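(* For a given bounded cost function $c:\mathcal X\to\mathbb R$, $$\sqrt N\big(S_\varepsilon(\hat\nu^N_1,\dots,\hat\nu^N_m)-S_\varepsilon(\nu_1,\dots,\nu_m)\big)\xrightarrow{w}\mathcal N(0,\sigma_\varepsilon^2)\qquad\text{as }N\to\infty,$$ where $\sigma_\varepsilon^2=\sum_{j=1}^m\mathrm{Var}_{X_j\sim\nu_j}(f_j^*(X_j))$.
   Context: Fix integers $m\ge 2$, $d\ge 1$ and $\varepsilon>0$; $[m]:=\{1,\dots,m\}$. For $j\in[m]$, $\mathcal X_j\subset[-1,1]^d$ is compact with non-empty interior, $\nu_j$ is a Borel probability measure on $\mathcal X_j$, and $\mathcal X=\prod_{j=1}^m\mathcal X_j$. $\Pi(\mu_1,\dots,\mu_m)$ is the set of probability measures on $\mathcal X$ with marginals $\mu_1,\dots,\mu_m$, and $\mathrm{KL}(P\|Q)=\int\log\frac{dP}{dQ}\,dP$ if $P\ll Q$, $+\infty$ otherwise. Define $$S_\varepsilon(\mu_1,\dots,\mu_m)=\inf_{\pi\in\Pi(\mu_1,\dots,\mu_m)}\int_{\mathcal X}c\,d\pi+\varepsilon\,\mathrm{KL}(\pi\|\otimes_{k=1}^m\mu_k).$$ Sampling model: for each $j$, $X^{(j)}_1,\dots,X^{(j)}_N$ are i.i.d. from $\nu_j$, the $m$ samples are independent, and $\hat\nu_j^N=\frac1N\sum_{k=1}^N\delta_{X_k^{(j)}}$. The optimal dual potentials $(f_1^*,\dots,f_m^* )\in\prod_jL^\infty(\nu_j)$ are the unique maximizer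 of $$\Phi_\varepsilon(f_1,\dots,f_m)=\sum_{j=1}^m\int f_j\,d\nu_j-\varepsilon\int\exp\Big(\frac{\sum_{j=1}^mf_j(x_j)-c(x)}{\varepsilon}\Big)d(\otimes_{k=1}^m\nu_k)(x)$$ over $\prod_jL^\infty(\nu_j)$ subject to the normalization $\nu_k(f^*_k)=\int f_k^*d\nu_k=0$ for $k\in[m-1]$ (maximizers are unique up to adding constants $c_j$ with $\sum_jc_j=0$). $\xrightarrow{w}$ denotes weak convergence (convergence in distribution). *)

(* Defs.v *)
From HB Require Import structures.
From mathcomp Require Import all_boot all_order all_algebra finmap.
From mathcomp Require Import all_classical all_reals all_analysis.

Set Implicit Arguments.
Unset Strict Implicit.
Unset Printing Implicit Defensive.

Import Order.TTheory GRing.Theory Num.Theory.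
Import numFieldNormedType.Exports.

Local Open Scope classical_set_scope.
Local Open Scope ring_scope.
Local Open Scope ereal_scope.

(* R^d with its Borel sigma-algebra. The carrier is convertible to 'rV[R]_d. *)
Definition borelRn (R : realType) (d : nat) :=
  g_sigma_algebraType (@open 'rV[R]_d).
HB.instance Definition _ R d := Measurable.on (borelRn R d).

Section product_probability.
Context d0 (T : measurableType d0) (R : realType).

Definition tuple_cons n (z : T * n.-tuple T) : n.+1.-tuple T :=
  [tuple of z.1 :: z.2].

Lemma measurable_tuple_cons n :
  measurable_fun [set: T * n.-tuple T] (@tuple_cons n).
Proof. exact: measurable_cons. Qed.

HB.instance Definition _ n :=
  isMeasurableFun.Build _ _ _ _ (@tuple_cons n) (@measurable_tuple_cons n).

(* The tensor product of mu_0, ..., mu_(m-1) on T^m, by iterating the binary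
   product; prod_prob_box below gives its values on boxes. *)
Fixpoint prod_prob m : ('I_m -> probability T R) -> probability (m.-tuple T) R :=
  if m is n.+1 then fun mu =>
    distribution (mu ord0 \x prod_prob (fun j => mu (lift ord0 j)))
                 (@tuple_cons n)
  else fun _ => \d_([tuple] : 0.-tuple T).

Definition box m (A : 'I_m -> set T) : set (m.-tuple T) :=
  [set x | forall j, A j (tnth x j)].

Lemma measurable_box m (A : 'I_m -> set T) :
  (forall j, measurable (A j)) -> measurable (box A).
Proof.
move=> mA; rewrite [box A](_ : _ = \bigcap_(j in [set: 'I_m])
    ((fun x : m.-tuple T => tnth x j) @^-1` A j)).
  apply: fin_bigcap_measurable => // j _; rewrite -[X in measurable X]setTI.
  exact: measurable_tnth.
by apply/seteqP; split => x /= Ax j => [_|]; apply: Ax.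
Qed.

Lemma prod_prob_box m (mu : 'I_m -> probability T R) (A : 'I_m -> set T) :
  (forall j, measurable (A j)) ->
  prod_prob mu (box A) = \prod_(j < m) mu j (A j).
Proof.
elim: m mu A => [|n IH] mu A mA.
  by rewrite big_ord0 /= diracE mem_set//= => -[].
rewrite big_ord_recl /= /distribution /pushforward -IH//.
rewrite -product_measure1E//; last exact: measurable_box.
congr (_ _); apply/seteqP; split => -[x y] /=.
  move=> h; split; first by have := h ord0.
  by move=> j; have := h (lift ord0 j); rewrite tnthS.
by move=> [Ax Ay] j; case: (unliftP ord0 j) => [k|] -> //=; rewrite tnthS.
Qed.

End product_probability.

Section entropic_transport.
Context d0 (T : measurableType d0) (R : realType) (m : nat).
Implicit Types (A : 'I_m -> set T) (c : m.-tuple T -> R).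

(* Probability measures on box A are encoded as probability measures on T^m
   giving mass 1 to box A. *)
Definition coupling A (mu : 'I_m -> probability T R) :
    set (probability (m.-tuple T) R) :=
  [set pi | pi (box A) = 1 /\
    forall j (B : set T), measurable B ->
      pi ((fun x => tnth x j) @^-1` B) = mu j B].

Definition KL d (U : measurableType d) (P Q : probability U R) : \bar R :=
  if `[< P `<< Q >] then
    \int[P]_x lne (Radon_Nikodym (charge_of_finite_measure P) Q x)
  else +oo.

(* Finite whenever c is bounded on box A and every mu j gives mass 1 to A j:
   the product measure is then a coupling with KL = 0, and KL >= 0. *)
Definition eot A c (eps : R) (mu : 'I_m -> probability T R) : \bar R :=
  ereal_inf [set \int[pi]_(x in box A) (c x)%:E + eps%:E * KL pi (prod_prob mu)
            | pi in coupling A mu].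

Definition dual_objective A c (eps : R) (nu : 'I_m -> probability T R)
    (f : 'I_m -> T -> R) : \bar R :=
  \sum_(j < m) \int[nu j]_x (f j x)%:E -
  eps%:E * \int[prod_prob nu]_(x in box A)
    (expR ((\sum_(j < m) f j (tnth x j) - c x) / eps))%:E.

(* L^oo(nu_j) is represented by functions on T, of which only the
   nu_j-a.e. class matters. The normalization leaves the last potential free. *)
Definition normalized_potentials (nu : 'I_m -> probability T R)
    (f : 'I_m -> T -> R) :=
  (forall j, f j \in Lfun (nu j) +oo) /\
  (forall k : 'I_m, (k.+1 < m)%N -> \int[nu k]_x (f k x)%:E = 0).

Definition optimal_potentials A c eps nu (f : 'I_m -> T -> R) :=
  normalized_potentials nu f /\
  forall g, normalized_potentials nu g ->
    dual_objective A c eps nu g <= dual_objective A c eps nu f.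

End entropic_transport.

Section sampling.
Context d0 (T : measurableType d0) (R : realType).

(* The empirical measure of the n.+1 points x 0, ..., x n. *)
Definition empirical (n : nat) (x : nat -> T) : set T -> \bar R :=
  mscale (n.+1%:R^-1%:nng)%R (msum (fun k => \d_(x k)) n.+1).

HB.instance Definition _ n x := Measure.on (empirical n x).

Let empirical_setT n x : empirical n x [set: T] = 1.
Proof.
rewrite /empirical /mscale /= /msum.
rewrite (eq_bigr (fun=> 1)) => [|k _]; last by rewrite /= diracT.
by rewrite sumEFin -EFinM sumr_const card_ord mulVf ?pnatr_eq0.
Qed.

HB.instance Definition _ n x :=
  Measure_isProbability.Build _ _ _ (empirical n x) (empirical_setT n x).

Context dO (Om : measurableType dO) (P : probability Om R).

(* Mutual independence: the product rule over every finite subfamily. *)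
Definition independent_RVs (I : choiceType) (X : I -> {RV P >-> T}) :=
  forall (J : {fset I}) (B : I -> set T), (forall i, measurable (B i)) ->
    P (\bigcap_(i in [set` J]) (X i @^-1` B i)) =
    \prod_(i <- J) P (X i @^-1` B i).

End sampling.

(* The library's normal_prob m 0 is not the Dirac mass at m, which is what
   N(m, 0) means. *)
Definition gaussian (R : realType) (m v : R) :
    probability (measurableTypeR R) R :=
  if v == 0%R then (\d_(m : measurableTypeR R) : probability (measurableTypeR R) R)
  else (normal_prob m (Num.sqrt v) : probability (measurableTypeR R) R).

Definition cvg_in_law d (Om : measurableType d) (R : realType)
    (P : probability Om R) (Y : nat -> Om -> R)
    (mu : probability (measurableTypeR R) R) :=
  (forall n, measurable_fun [set: Om] (Y n)) /\
  forall h : R -> R, continuous h -> bounded_fun h ->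
    \int[P]_w (h (Y n w))%:E @[n --> \oo] --> \int[mu]_x (h x)%:E.

(* Main.v *)
Require Import Defs.
From HB Require Import structures.
From mathcomp Require Import all_boot all_order all_algebra finmap.
From mathcomp Require Import all_classical all_reals all_analysis.
From mathcomp Require Import perm measurable_realfun ess_sup_inf.
From mathcomp Require Import ring lra.

(** Up to an error whose expectation is O(1/N), the value of the empirical problem
    is the sum of the empirical means of the optimal potentials. After
    multiplication by sqrt N the error is negligible, and what is left is a central
    limit theorem for independent bounded variables.

    Duality. Perturbing the optimal potentials f_j by indicator functions shows that
    p = exp ((sum_j f_j - c) / eps) is a density, relative to the product of the
    nu_j, of a coupling of the nu_j ([optimal_marginals]). This coupling attains the
    lower bound of weak duality ([eot_ge]), hence S(nu) = sum_j nu_j(f_j)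
    ([eot_optimal]). All potentials are replaced by bounded measurable
    representatives, so that p lies between two positive constants.

    Empirical problem. When the sample lies in X, the infimum over the couplings of
    the empirical measures is an infimum over the nonnegative functions q of the
    multi-indices i = (i_1, ..., i_m) with all marginal averages equal to 1
    ([eot_empirical]). Substituting c = sum_j f_j - eps ln p turns the objective into
      sum_j hat nu_j(f_j) + eps avg (q ln (q / p)).
    The inequality ln x <= x - 1 bounds the last average below by 1 - avg p, and
    above by 1 - avg p + avg ((q - p)^2 / p). As p has almost the right marginal
    averages, a small correction of it has exactly the right ones: [rounding] finds
    q with avg (q - p)^2 = O(eta), where eta is the sum of the mean squared marginal
    errors of p. Thus the empirical value differs from sum_j hat nu_j(f_j) by
    O(|1 - avg p| + eta) ([index_value_linearization]).

    Fluctuations. Since p has marginals nu_j, the function p - 1 has conditional mean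
    0 given any one coordinate. Its values at two multi-indices are therefore
    uncorrelated unless the multi-indices share at least two coordinates
    ([expect_degenerate]), which happens for a proportion O(1/N^2) of the pairs.
    It follows that E (1 - avg p)^2 = O(1/N^2) and E eta = O(1/N) ([expect_error]).

    Central limit theorem. Lindeberg's replacement of the summands by Gaussian
    variables, one at a time, compares the expectations of functions with a uniform
    third-order Taylor bound ([lindeberg]). Such functions determine convergence in
    law because averaging a Lipschitz minorant of a bounded continuous function three
    times over short intervals gives one of them ([cvg_in_law_taylor3]). A vanishing
    variance is the case where the Gaussian law is a Dirac mass.

    Measurability of the empirical value comes from its being a Lipschitz function of
    the costs at the sample points ([index_value_lipschitz]), on the almost sure event
    that the sample lies in X, and constant elsewhere ([fine_eot_outside]). *)

Set Implicit Arguments.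
Unset Strict Implicit.
Unset Printing Implicit Defensive.

Import Order.TTheory GRing.Theory Num.Theory.
Import numFieldNormedType.Exports.

Local Open Scope classical_set_scope.
Local Open Scope ring_scope.

(** * Bounded measurable functions and their expectations *)

Section bounded_measurable.
Context d (T : measurableType d) (R : realType).
Implicit Types (f g : T -> R).

(** This class is stable under all the operations below and integrable for every
    probability, so that expectations of its members need no side condition. *)
Definition bmeas f := measurable_fun setT f /\ exists K, forall x, `|f x| <= K.

Lemma bmeas_meas f : bmeas f -> measurable_fun setT f.
Proof. by case. Qed.

Lemma bmeas_cst (k : R) : bmeas (fun=> k).
Proof. by split; [exact: measurable_cst | exists `|k|]. Qed.

Lemma bmeasD f g : bmeas f -> bmeas g -> bmeas (fun x => f x + g x).
Proof.
move=> [mf [K hK]] [mg [L hL]]; split; first exact: measurable_funD.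
by exists (K + L) => x; rewrite (le_trans (ler_normD _ _))// lerD.
Qed.

Lemma bmeasN f : bmeas f -> bmeas (fun x => - f x).
Proof.
move=> [mf [K hK]]; split; first exact: measurableT_comp.
by exists K => x; rewrite normrN.
Qed.

Lemma bmeasB f g : bmeas f -> bmeas g -> bmeas (fun x => f x - g x).
Proof. by move=> bf bg; apply: bmeasD => //; exact: bmeasN. Qed.

Lemma bmeasM f g : bmeas f -> bmeas g -> bmeas (fun x => f x * g x).
Proof.
move=> [mf [K hK]] [mg [L hL]]; split; first exact: measurable_funM.
by exists (K * L) => x; rewrite normrM ler_pM.
Qed.

Lemma bmeasZ k f : bmeas f -> bmeas (fun x => k * f x).
Proof. by move=> bf; apply: bmeasM => //; exact: bmeas_cst. Qed.

Lemma bmeas_norm f : bmeas f -> bmeas (fun x => `|f x|).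
Proof.
move=> [mf [K hK]]; split; first exact: measurableT_comp.
by exists K => x; rewrite normr_id.
Qed.

Lemma bmeasX n f : bmeas f -> bmeas (fun x => f x ^+ n).
Proof.
move=> bf; elim: n => [|n IH]; first exact: bmeas_cst.
by under eq_fun do rewrite exprS; exact: bmeasM.
Qed.

Lemma bmeas_sum (I : Type) (r : seq I) (Q : pred I) (F : I -> T -> R) :
  (forall i, Q i -> bmeas (F i)) -> bmeas (fun x => \sum_(i <- r | Q i) F i x).
Proof.
move=> bF; elim: r => [|i r IH].
  by under eq_fun do rewrite big_nil; exact: bmeas_cst.
case Qi : (Q i); under eq_fun do rewrite big_cons Qi; last exact: IH.
by apply: bmeasD => //; exact: bF.
Qed.

Lemma bmeas_indic (B : set T) : measurable B -> bmeas (\1_B : T -> R).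
Proof.
move=> mB; split; first exact: measurable_indic.
by exists 1 => x; rewrite indicE; case: (_ \in _); rewrite ?normr1 ?normr0.
Qed.

Lemma bmeas_expR f : bmeas f -> bmeas (fun x => expR (f x)).
Proof.
move=> [mf [K hK]]; split; first exact: measurableT_comp.
exists (expR K) => x; rewrite ger0_norm ?expR_ge0// ler_expR.
exact: le_trans (ler_norm _) (hK x).
Qed.

End bounded_measurable.

Lemma bmeas_comp d d' (T : measurableType d) (U : measurableType d')
    (R : realType) (f : U -> R) (X : T -> U) :
  bmeas f -> measurable_fun setT X -> bmeas (fun x => f (X x)).
Proof.
by move=> [mf [K hK]] mX; split; [exact: measurableT_comp|exists K => x].
Qed.

Section expectation.
Context d (T : measurableType d) (R : realType) (P : probability T R).
Implicit Types (f g : T -> R).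

Lemma bmeas_integrable f : bmeas f -> P.-integrable setT (EFin \o f).
Proof.
move=> [mf [K hK]]; apply: measurable_bounded_integrable => //.
  by move: (@probability_setT _ _ _ P); rewrite /= => ->; rewrite ltry.
exists K; split; first exact: num_real.
by move=> M KM x _; exact: le_trans (hK x) (ltW KM).
Qed.

Lemma Rintegral_EFin f : bmeas f ->
  (\int[P]_x f x)%:E = (\int[P]_x (f x)%:E)%E.
Proof.
move=> bf; rewrite /Rintegral fineK//.
by apply: integrable_fin_num => //; exact: bmeas_integrable.
Qed.

Lemma expect_cst (k : R) : \int[P]_x k = k.
Proof. by rewrite Rintegral_cst//= probability_setT/= mulr1. Qed.

Lemma expectD f g : bmeas f -> bmeas g ->
  \int[P]_x (f x + g x) = \int[P]_x f x + \int[P]_x g x.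
Proof. by move=> bf bg; apply: RintegralD => //; exact: bmeas_integrable. Qed.

Lemma expectB f g : bmeas f -> bmeas g ->
  \int[P]_x (f x - g x) = \int[P]_x f x - \int[P]_x g x.
Proof. by move=> bf bg; apply: RintegralB => //; exact: bmeas_integrable. Qed.

Lemma expectZ k f : bmeas f -> \int[P]_x (k * f x) = k * \int[P]_x f x.
Proof. by move=> bf; apply: RintegralZl => //; exact: bmeas_integrable. Qed.

Lemma expect_sum (I : Type) (r : seq I) (Q : pred I) (F : I -> T -> R) :
  (forall i, Q i -> bmeas (F i)) ->
  \int[P]_x (\sum_(i <- r | Q i) F i x) = \sum_(i <- r | Q i) \int[P]_x F i x.
Proof.
move=> bF; elim: r => [|i r IH].
  by under eq_Rintegral do rewrite big_nil; rewrite expect_cst big_nil.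
case Qi : (Q i); under eq_Rintegral do rewrite big_cons Qi;
  rewrite big_cons Qi//.
by rewrite expectD ?IH//; [exact: bF|exact: bmeas_sum].
Qed.

Lemma expect_le f g : bmeas f -> bmeas g -> (forall x, f x <= g x) ->
  \int[P]_x f x <= \int[P]_x g x.
Proof.
by move=> bf bg fg; apply: le_Rintegral => //; exact: bmeas_integrable.
Qed.

Lemma expect_norm f : bmeas f -> `|\int[P]_x f x| <= \int[P]_x `|f x|.
Proof. by move=> bf; apply: le_normr_Rintegral => //; exact: bmeas_integrable. Qed.

Lemma expect_bound f K : bmeas f -> (forall x, `|f x| <= K) ->
  `|\int[P]_x f x| <= K.
Proof.
move=> bf fK; rewrite (le_trans (expect_norm bf))// -[leRHS](expect_cst K).
by apply: expect_le => //; [exact: bmeas_norm | exact: bmeas_cst].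
Qed.

Lemma expect_ae_eq f g : bmeas f -> bmeas g -> {ae P, forall x, f x = g x} ->
  \int[P]_x f x = \int[P]_x g x.
Proof.
move=> bf bg fg; congr fine; apply: ae_eq_integral => //.
- by apply/measurable_EFinP; exact: bmeas_meas.
- by apply/measurable_EFinP; exact: bmeas_meas.
- by apply: filterS fg => x /= -> _.
Qed.

Lemma expect_indic (B : set T) : measurable B ->
  \int[P]_x (\1_B x : R) = fine (P B).
Proof. by move=> mB; rewrite /Rintegral integral_indic// setIT. Qed.

End expectation.

Lemma expect_distribution d d' (T : measurableType d) (U : measurableType d')
    (R : realType) (P : probability T R) (X : {RV P >-> U}) (f : U -> R) :
  bmeas f -> \int[distribution P X]_y f y = \int[P]_x f (X x).
Proof.
move=> bf; congr fine; rewrite integral_distribution//.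
  by apply/measurable_EFinP; exact: bmeas_meas bf.
exact: (bmeas_integrable P (bmeas_comp bf (measurable_funPT X))).
Qed.

Lemma expect_eq_measure d (T : measurableType d) (R : realType)
    (P Q : probability T R) (f : T -> R) :
  (forall B, measurable B -> P B = Q B) -> \int[P]_x f x = \int[Q]_x f x.
Proof.
by move=> PQ; congr fine; apply: eq_measure_integral => B mB _; exact: PQ.
Qed.

Section fubini.
Context d1 d2 (T1 : measurableType d1) (T2 : measurableType d2) (R : realType).
Variables (P1 : probability T1 R) (P2 : probability T2 R) (f : T1 * T2 -> R).
Hypothesis bf : bmeas f.

Lemma bmeas_pair1 x : bmeas (fun y => f (x, y)).
Proof. by apply: (bmeas_comp bf); exact: measurable_pair1. Qed.

Lemma bmeas_pair2 y : bmeas (fun x => f (x, y)).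
Proof. by apply: (bmeas_comp bf); exact: measurable_pair2. Qed.

Lemma bmeas_fubini1 : bmeas (fun x => \int[P2]_y f (x, y)).
Proof.
have [mf [K hK]] := bf; split.
  apply/measurable_EFinP.
  rewrite (_ : _ \o _ = fubini_F P2 (EFin \o f)).
    apply: measurable_fubini_F; exact: (bmeas_integrable (P1 \x P2)%E bf).
  by apply/funext => x /=; rewrite Rintegral_EFin//; exact: bmeas_pair1.
by exists K => x; apply: expect_bound => //; exact: bmeas_pair1.
Qed.

Lemma bmeas_fubini2 : bmeas (fun y => \int[P1]_x f (x, y)).
Proof.
have [mf [K hK]] := bf; split.
  apply/measurable_EFinP.
  rewrite (_ : _ \o _ = fubini_G P1 (EFin \o f)).
    apply: measurable_fubini_G; exact: (bmeas_integrable (P1 \x P2)%E bf).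
  by apply/funext => x /=; rewrite Rintegral_EFin//; exact: bmeas_pair2.
by exists K => x; apply: expect_bound => //; exact: bmeas_pair2.
Qed.

Lemma expect_prod1 :
  \int[(P1 \x P2)%E]_z f z = \int[P1]_x \int[P2]_y f (x, y).
Proof.
rewrite /Rintegral; congr fine.
have := integral12_prod_meas1 (bmeas_integrable (P1 \x P2)%E bf) => /= <-.
by apply: eq_integral => x _; exact: esym (Rintegral_EFin P2 (bmeas_pair1 x)).
Qed.

Lemma expect_prod2 :
  \int[(P1 \x P2)%E]_z f z = \int[P2]_y \int[P1]_x f (x, y).
Proof.
rewrite /Rintegral; congr fine.
have := integral21_prod_meas1 (bmeas_integrable (P1 \x P2)%E bf) => /= <-.
by apply: eq_integral => y _; exact: esym (Rintegral_EFin P1 (bmeas_pair2 y)).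
Qed.

End fubini.

(** * Product laws and independent samples *)

Section laws.
Context d d' (T : measurableType d) (U : measurableType d') (R : realType).

(** Only the law of X enters, so that an expectation may be computed on any
    space carrying that law; this is how independence is used below. *)
Lemma expect_law (P : probability T R) (Q : probability U R) (X : T -> U) f :
  measurable_fun setT X ->
  (forall B, measurable B -> Q B = P (X @^-1` B)) -> bmeas f ->
  \int[Q]_y f y = \int[P]_x f (X x).
Proof.
move=> mX QP bf; rewrite -(expect_distribution (P := P) (mfun_Sub (mem_set mX)) bf).
exact: expect_eq_measure.
Qed.

End laws.

Section boxes.
Context d (T : measurableType d) (R : realType).

Definition boxes m : set (set (m.-tuple T)) :=
  [set box A | A in [set A : 'I_m -> set T | forall j, measurable (A j)]].

Lemma box_setT m : box (fun=> setT) = [set: m.-tuple T].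
Proof. by apply/seteqP; split. Qed.

Lemma measurable_tupleE m :
  measurable = <<s @boxes m >> :> set (set (m.-tuple T)).
Proof.
apply/seteqP; split; last first.
  apply: smallest_sub; first exact: sigma_algebra_measurable.
  by move=> _ [A mA <-]; exact: measurable_box.
apply: smallest_sub; first exact: smallest_sigma_algebra.
rewrite -bigcup_seq => _ [i _ [B mB <-]]; apply: sub_gen_smallest.
exists (fun j => if j == i then B else setT) => [j|]; first by case: ifP.
apply/seteqP; split => [x Bx|x [_ Bx] j /=].
  by split => //=; have := Bx i; rewrite eqxx.
by case: eqP => // ->.
Qed.

(** The boxes generate the sigma-algebra and are stable under intersection. *)
Lemma prod_prob_unique m (mu : 'I_m -> probability T R)
    (Q : probability (m.-tuple T) R) :
  (forall A : 'I_m -> set T, (forall j, measurable (A j)) ->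
    Q (box A) = (\prod_(j < m) mu j (A j))%E) ->
  forall E, measurable E -> prod_prob mu E = Q E.
Proof.
move=> QA E mE.
apply: (measure_unique (@boxes m) (fun=> setT)) => //.
- exact: measurable_tupleE.
- move=> _ _ [A mA <-] [B mB <-].
  exists (fun j => A j `&` B j) => [j|]; first exact: measurableI.
  apply/seteqP; split => [x ABx|x [Ax Bx] j]; last by split.
  by split => j; have [] := ABx j.
- by move=> _; exists (fun=> setT) => //; exact: box_setT.
- by apply/seteqP; split => // x _; exists 0%N.
- by move=> _ [A mA <-]; exact: etrans (prod_prob_box mu mA) (esym (QA A mA)).
- by move=> _ /=; exact: le_lt_trans (probability_le1 _ measurableT) (ltry _).
Qed.

Lemma prod_prob_tnth m (mu : 'I_m -> probability T R) j B : measurable B ->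
  prod_prob mu ((fun x => tnth x j) @^-1` B) = mu j B.
Proof.
move=> mB; pose A k := if k == j then B else setT.
rewrite (_ : _ @^-1` _ = box A); last first.
  apply/seteqP; split => [x Bx k|x /(_ j)]; rewrite /A/= ?eqxx//.
  by case: eqP => // ->.
rewrite prod_prob_box => [|k]; last by rewrite /A; case: ifP.
rewrite (bigD1 j)//= /A eqxx big1 ?mule1// => k /negbTE ->.
exact: probability_setT.
Qed.

Lemma expect_prod_prob_cons n (mu : 'I_n.+1 -> probability T R)
    (f : n.+1.-tuple T -> R) : bmeas f ->
  \int[prod_prob mu]_x f x =
  \int[mu ord0]_x \int[prod_prob (fun j => mu (lift ord0 j))]_y
    f [tuple of x :: y].
Proof.
move=> bf; rewrite /= (expect_distribution (@tuple_cons _ T n) bf).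
have bg : bmeas (fun z => f (@tuple_cons _ T n z)).
  by apply: (bmeas_comp bf); exact: measurable_tuple_cons.
exact: (expect_prod1 _ _ bg).
Qed.

Lemma bmeas_tnth n (g : T -> R) k : bmeas g ->
  bmeas (fun x : n.-tuple T => g (tnth x k)).
Proof. by move=> bg; apply: (bmeas_comp bg); exact: measurable_tnth. Qed.

End boxes.

Section independence.
Context d (T : measurableType d) (R : realType).
Context dO (Om : measurableType dO) (P : probability Om R).
Context (I : choiceType) (X : I -> {RV P >-> T}) (nu : I -> probability T R).
Hypothesis X_indep : independent_RVs X.
Hypothesis X_law : forall i B, measurable B -> P (X i @^-1` B) = nu i B.

Definition sample n (s : n.-tuple I) (w : Om) : n.-tuple T :=
  [tuple X (tnth s k) w | k < n].

Lemma measurable_sample n (s : n.-tuple I) : measurable_fun setT (sample s).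
Proof.
apply/measurable_fun_tnthP => k.
rewrite (_ : _ \o _ = X (tnth s k)); first exact: measurable_funPT.
by apply/funext => w /=; rewrite tnth_mktuple.
Qed.

Lemma sample_cons n i (s : n.-tuple I) w :
  sample [tuple of i :: s] w = [tuple of X i w :: sample s w].
Proof.
apply: eq_from_tnth => k; rewrite tnth_mktuple.
by have [j ->|->] := unliftP ord0 k; rewrite ?tnthS ?tnth0// tnth_mktuple.
Qed.

(** The definition of independence gives the law on boxes. *)
Lemma law_sample n (s : n.-tuple I) E : uniq s -> measurable E ->
  prod_prob (fun k => nu (tnth s k)) E = P (sample s @^-1` E).
Proof.
move=> us mE; pose XS := mfun_Sub (mem_set (measurable_sample s)).
rewrite -[RHS]/(distribution P XS E).
apply: prod_prob_unique => // A mA; change (P (sample s @^-1` box A) = \prod_(j < n) nu (tnth s j) (A j))%E.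
(* The definition of independence asks for sets attached to indices of variables. *)
pose B i := nth setT [seq A k | k <- enum 'I_n] (index i s).
have BE k : B (tnth s k) = A k.
  rewrite /B {1}(tnth_nth (tnth s k)) index_uniq ?size_tuple// (nth_map k).
    by rewrite nth_ord_enum.
  by rewrite size_enum_ord.
have mB i : measurable (B i).
  rewrite /B; have [h|h] := ltnP (index i s) (size [seq A k | k <- enum 'I_n]).
    by have /mapP[k _ ->] := mem_nth setT h.
  by rewrite nth_default.
rewrite (_ : _ @^-1` _ = \bigcap_(i in [set` seq_fset tt s]) (X i @^-1` B i)).
  rewrite X_indep// (perm_big (val s)) /=; last first.
    by have := seq_fset_perm tt s; rewrite (undup_id us).
  by rewrite big_tuple; apply: eq_bigr => k _; rewrite BE X_law.
apply/seteqP; split => [w Aw i|w Bw k].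
  change (i \in seq_fset tt s -> B i (X i w)).
  rewrite seq_fsetE => /tnthP[k ->]; rewrite BE; have := Aw k.
  by rewrite tnth_mktuple.
rewrite tnth_mktuple -BE; apply: (Bw (tnth s k)); change (tnth s k \in seq_fset tt s).
by rewrite seq_fsetE mem_tnth.
Qed.

Lemma expect_sample n (s : n.-tuple I) (F : n.-tuple T -> R) : uniq s ->
  bmeas F ->
  \int[P]_w F (sample s w) = \int[prod_prob (fun k => nu (tnth s k))]_x F x.
Proof.
move=> us bF; apply/esym/expect_law => //; first exact: measurable_sample.
by move=> B mB; exact: law_sample.
Qed.

Lemma expect_freeze1 i n (s : n.-tuple I) (F : T * n.-tuple T -> R) :
  uniq (i :: s) -> bmeas F ->
  \int[P]_w F (X i w, sample s w) =
  \int[P]_w \int[nu i]_y F (y, sample s w).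
Proof.
move=> us bF; have [_ us'] := andP us.
pose G (x : n.+1.-tuple T) := F (thead x, [tuple of behead x]).
have bG : bmeas G.
  apply: (bmeas_comp bF); apply/measurable_fun_pair.
    exact: measurable_tnth.
  exact: measurable_behead.
have GE y (x : n.-tuple T) : G [tuple of y :: x] = F (y, x).
  by rewrite /G theadE; congr (F (_, _)); apply: val_inj.
transitivity (\int[P]_w G (sample [tuple of i :: s] w)).
  by apply: eq_Rintegral => w _; rewrite sample_cons GE.
rewrite expect_sample// expect_prod_prob_cons//=.
have bG2 := bmeas_fubini2 (nu i) (prod_prob (fun k => nu (tnth s k))) bF.
rewrite (expect_sample us' bG2) -expect_prod2// expect_prod1//.
have -> : (fun j => nu (tnth [tuple of i :: s] (lift ord0 j))) =
    (fun k => nu (tnth s k)) by apply/funext => k; rewrite tnthS.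
by apply: eq_Rintegral => y _; apply: eq_Rintegral => x _; rewrite GE.
Qed.

(** Independence in the form of Fubini's theorem: it allows the mean over some of the
    sample points to be taken first, the others being held fixed. *)
Lemma expect_freeze n (s2 : n.-tuple I) k (s1 : k.-tuple I)
    (F : k.-tuple T * n.-tuple T -> R) :
  uniq (s2 ++ s1) -> bmeas F ->
  \int[P]_w F (sample s1 w, sample s2 w) =
  \int[P]_w \int[prod_prob (fun l => nu (tnth s2 l))]_y F (sample s1 w, y).
Proof.
elim: n s2 k s1 F => [|n IH] s2 k s1 F us bF.
  apply: eq_Rintegral => w _; rewrite /Rintegral integral_dirac//; last first.
    by apply/measurable_EFinP; exact: bmeas_meas (bmeas_pair1 bF _).
  by rewrite diracT mul1e/= (tuple0 (sample s2 w)).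
case/tupleP: s2 us => b s2 us.
have us0 : uniq (b :: (val s2 ++ val s1)) := us.
have us1 : uniq (b :: s1).
  move: us0; rewrite /= mem_cat negb_or cat_uniq.
  by move=> /andP[/andP[_ ->] /and3P[_ _ ->]].
have us2 : uniq (s2 ++ [tuple of b :: s1]).
  by rewrite /= -[b :: s1]cat1s uniq_catCA.
pose F' (z : k.+1.-tuple T * n.-tuple T) :=
  F ([tuple of behead z.1], [tuple of thead z.1 :: z.2]).
have bF' : bmeas F'.
  apply: (bmeas_comp bF); apply/measurable_fun_pair => /=.
    exact: (measurableT_comp (@measurable_behead _ T k) measurable_fst).
  apply: measurable_cons => //=.
  exact: (measurableT_comp (@measurable_tnth _ T k.+1 ord0) measurable_fst).
have F'E z (u : k.-tuple T) (v : n.-tuple T) : F' ([tuple of z :: u], v) = F (u, [tuple of z :: v]).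
  rewrite /F'/=; congr (F (_, _)); apply: val_inj => //=.
transitivity (\int[P]_w F' (sample [tuple of b :: s1] w, sample s2 w)).
  by apply: eq_Rintegral => w _; rewrite !sample_cons F'E.
rewrite IH//.
pose mu2 := prod_prob (fun l => nu (tnth s2 l)).
pose G (z : T * k.-tuple T) := \int[mu2]_y F' ([tuple of z.1 :: z.2], y).
have bG : bmeas G.
  have bG' : bmeas (fun z => \int[mu2]_y F' (z, y)).
    have := bmeas_fubini1 (prod_prob (fun l => nu (tnth [tuple of b :: s1] l))) mu2 bF'.
    by [].
  by apply: (bmeas_comp bG'); exact: measurable_cons.
transitivity (\int[P]_w G (X b w, sample s1 w)).
  by apply: eq_Rintegral => w _; rewrite sample_cons.
rewrite expect_freeze1//; apply: eq_Rintegral => w _.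
rewrite expect_prod_prob_cons/=; last exact: bmeas_pair1.
have -> : (fun j => nu (tnth [tuple of b :: s2] (lift ord0 j))) =
    (fun k => nu (tnth s2 k)) by apply/funext => l; rewrite tnthS.
by apply: eq_Rintegral => y _; apply: eq_Rintegral => x _; rewrite F'E.
Qed.

End independence.

(** * Densities, and functions with a uniform third-order Taylor bound *)

Section density.
Local Open Scope ereal_scope.
Context d (T : measurableType d) (R : realType) (P : probability T R)
  (mu : {sigma_finite_measure set T -> \bar R}) (g : T -> R).
Hypotheses (mg : measurable_fun setT g) (g0 : forall x, (0 <= g x)%R).
Hypothesis Pg : forall B, measurable B -> P B = \int[mu]_(x in B) (g x)%:E.

Lemma density_dominates : P `<< mu.
Proof.
apply/null_content_dominatesP => B mB muB; rewrite Pg//.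
by apply: null_set_integral => //; apply/measurable_EFinP/measurable_funTS.
Qed.

Lemma density_Radon_Nikodym :
  ae_eq mu setT (Radon_Nikodym (charge_of_finite_measure P) mu) (EFin \o g).
Proof.
apply: integral_ae_eq => //.
- exact/Radon_Nikodym_integrable/density_dominates.
- exact/measurable_EFinP.
- move=> B _ mB; rewrite -Radon_Nikodym_integral//; first exact: Pg.
  exact: density_dominates.
Qed.

(** A density is almost everywhere the Radon-Nikodym derivative, for which the
    change of variables is known. *)
Lemma ge0_integral_density f : measurable_fun setT f -> (forall x, 0 <= f x) ->
  \int[P]_x f x = \int[mu]_x (f x * (g x)%:E).
Proof.
move=> mf f0.
rewrite -(Radon_Nikodym_SigmaFinite.change_of_variables density_dominates)//.
apply: ae_eq_integral => //.
- apply: emeasurable_funM => //; apply: measurable_int.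
  exact: Radon_Nikodym_SigmaFinite.f_integrable density_dominates.
- by apply: emeasurable_funM => //; exact/measurable_EFinP.
- apply: ae_eqe_mul2l; apply: ae_eq_trans _ density_Radon_Nikodym.
  exact: (ae_eq_Radon_Nikodym_SigmaFinite density_dominates).
Qed.

Lemma integrable_density f :
  measurable_fun setT f -> mu.-integrable setT (fun x => f x * (g x)%:E) ->
  P.-integrable setT f.
Proof.
move=> mf /integrableP[_ fg]; apply/integrableP; split => //.
rewrite ge0_integral_density//; last exact: measurableT_comp.
apply: le_lt_trans fg; rewrite le_eqVlt; apply/orP; left; apply/eqP.
apply: eq_integral => x _.
by rewrite abseM; congr (_ * _); rewrite gee0_abs// lee_fin.
Qed.

Lemma integral_density f : P.-integrable setT f ->
  \int[P]_x f x = \int[mu]_x (f x * (g x)%:E).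
Proof.
move=> itf; rewrite -(Radon_Nikodym_change_of_variables density_dominates)//.
have mf := measurable_int _ itf.
apply: ae_eq_integral => //.
- by apply: emeasurable_funM => //; apply: measurable_int;
    exact/Radon_Nikodym_integrable/density_dominates.
- by apply: emeasurable_funM => //; exact/measurable_EFinP.
- by apply: ae_eqe_mul2l; exact: density_Radon_Nikodym.
Qed.

End density.

Section taylor_class.
Context (R : realType).
Implicit Types (h : R -> R).

(** The functions h1 and h2 are not asked to be derivatives, so that averages of
    translates inherit the expansion by integrating it. *)
Definition taylor3 (K : R) h := bmeas h /\ exists h1 h2, [/\ bmeas h1, bmeas h2 &
  forall x t, `|h (x + t) - h x - t * h1 x - t ^+ 2 / 2 * h2 x| <= K * `|t| ^+ 3].

Lemma bmeas_translate h x : bmeas h -> bmeas (fun y : R => h (x + y)).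
Proof. by move=> bh; apply: (bmeas_comp bh); exact: measurable_funD. Qed.

Lemma bmeas_average d (T : measurableType d) (P : probability T R) (u : T -> R) h :
  measurable_fun setT u -> bmeas h -> bmeas (fun x : R => \int[P]_y h (x + u y)).
Proof.
move=> mu bh.
have bF : bmeas (fun z : measurableTypeR R * T => h (z.1 + u z.2)).
  apply: (bmeas_comp bh); apply: measurable_funD => //.
  exact: measurableT_comp mu measurable_snd.
have := bmeas_fubini1 (\d_(0 : measurableTypeR R) : probability (measurableTypeR R) R) P bF.
exact.
Qed.

Lemma taylor3_average d (T : measurableType d) (P : probability T R) (u : T -> R) K h :
  measurable_fun setT u -> taylor3 K h ->
  taylor3 K (fun x => \int[P]_y h (x + u y)).
Proof.
move=> mu [bh [h1 [h2 [bh1 bh2 hK]]]]; split; first exact: bmeas_average.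
exists (fun x => \int[P]_y h1 (x + u y)), (fun x => \int[P]_y h2 (x + u y)).
split; [exact: bmeas_average|exact: bmeas_average|move=> x t].
have bu g z : bmeas g -> bmeas (fun y => g (z + u y)).
  by move=> bg; apply: (bmeas_comp bg); exact: measurable_funD.
rewrite -!expectZ; [|exact: bu..].
rewrite -!expectB; [|repeat first [exact: bu|apply: bmeasZ|apply: bmeasB]..].
apply: expect_bound => [|y].
  by repeat first [exact: bu|apply: bmeasZ|apply: bmeasB].
by have := hK (x + u y) t; rewrite [x + u y + t]addrAC.
Qed.

(** All that Lindeberg's replacement has to know of a summand: two summands with the
    same v are exchanged at a cost depending on their bounds B only. *)
Definition centred d (T : measurableType d) (P : probability T R) (u : T -> R)
    (v B : R) := [/\ measurable_fun setT u,
  P.-integrable setT (fun x => (u x)%:E),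
  P.-integrable setT (fun x => (u x ^+ 2)%:E) &
  P.-integrable setT (fun x => (`|u x| ^+ 3)%:E)] /\
  [/\ \int[P]_x u x = 0, \int[P]_x (u x ^+ 2) = v &
  \int[P]_x (`|u x| ^+ 3) <= B].

(** The first-order term of the expansion disappears because u has mean 0. The function
    h2 is chosen before the law of u, so that two laws with the same variance give
    the same second-order term. *)
Lemma taylor3_perturb K h : 0 <= K -> taylor3 K h ->
  exists h2 : R -> R, forall d (T : measurableType d) (P : probability T R) u v B,
  centred P u v B -> forall x,
  `|\int[P]_y h (x + u y) - h x - v / 2 * h2 x| <= K * B.
Proof.
move=> K0 [bh [h1 [h2 [bh1 bh2 hK]]]]; exists h2.
move=> d T P u v B [[mu i1 i2 i3] [e1 e2 e3]] x.
have ih : P.-integrable setT (fun y => (h (x + u y))%:E).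
  apply: (bmeas_integrable P (f := fun y => h (x + u y))).
  by apply: (bmeas_comp bh); exact: measurable_funD.
have ic (k : R) : P.-integrable setT (fun _ : T => k%:E).
  exact: (bmeas_integrable P (@bmeas_cst _ T R k)).
have iu1 : P.-integrable setT (fun y => (u y * h1 x)%:E).
  by under eq_fun do rewrite mulrC EFinM; exact: integrableZl.
have iu2 : P.-integrable setT (fun y => (u y ^+ 2 * (h2 x / 2))%:E).
  by under eq_fun do rewrite mulrC EFinM; exact: integrableZl.
have iA : P.-integrable setT (fun y => (h (x + u y) - h x)%:E).
  by under eq_fun do rewrite EFinB; exact: (integrableB _ ih (ic _)).
have iB : P.-integrable setT (fun y => (h (x + u y) - h x - u y * h1 x)%:E).
  by under eq_fun do rewrite EFinB; exact: (integrableB _ iA iu1).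
have iC : P.-integrable setT (fun y => (h (x + u y) - h x - u y * h1 x
    - u y ^+ 2 * (h2 x / 2))%:E).
  by under eq_fun do rewrite EFinB; exact: (integrableB _ iB iu2).
have iD : P.-integrable setT (fun y => (K * `|u y| ^+ 3)%:E).
  by under eq_fun do rewrite EFinM; exact: integrableZl.
have -> : \int[P]_y h (x + u y) - h x - v / 2 * h2 x =
    \int[P]_y (h (x + u y) - h x - u y * h1 x - u y ^+ 2 * (h2 x / 2)).
  rewrite RintegralB// RintegralB// RintegralB//; last exact: ic.
  rewrite expect_cst.
  rewrite (RintegralZr (f := u))// (RintegralZr (f := fun y => u y ^+ 2))//.
  by rewrite e1 e2 mul0r subr0; congr (_ - _); ring.
apply: le_trans (le_normr_Rintegral _ iC) _ => //.
apply: (@le_trans _ _ (\int[P]_y (K * `|u y| ^+ 3))).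
  apply: le_Rintegral => //; first exact: (integrable_abse iC).
  move=> y _; have := hK x (u y).
  by rewrite [u y ^+ 2 / 2 * _]mulrAC -mulrA.
by rewrite (RintegralZl (f := fun y => `|u y| ^+ 3))// ler_wpM2l.
Qed.

Lemma taylor3_swap K h : 0 <= K -> taylor3 K h ->
  forall d (T : measurableType d) (P : probability T R) u v B,
  centred P u v B ->
  forall d' (T' : measurableType d') (P' : probability T' R) u' B',
  centred P' u' v B' -> forall x,
  `|\int[P]_y h (x + u y) - \int[P']_y h (x + u' y)| <= K * (B + B').
Proof.
move=> K0 /(taylor3_perturb K0)[h2 H] d T P u v B c d' T' P' u' B' c' x.
have := H _ _ _ _ _ _ c x; have := H _ _ _ _ _ _ c' x.
set a := \int[P]_y _; set b := \int[P']_y _; set z := v / 2 * _ => h' hh.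
have -> : a - b = (a - h x - z) - (b - h x - z) by ring.
by rewrite (le_trans (ler_normB _ _))// mulrDr lerD.
Qed.

End taylor_class.

(** * Gaussian moments and convolution *)

Section gaussian.
Context (R : realType).
Notation mu := (@lebesgue_measure R).

(** The fundamental theorem of calculus on [-n, n], in the limit. *)
Lemma integral_derivative_line (F f : R -> R) :
  (forall x : R, is_derive x 1 F (f x)) -> continuous f ->
  mu.-integrable setT (EFin \o f) ->
  F n%:R @[n --> \oo] --> 0 -> F (- n%:R) @[n --> \oo] --> 0 ->
  \int[mu]_x f x = 0.
Proof.
move=> dF cf itf Fp Fm.
pose f_ n := (EFin \o f) \_ `[- n%:R, n%:R].
have mf : measurable_fun setT (EFin \o f) := measurable_int _ itf.
have h1 : (\int[mu]_x f_ n.+1 x)%E @[n --> \oo] --> (\int[mu]_x (f x)%:E)%E.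
  rewrite (cvg_shiftS (fun n => (\int[mu]_x f_ n x)%E)).
  have [] := @dominated_convergence _ _ R mu setT measurableT f_ (EFin \o f)
    (abse \o (EFin \o f)) _ mf _ _ _ => //.
  - by move=> n; apply/(measurable_restrictT _ _).1 => //; exact: measurable_funTS.
  - apply: aeW => x _; apply: cvg_near_cst; near=> n.
    rewrite /f_ patchE ifT//= inE/= in_itv/= -ler_norml.
    near: n; exact: nbhs_infty_ger.
  - exact: integrable_abse.
  - apply: aeW => x n _; rewrite /f_ patchE /=; case: ifP => // _.
    by rewrite abse0 lee_fin.
have h2 : (\int[mu]_x f_ n.+1 x)%E @[n --> \oo] --> 0%E.
  have FE n : (\int[mu]_x f_ n.+1 x)%E = (F n.+1%:R - F (- n.+1%:R))%:E.
    rewrite -integral_mkcond (@continuous_FTC2 _ f F)//.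
    - by rewrite gtrN.
    - exact: continuous_subspaceT.
    - have cF : continuous F.
        by move=> x; apply/differentiable_continuous/derivable1_diffP; exact: ex_derive.
      split.
      + by move=> x _; exact: ex_derive.
      + by apply: cvg_at_right_filter; exact: cF.
      + by apply: cvg_at_left_filter; exact: cF.
    - by move=> x _; rewrite derive1E; exact: derive_val.
  under eq_fun do rewrite FE.
  apply: cvg_EFin; first by near=> n.
  rewrite (_ : fine \o _ = fun n => F n.+1%:R - F (- n.+1%:R))//.
  rewrite -[X in _ --> X](subr0 (0 : R)).
  by apply: cvgB; [rewrite (cvg_shiftS (fun n => F n%:R))|
    rewrite (cvg_shiftS (fun n => F (- n%:R)))].
by rewrite /Rintegral (cvg_unique _ h1 h2).
Unshelve. all: by end_near. Qed.

Lemma normal_pdf0E (s y : R) : 0 < s ->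
  normal_pdf 0 s y = normal_peak s * expR (- (y ^+ 2 / (s ^+ 2 * 2))).
Proof.
move=> s0; rewrite normal_pdfE ?gt_eqF// /normal_fun subr0.
by rewrite mulNr -mulr_natr.
Qed.

Lemma is_derive_normal_pdf (s x : R) : 0 < s ->
  is_derive x 1 (normal_pdf 0 s) (- (x / s ^+ 2) * normal_pdf 0 s x).
Proof.
move=> s0; have s2 : s ^+ 2 != 0 by rewrite expf_neq0// gt_eqF.
have -> : normal_pdf 0 s = fun y => normal_peak s * expR (- (y ^+ 2 / (s ^+ 2 * 2))).
  by apply/funext => y; exact: normal_pdf0E.
pose E := fun y : R => - (y ^+ 2 / (s ^+ 2 * 2)).
have dE : is_derive x 1 E (- (x / s ^+ 2)).
  rewrite /E; apply: is_derive_eq.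
  by rewrite /GRing.scale/=; field; rewrite gt_eqF.
have -> : (fun y => normal_peak s * expR (- (y ^+ 2 / (s ^+ 2 * 2)))) =
   (cst (normal_peak s) * (expR \o E)).
  by [].
apply: is_derive_eq.
by rewrite /GRing.scale/= mulr0 addr0 /E; ring.
Qed.

Lemma cube_le_expR (z : R) : 0 <= z -> z ^+ 3 <= 64 * expR (z ^+ 2 / 4).
Proof.
move=> z0; set w := z ^+ 2 / 4.
(* From exp w >= (1 + w / 2)^2. *)
have e1 : (1 + w / 2) ^+ 2 <= expR w.
  rewrite [in leRHS](_ : w = 2%:R * (w / 2)); last by field.
  rewrite expRM_natl lerXn2r// ?nnegrE ?expR_ge0 ?expR_ge1Dx//.
  by rewrite /w addr_ge0// !mulr_ge0// ?sqr_ge0// invr_ge0.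
apply: (@le_trans _ _ (64 * (1 + w / 2) ^+ 2)); last by rewrite ler_pM2l.
have [z1|z1] := leP z 1.
  apply: (@le_trans _ _ 1); first by rewrite exprn_ile1.
  by rewrite /w; nra.
apply: (@le_trans _ _ (z ^+ 4)); first by rewrite ler_eXn2l// ltW.
by rewrite /w; nra.
Qed.

(** The cube is absorbed by half of the exponent, which leaves a Gaussian density of
    twice the deviation; hence the third moment is finite and O(s^3). *)
Lemma cube_normal_pdf (s y : R) : 0 < s ->
  `|y| ^+ 3 * normal_pdf 0 s y <= 128 * s ^+ 3 * normal_pdf 0 (2 * s) y.
Proof.
move=> s0; have s20 : 0 < 2 * s by rewrite mulr_gt0.
rewrite !normal_pdf0E//.
have -> : normal_peak s = 2 * normal_peak (2 * s).
  rewrite /normal_peak (_ : (2 * s) ^+ 2 * pi *+ 2 = 2 ^+ 2 * (s ^+ 2 * pi *+ 2)).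
    rewrite sqrtrM ?sqr_ge0// sqrtr_sqr ger0_norm// invfM mulrA divff ?mul1r//.
  by move: (pi : R) => q; ring.
set p := normal_peak _; have p0 : 0 < p by rewrite normal_peak_gt0// gt_eqF.
pose z := `|y| / s.
have z0 : 0 <= z by rewrite divr_ge0// ltW.
have yE : `|y| = z * s by rewrite /z divfK// gt_eqF.
have -> : y ^+ 2 / (s ^+ 2 * 2) = z ^+ 2 / 2.
  by rewrite -[y ^+ 2]real_normK ?num_real// yE; field; rewrite gt_eqF.
have -> : y ^+ 2 / ((2 * s) ^+ 2 * 2) = z ^+ 2 / 8.
  by rewrite -[y ^+ 2]real_normK ?num_real// yE; field; rewrite gt_eqF.
have := cube_le_expR z0 => hz.
rewrite yE exprMn.
have le1 : z ^+ 3 * expR (- (z ^+ 2 / 2)) <= 64 * expR (- (z ^+ 2 / 8)).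
  apply: (@le_trans _ _ (64 * expR (z ^+ 2 / 4) * expR (- (z ^+ 2 / 2)))).
    by rewrite ler_pM2r ?expR_gt0.
  rewrite -mulrA -expRD ler_pM2l// ler_expR.
  have := sqr_ge0 z; lra.
rewrite [leLHS](_ : _ = (2 * p * s ^+ 3) * (z ^+ 3 * expR (- (z ^+ 2 / 2)))); last by ring.
rewrite [leRHS](_ : _ = (2 * p * s ^+ 3) * (64 * expR (- (z ^+ 2 / 8)))); last by ring.
by rewrite ler_pM2l// !mulr_gt0// exprn_gt0.
Qed.

Lemma measurable_norm_cube : measurable_fun setT (fun x : R => `|x| ^+ 3).
Proof. by apply: measurable_funX; exact: normr_measurable. Qed.

Section moments.
Variables (s : R).
Hypothesis s0 : 0 < s.
Let p := normal_pdf 0 s.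

Let p_ge0 y : 0 <= p y. Proof. exact: normal_pdf_ge0. Qed.
Let cp : continuous p.
Proof. by apply: continuous_normal_pdf; rewrite gt_eqF. Qed.
Let mp : measurable_fun setT p. Proof. exact: measurable_normal_pdf. Qed.

Let int_cube : mu.-integrable setT (fun y => (`|y| ^+ 3 * p y)%:E).
Proof.
apply: (@le_integrable _ _ _ mu setT measurableT _ (fun y => ((128 * s ^+ 3) * normal_pdf 0 (2 * s) y)%:E)) => //.
- apply/measurable_EFinP; apply: measurable_funM => //.
  exact: measurable_norm_cube.
- move=> y _ /=; rewrite lee_fin ger0_norm ?mulr_ge0 ?exprn_ge0//.
  exact: le_trans (cube_normal_pdf y s0) (ler_norm _).
- under eq_fun do rewrite EFinM; apply: integrableZl => //.
  exact: integrable_normal_pdf.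
Qed.

Let int_le_cube (f : R -> R) : measurable_fun setT f ->
  (forall y, `|f y| <= 1 + `|y| ^+ 3) -> mu.-integrable setT (fun y => (f y * p y)%:E).
Proof.
move=> mf fle.
apply: (@le_integrable _ _ _ mu setT measurableT _
  (fun y => ((1 + `|y| ^+ 3) * p y)%:E)) => //.
- by apply/measurable_EFinP; exact: measurable_funM.
- move=> y _ /=; rewrite lee_fin !normrM ler_wpM2r// (le_trans (fle y))//.
  exact: ler_norm.
- under eq_fun do rewrite mulrDl mul1r EFinD.
  by apply: integrableD => //; exact: integrable_normal_pdf.
Qed.

Let C := 128 * s ^+ 3 * normal_peak (2 * s).

Let cube_bound y : `|y| ^+ 3 * p y <= C.
Proof.
apply: le_trans (cube_normal_pdf y s0) _.
rewrite ler_wpM2l ?mulr_ge0 ?exprn_ge0 ?(ltW s0)//.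
by apply: normal_pdf_ub; rewrite gt_eqF// mulr_gt0.
Qed.

Let vanish (F : R -> R) K : (forall y, 1 <= `|y| -> `|F y| * `|y| <= K) ->
  (F n%:R @[n --> \oo] --> 0) * (F (- n%:R) @[n --> \oo] --> 0).
Proof.
move=> FK.
have inv0 : K * (n%:R : R)^-1 @[n --> \oo] --> 0.
  rewrite -(mulr0 K); apply: cvgM; first exact: cvg_cst.
  apply/gtr0_cvgV0; last exact: cvgr_idn.
  by near=> n; rewrite ltr0n; near: n; exists 1%N.
have H (e : R) : `|e| = 1 -> F (e * n%:R) @[n --> \oo] --> 0.
  move=> e1; apply/norm_cvg0P.
  apply: (squeeze_cvgr _ (cvg_cst 0) inv0); near=> n.
  have n1 : (1 <= n%:R :> R) by rewrite ler1n; near: n; exists 1%N.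
  rewrite normr_ge0/= ler_pdivlMr ?(lt_le_trans ltr01)//.
  have := FK (e * n%:R); rewrite normrM e1 mul1r ger0_norm ?ler0n//.
  by move/(_ n1).
split; first by have := H 1 (normr1 _); under eq_fun do rewrite mul1r.
by have := H (-1) (normrN1 _); under eq_fun do rewrite mulN1r.
Unshelve. all: by end_near. Qed.

Let low (y : R) k : 1 <= `|y| -> (k <= 3)%N -> `|y| ^+ k * p y <= C.
Proof.
move=> y1 k3; apply: le_trans (cube_bound y); rewrite ler_wpM2r//.
exact: ler_weXn2l.
Qed.

Lemma normal_moment1 : \int[mu]_y (y * p y) = 0.
Proof.
(* A primitive of y p(y). *)
pose F := (fun y => - s ^+ 2 * p y).
have [F1 F2] : (F n%:R @[n --> \oo] --> 0) * (F (- n%:R) @[n --> \oo] --> 0).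
  apply: (vanish (K := s ^+ 2 * C)) => y y1.
  rewrite normrM normrN (ger0_norm (p_ge0 y)) ger0_norm ?sqr_ge0// -mulrA.
  by rewrite ler_wpM2l ?sqr_ge0// mulrC; have := low y1 (k := 1) isT; rewrite expr1.
have dF (x : R) : is_derive x 1 F (x * p x).
  have dp := is_derive_normal_pdf x s0.
  have -> : F = cst (- s ^+ 2) * normal_pdf 0 s by [].
  apply: is_derive_eq; rewrite /GRing.scale/= mulr0 addr0 /p.
  by field; rewrite gt_eqF.
have cf : continuous (fun y : R => y * p y) by move=> x; apply: cvgM => //; exact: cp.
have itf : mu.-integrable setT (EFin \o (fun y : R => y * p y)).
  apply: int_le_cube => // y; have [y1|/ltW y1] := leP `|y| 1.
    by rewrite (le_trans y1)// lerDl exprn_ge0.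
  by rewrite -[leLHS]add0r lerD// -[leLHS]expr1 ler_weXn2l.
exact: integral_derivative_line dF cf itf F1 F2.
Qed.

Lemma normal_moment2 : \int[mu]_y (y ^+ 2 * p y) = s ^+ 2.
Proof.
(* The derivative of F is (y^2 - s^2) p(y). *)
pose F := (fun y => - s ^+ 2 * (y * p y)).
have [F1 F2] : (F n%:R @[n --> \oo] --> 0) * (F (- n%:R) @[n --> \oo] --> 0).
  apply: (vanish (K := s ^+ 2 * C)) => y y1.
  rewrite !normrM normrN (ger0_norm (p_ge0 y)) (ger0_norm (sqr_ge0 s)) -mulrA.
  rewrite ler_wpM2l ?sqr_ge0// mulrC mulrA -expr2.
  exact: low.
have i2 : mu.-integrable setT (EFin \o (fun y => y ^+ 2 * p y)).
  apply: int_le_cube => // y; rewrite normrX; have [y1|/ltW y1] := leP `|y| 1.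
    by rewrite (@le_trans _ _ 1)// ?exprn_ile1// lerDl exprn_ge0.
  by rewrite -[leLHS]add0r lerD// ler_weXn2l.
have i0 : mu.-integrable setT (EFin \o (fun y => s ^+ 2 * p y)).
  rewrite (_ : _ \o _ = fun y => (s ^+ 2)%:E * (p y)%:E)%E; last first.
    by apply/funext => y /=; rewrite EFinM.
  by apply: integrableZl => //; exact: integrable_normal_pdf.
have : \int[mu]_y (y ^+ 2 * p y - s ^+ 2 * p y) = 0.
  have dF (x : R) : is_derive x 1 F (x ^+ 2 * p x - s ^+ 2 * p x).
    have dp := is_derive_normal_pdf x s0.
    have -> : F = cst (- s ^+ 2) * (id * normal_pdf 0 s) by [].
    apply: is_derive_eq; rewrite /GRing.scale/= mulr0 addr0 /p.
    by field; rewrite gt_eqF.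
  have cf : continuous (fun y : R => y ^+ 2 * p y - s ^+ 2 * p y).
    move=> x; apply: cvgB; apply: cvgM; [|exact: cp|exact: cvg_cst|exact: cp].
    exact: exprn_continuous.
  exact: integral_derivative_line dF cf (integrableB measurableT i2 i0) F1 F2.
rewrite RintegralB// => /eqP; rewrite subr_eq0 => /eqP ->.
rewrite RintegralZl//; last exact: integrable_normal_pdf.
by rewrite {1}/Rintegral integral_normal_pdf mulr1.
Qed.

(** The products of the Gaussian density with polynomials integrate by parts, which gives
    the first two moments; the third one is bounded by domination. *)
Lemma normal_centred :
  centred (normal_prob 0 s : probability (measurableTypeR R) R) (fun y : R => y)
    (s ^+ 2) (128 * s ^+ 3).
Proof.
pose N : probability (measurableTypeR R) R := normal_prob 0 s.
have Pg (B : set (measurableTypeR R)) : measurable B ->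
  N B = (\int[mu]_(x in B) (p x)%:E)%E by [].
have itD (f : measurableTypeR R -> R) : measurable_fun setT f ->
    (forall y, `|f y| <= 1 + `|y| ^+ 3) ->
    N.-integrable setT (fun y => (f y)%:E) /\
    \int[N]_y f y = \int[mu]_y (f y * p y).
  move=> mf fle; have i : N.-integrable setT (fun y => (f y)%:E).
    refine (@integrable_density _ (measurableTypeR R) R N mu p mp p_ge0 Pg _ _ _).
      exact/measurable_EFinP.
    exact: (int_le_cube mf fle).
  split; first exact: i.
  by congr fine; exact: (@integral_density _ (measurableTypeR R) R N mu p mp Pg _ i).
have pow_le k (y : R) : (0 < k <= 3)%N -> `|y| ^+ k <= 1 + `|y| ^+ 3.
  move=> /andP[k0 k3]; have [y1|/ltW y1] := leP `|y| 1.
    by rewrite (@le_trans _ _ 1)// ?exprn_ile1// lerDl exprn_ge0.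
  by rewrite -[leLHS]add0r lerD// ler_weXn2l.
have [||i1 e1] := itD id.
- exact: measurable_id.
- by move=> y; have := pow_le 1%N y isT; rewrite expr1.
have [||i2 e2] := itD (fun y => y ^+ 2).
- exact: exprn_measurable.
- by move=> y; rewrite normrX; exact: pow_le.
have [||i3 e3] := itD (fun y => `|y| ^+ 3).
- exact: measurable_norm_cube.
- by move=> y; rewrite (ger0_norm (exprn_ge0 3 (normr_ge0 y))); exact: pow_le.
split; first by split; [exact: measurable_id|exact: i1|exact: i2|exact: i3].
split; [by rewrite e1; exact: normal_moment1|by rewrite e2; exact: normal_moment2|].
rewrite e3; apply: (@le_trans _ _ (\int[mu]_y (128 * s ^+ 3 * normal_pdf 0 (2 * s) y))).
  apply: le_Rintegral => //; last by move=> y _; exact: cube_normal_pdf.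
  rewrite (_ : _ \o _ = fun y => (128 * s ^+ 3)%:E * (normal_pdf 0 (2 * s) y)%:E)%E.
    by apply: integrableZl => //; exact: integrable_normal_pdf.
  by apply/funext => y /=; rewrite EFinM.
rewrite RintegralZl//; last exact: integrable_normal_pdf.
by rewrite /Rintegral integral_normal_pdf mulr1.
Qed.

End moments.

(** For v = 0 the law is a Dirac mass and all the moments vanish. *)
Lemma gaussian_centred (v : R) : 0 <= v ->
  centred (gaussian 0 v) (fun y : R => y) v (128 * Num.sqrt v ^+ 3).
Proof.
rewrite le_eqVlt /gaussian => /predU1P[<-|v0]; last first.
  rewrite gt_eqF//; have := normal_centred (s := Num.sqrt v).
  by rewrite sqrtr_gt0 sqr_sqrtr ?(ltW v0)//; exact.
rewrite eqxx.
have dirac_int (f : R -> R) : measurable_fun setT f -> f 0 = 0 ->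
    (\d_(0 : measurableTypeR R)).-integrable setT (fun y => (f y)%:E) /\
    \int[\d_(0 : measurableTypeR R)]_y f y = 0.
  move=> mf f0; have mEf : measurable_fun setT (fun y => (f y)%:E).
    exact/measurable_EFinP.
  split.
    apply/integrableP; split => //; rewrite integral_dirac//.
      by rewrite f0 abse0 mule0 ltry.
    exact: measurableT_comp.
  by rewrite /Rintegral integral_dirac// f0 mule0.
have [||i1 e1] := dirac_int id; [exact: measurable_id|by []|].
have [||i2 e2] := dirac_int (fun y => y ^+ 2).
- exact: exprn_measurable.
- by rewrite expr0n.
have [||i3 e3] := dirac_int (fun y => `|y| ^+ 3).
- exact: measurable_norm_cube.
- by rewrite normr0 expr0n.
split; first by split.
by split=> //; rewrite e3 mulr_ge0// exprn_ge0.
Qed.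

End gaussian.

Section gaussian_semigroup.
Context (R : realType).
Notation mu := (@lebesgue_measure R).
Local Open Scope ereal_scope.

Lemma ge0_integral_translate (G : R -> R) (x : R) :
  continuous G -> (forall z, (0 <= G z)%R) ->
  \int[mu]_z (G z)%:E = \int[mu]_y (G (x + y)%R)%:E.
Proof.
move=> cG G0.
have dF (y : R) : is_derive y 1%R (fun y : R => x + y)%R (1%R : R).
  by apply: is_derive_eq; rewrite add0r mulr1.
have F'E : ((fun y : R => x + y)%R^`()%classic : R -> R) = cst 1%R.
  by apply/funext => y; rewrite derive1E; exact: derive_val.
rewrite (@increasing_ge0_integration_by_substitutionT _ (fun y : R => x + y)%R)//.
- by apply: eq_integral => y _; rewrite F'E !fctE /= mulr1.
- by move=> a b; rewrite ltrD2l.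
- by rewrite F'E => ?; exact: cvg_cst.
- by rewrite F'E; exact: is_cvg_cst.
- by rewrite F'E; exact: is_cvg_cst.
- rewrite (_ : (fun y : R => (x + y)%R) = (fun y => y + x)%R); last first.
    by apply/funext => y; rewrite addrC.
  exact: cvg_addrr_Ny.
- rewrite (_ : (fun y : R => (x + y)%R) = (fun y => y + x)%R); last first.
    by apply/funext => y; rewrite addrC.
  exact: cvg_addrr.
Qed.

Lemma normal_peakM (s t r : R) : (0 < s)%R -> (0 < t)%R -> (0 < r)%R ->
  (normal_peak s * normal_peak t = normal_peak r * normal_peak (s * t / r))%R.
Proof.
move=> s0 t0 r0.
have pk (a : R) : (0 < a)%R -> normal_peak a = ((a * Num.sqrt (pi *+ 2))^-1)%R.
  move=> a0; rewrite /normal_peak -mulrnAr sqrtrM ?sqr_ge0//.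
  by rewrite sqrtr_sqr gtr0_norm.
rewrite !pk ?divr_gt0 ?mulr_gt0// -!invfM; congr (_^-1)%R.
set c := Num.sqrt _; by field; rewrite gt_eqF.
Qed.

(** Completing the square: the conditional law of x given the sum z of two Gaussian
    variables is again Gaussian. *)
Lemma normal_pdfM (s t r x z : R) : (0 < s)%R -> (0 < t)%R -> (0 < r)%R ->
  (r ^+ 2 = s ^+ 2 + t ^+ 2)%R ->
  (normal_pdf 0 s x * normal_pdf 0 t (z - x) =
   normal_pdf 0 r z * normal_pdf (z * s ^+ 2 / r ^+ 2) (s * t / r) x)%R.
Proof.
move=> s0 t0 r0 rE.
have str : (0 < s * t / r)%R by rewrite divr_gt0// mulr_gt0.
rewrite !normal_pdf0E// normal_pdfE ?gt_eqF// /normal_fun.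
rewrite mulrACA (normal_peakM s0 t0 r0) [RHS]mulrACA -!expRD; congr (_ * expR _)%R.
rewrite -mulr_natr.
have rs : (s ^+ 2 + t ^+ 2 != 0)%R by rewrite -rE expf_neq0// gt_eqF.
have -> : ((s * t / r) ^+ 2 = s ^+ 2 * t ^+ 2 / (s ^+ 2 + t ^+ 2))%R.
  by rewrite !exprMn exprVn rE.
by rewrite rE; field; rewrite ?rs ?gt_eqF.
Qed.

(** By Tonelli's theorem the variable z = x + y can be integrated last; given z, the
    density of x has mass 1. *)
Lemma ge0_normal_semigroup (s t r : R) (h : R -> R) :
  (0 < s)%R -> (0 < t)%R -> (0 < r)%R ->
  (r ^+ 2 = s ^+ 2 + t ^+ 2)%R ->
  continuous h -> (forall x, (0 <= h x)%R) ->
  \int[normal_prob 0 s]_x \int[normal_prob 0 t]_y (h (x + y)%R)%:E =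
  \int[normal_prob 0 r]_z (h z)%:E.
Proof.
move=> s0 t0 r0 rE ch h0.
have mh : measurable_fun setT h by exact: continuous_measurable_fun.
have nd (v : R) (f : R -> \bar R) : measurable_fun setT f -> (forall x, 0 <= f x) ->
    \int[normal_prob 0 v]_x f x = \int[mu]_x (f x * (normal_pdf 0 v x)%:E).
  move=> mf f0; apply: ge0_integral_density => //.
  exact: measurable_normal_pdf.
have mpair : measurable_fun setT
    (fun z : measurableTypeR R * measurableTypeR R => h (z.1 + z.2)%R).
  by apply: measurableT_comp mh _; exact: measurable_funD.
have inner x : \int[normal_prob 0 t]_y (h (x + y)%R)%:E =
    \int[mu]_z (h z * normal_pdf 0 t (z - x))%:E.
  rewrite nd; last by move=> y; rewrite lee_fin.
    rewrite (@ge0_integral_translate (fun z => h z * normal_pdf 0 t (z - x))%R x).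
    - by apply: eq_integral => y _; rewrite -EFinM (_ : x + y - x = y)%R//; ring.
    - move=> y; apply: cvgM; first exact: ch.
      apply: (continuous_comp (f := fun z : R => (z - x)%R)).
        by apply: cvgB; [exact: cvg_id|exact: cvg_cst].
      by apply: continuous_normal_pdf; rewrite gt_eqF.
    - by move=> z; rewrite mulr_ge0// normal_pdf_ge0.
  by apply/measurable_EFinP; apply: measurableT_comp mh _; exact: measurable_funD.
rewrite nd; last 2 first.
- apply: (measurable_fun_fubini_tonelli_F (m2 := normal_prob 0 t)
    (fun z : measurableTypeR R * measurableTypeR R => (h (z.1 + z.2)%R)%:E)).
    exact/measurable_EFinP.
  by move=> z; rewrite lee_fin.
- by move=> x; apply: integral_ge0 => y _; rewrite lee_fin.
pose k (w : measurableTypeR R * measurableTypeR R) :=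
  (h w.2 * (normal_pdf 0 s w.1 * normal_pdf 0 t (w.2 - w.1)))%:E.
have mk : measurable_fun setT k.
  apply/measurable_EFinP; apply: measurable_funM.
    exact: measurableT_comp mh measurable_snd.
  apply: measurable_funM.
    exact: measurableT_comp (measurable_normal_pdf _ _) measurable_fst.
  by apply: measurableT_comp (measurable_normal_pdf _ _) _; exact: measurable_funB.
have k0 w : 0 <= k w by rewrite lee_fin !mulr_ge0 ?normal_pdf_ge0.
transitivity (\int[mu]_x \int[mu]_z k (x, z)).
  apply: eq_integral => x _; rewrite inner -ge0_integralZr//.
  - by apply: eq_integral => z _; rewrite -EFinM /k/=; congr EFin; ring.
  - apply/measurable_EFinP; apply: measurable_funM => //.
    by apply: measurableT_comp (measurable_normal_pdf _ _) _; exact: measurable_funB.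
  - by move=> z _; rewrite lee_fin mulr_ge0 ?normal_pdf_ge0.
  - by rewrite lee_fin normal_pdf_ge0.
rewrite (fubini_tonelli k)// nd; last 2 first.
- exact/measurable_EFinP.
- by move=> x; rewrite lee_fin.
apply: eq_integral => z _.
under eq_integral => x _.
  rewrite /k/= (normal_pdfM _ _ s0 t0 r0 rE) mulrA EFinM; over.
rewrite ge0_integralZl//; last 3 first.
- by apply/measurable_EFinP; exact: measurable_normal_pdf.
- by move=> x _; rewrite lee_fin normal_pdf_ge0.
- by rewrite lee_fin mulr_ge0 ?normal_pdf_ge0.
by rewrite integral_normal_pdf mule1 EFinM.
Qed.

End gaussian_semigroup.

(** * Lindeberg's method *)

Section gaussian_average.
Context (R : realType).
Implicit Types (h : R -> R) (a b v : R).

Lemma gaussian0E : gaussian 0 0 = \d_(0 : measurableTypeR R) :> probability _ R.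
Proof. by rewrite /gaussian eqxx. Qed.

Lemma expect_dirac d (T : measurableType d) (x : T) (f : T -> R) : bmeas f ->
  \int[(\d_x : probability T R)]_y f y = f x.
Proof.
move=> bf; rewrite /Rintegral integral_dirac//; last first.
  by apply/measurable_EFinP; exact: bmeas_meas.
by rewrite diracT mul1e.
Qed.

Lemma expect_gaussian0 h : bmeas h -> \int[gaussian 0 0]_y h y = h 0.
Proof.
by move=> bh; rewrite gaussian0E; exact: (@expect_dirac _ (measurableTypeR R) 0).
Qed.

Lemma average_shift_cst (P1 P2 P3 : probability (measurableTypeR R) R) h K :
  bmeas h ->
  \int[P1]_x \int[P2]_y (h (x + y) + K) = \int[P3]_z (h z + K) ->
  \int[P1]_x \int[P2]_y h (x + y) = \int[P3]_z h z.
Proof.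
move=> bh; rewrite [in RHS]expectD// ?expect_cst; last exact: bmeas_cst.
under eq_Rintegral => x _.
  rewrite expectD ?expect_cst; [|exact: bmeas_translate|exact: bmeas_cst].
  over.
rewrite expectD ?expect_cst; [|exact: bmeas_average|exact: bmeas_cst].
by move/addIr.
Qed.

Lemma average_EFin (P1 P2 P3 : probability (measurableTypeR R) R) h :
  bmeas h ->
  (\int[P1]_x \int[P2]_y (h (x + y))%:E = \int[P3]_z (h z)%:E)%E ->
  \int[P1]_x \int[P2]_y h (x + y) = \int[P3]_z h z.
Proof.
move=> bh E; rewrite [RHS]/Rintegral -E; congr fine; apply: eq_integral => x _.
by apply: Rintegral_EFin; exact: bmeas_translate.
Qed.

Lemma gaussianE v : 0 < v ->
  gaussian 0 v = normal_prob 0 (Num.sqrt v) :> probability (measurableTypeR R) R.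
Proof. by move=> v0; rewrite /gaussian gt_eqF. Qed.

(** Adding a constant to h makes it nonnegative, which is the case of Tonelli's theorem;
    a zero variance is a Dirac mass. *)
Lemma gaussian_semigroup a b h : 0 <= a -> 0 <= b -> bmeas h -> continuous h ->
  \int[gaussian 0 a]_x \int[gaussian 0 b]_y h (x + y) =
  \int[gaussian 0 (a + b)]_z h z.
Proof.
move=> a0 b0 bh ch.
have btr (c : R) : bmeas (fun x : R => \int[gaussian 0 c]_y h (x + y)).
  exact: bmeas_average.
have [->|an0] := eqVneq a 0.
  rewrite add0r; transitivity (\int[gaussian 0 b]_y h (0 + y)).
    exact: (expect_gaussian0 (btr b)).
  by apply: eq_Rintegral => y _; rewrite add0r.
have [->|bn0] := eqVneq b 0.
  rewrite addr0; apply: eq_Rintegral => x _.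
  transitivity (h (x + 0)); last by rewrite addr0.
  exact: (expect_gaussian0 (bmeas_translate x bh)).
have {}a0 : 0 < a by rewrite lt_neqAle eq_sym an0.
have {}b0 : 0 < b by rewrite lt_neqAle eq_sym bn0.
have ab0 : 0 < a + b by exact: addr_gt0.
have [mh [K hK]] := bh.
pose h' x := h x + K.
have bh' : bmeas h' by apply: bmeasD => //; exact: bmeas_cst.
have h'0 x : 0 <= h' x.
  by have := hK x; rewrite ler_norml => /andP[+ _]; rewrite /h'; lra.
have ch' : continuous h' by move=> x; apply: cvgD; [exact: ch|exact: cvg_cst].
suff H : \int[gaussian 0 a]_x \int[gaussian 0 b]_y h' (x + y) =
    \int[gaussian 0 (a + b)]_z h' z.
  exact: average_shift_cst bh H.
have Es : forall c : R, 0 < c -> 0 < Num.sqrt c by move=> c; rewrite sqrtr_gt0.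
rewrite (gaussianE a0) (gaussianE b0) (gaussianE ab0).
apply: (average_EFin bh').
apply: (ge0_normal_semigroup (Es _ a0) (Es _ b0) (Es _ ab0) _ ch' h'0).
by rewrite !sqr_sqrtr ?ltW.
Qed.

(** For small increments by the expansion, for large ones by boundedness. *)
Lemma taylor3_lipschitz K h : 0 <= K -> taylor3 K h ->
  exists2 L, 0 <= L & forall x y, `|h x - h y| <= L * `|x - y|.
Proof.
move=> K0 [[_ [M0 h0]] [h1 [h2 [[_ [M1 hM1]] [_ [M2 hM2]] hK]]]].
have M0p : 0 <= M0 := le_trans (normr_ge0 _) (h0 0).
have M1p : 0 <= M1 := le_trans (normr_ge0 _) (hM1 0).
have M2p : 0 <= M2 := le_trans (normr_ge0 _) (hM2 0).
exists (2 * M0 + M1 + M2 + K); first by rewrite !addr_ge0// mulr_ge0.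
move=> y x; pose t := y - x; rewrite -/t.
have -> : y = x + t by rewrite /t; ring.
have [t1|/ltW t1] := leP `|t| 1; last first.
  apply: (@le_trans _ _ (2 * M0)).
    rewrite (le_trans (ler_normB _ _))//.
    by have := h0 (x + t); have := h0 x; lra.
  by rewrite -[leLHS]mulr1 ler_pM ?mulr_ge0//; lra.
have e1 : `|t * h1 x| <= M1 * `|t| by rewrite normrM mulrC ler_wpM2r.
(* Increments at most 1: the powers of t are absorbed by t. *)
have tt : `|t| ^+ 2 <= `|t| by rewrite expr2 ler_piMr.
have ttt : `|t| ^+ 3 <= `|t| by rewrite exprS ler_piMr// exprn_ile1.
have e2 : `|t ^+ 2 / 2 * h2 x| <= M2 * `|t|.
  rewrite [M2 * _]mulrC normrM; apply: ler_pM => //.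
  rewrite normrM normrX normfV (ger0_norm (ler0n R 2)).
  by have := sqr_ge0 `|t|; lra.
have e3 := hK x t.
have e4 : K * `|t| ^+ 3 <= K * `|t| by rewrite ler_wpM2l.
have -> : h (x + t) - h x = (h (x + t) - h x - t * h1 x - t ^+ 2 / 2 * h2 x)
  + t * h1 x + t ^+ 2 / 2 * h2 x by ring.
rewrite (le_trans (ler_normD _ _))//.
rewrite (@le_trans _ _ (K * `|t| + M1 * `|t| + M2 * `|t|))//.
  rewrite lerD// (le_trans (ler_normD _ _))// lerD//.
  exact: le_trans e3 e4.
have M0t : 0 <= M0 * `|t| by exact: mulr_ge0.
by rewrite !mulrDl; lra.
Qed.

Lemma lipschitz_continuousR h L : (forall x y, `|h x - h y| <= L * `|x - y|) ->
  continuous h.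
Proof.
move=> hL x; apply/cvgrPdist_lt => e e0.
near=> y.
apply: le_lt_trans (hL x y) _.
apply: (@le_lt_trans _ _ ((`|L| + 1) * `|x - y|)).
  by rewrite ler_wpM2r// (le_trans (ler_norm L))// lerDl.
rewrite mulrC -ltr_pdivlMr//; near: y.
by apply/nbhs_ballP; exists (e / (`|L| + 1)); [exact: divr_gt0|].
Unshelve. all: by end_near. Qed.

Lemma taylor3_continuous K h : 0 <= K -> taylor3 K h -> continuous h.
Proof. by move=> K0 /(taylor3_lipschitz K0)[L _ /lipschitz_continuousR]. Qed.

End gaussian_average.

Section lindeberg.
Context d (T : measurableType d) (R : realType).
Context dO (Om : measurableType dO) (P : probability Om R).
Context (I : choiceType) (X : I -> {RV P >-> T}) (nu : I -> probability T R).
Hypothesis X_indep : independent_RVs X.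
Hypothesis X_law : forall i B, measurable B -> P (X i @^-1` B) = nu i B.
Variables (u : I -> T -> R) (v B : I -> R).
Hypothesis bu : forall i, bmeas (u i).
Hypothesis v0 : forall i, 0 <= v i.
Hypothesis cu : forall i, centred (nu i) (u i) (v i) (B i).

(** Lindeberg's method: the independent variables are replaced by Gaussian ones
    of the same variance, one after the other; each replacement costs a third
    moment. *)
Lemma lindeberg (s : seq I) K (h : R -> R) (x : R) : uniq s -> 0 <= K ->
  taylor3 K h ->
  `|\int[P]_w h (x + \sum_(i <- s) u i (X i w)) -
    \int[gaussian 0 (\sum_(i <- s) v i)]_z h (x + z)| <=
  K * \sum_(i <- s) (B i + 128 * Num.sqrt (v i) ^+ 3).
Proof.
move=> + K0; elim: s h x => [|i s IH] h x.
  move=> _ th; rewrite !big_nil mulr0.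
  under eq_Rintegral do rewrite big_nil.
  rewrite expect_cst; set a := Rintegral _ _ _.
  have -> : a = h (x + 0) by exact: (expect_gaussian0 (bmeas_translate x th.1)).
  by rewrite subrr normr0.
move=> /= us th; have [_ us'] := andP us.
have bh := th.1; have ch := taylor3_continuous K0 th.
pose S w := \sum_(i <- s) u i (X i w).
have mS : measurable_fun setT S.
  apply: measurable_sum => j.
  exact: measurableT_comp (bmeas_meas (bu j)) (measurable_funPT (X j)).
(* The expectation over the first summand, or over its Gaussian substitute. *)
pose g1 z := \int[nu i]_y h (z + u i y).
pose g2 z := \int[gaussian 0 (v i)]_y h (z + y).
have tg1 : taylor3 K g1 by apply: taylor3_average => //; exact: bmeas_meas.
have tg2 : taylor3 K g2 by exact: taylor3_average.
have E1 : \int[P]_w h (x + \sum_(j <- i :: s) u j (X j w)) = \int[P]_w g1 (x + S w).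
  pose st := in_tuple s.
  pose Su (t : (size s).-tuple T) := \sum_(k < size s) u (tnth st k) (tnth t k).
  have SuE w : Su (sample X st w) = S w.
    rewrite /Su /S (big_tnth _ _ s); apply: eq_bigr => k _.
    by rewrite tnth_mktuple.
  pose F (z : T * (size s).-tuple T) := h (x + (u i z.1 + Su z.2)).
  have bF : bmeas F.
    apply: (bmeas_comp bh); apply: measurable_funD => //.
    apply: measurable_funD.
      exact: measurableT_comp (bmeas_meas (bu i)) measurable_fst.
    apply: measurable_sum => k; apply: measurableT_comp (bmeas_meas (bu _)) _.
    exact: measurableT_comp (measurable_tnth k) measurable_snd.
  transitivity (\int[P]_w F (X i w, sample X st w)).
    by apply: eq_Rintegral => w _; rewrite /F/= SuE big_cons.
  rewrite (expect_freeze1 X_indep X_law)//; apply: eq_Rintegral => w _.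
  by apply: eq_Rintegral => y _; rewrite /F/= SuE [u i y + _]addrC addrA.
have bgS g : bmeas g -> bmeas (fun w => g (x + S w)).
  by move=> bg; apply: (bmeas_comp bg); exact: measurable_funD.
have D1 : `|\int[P]_w g1 (x + S w) - \int[P]_w g2 (x + S w)| <=
    K * (B i + 128 * Num.sqrt (v i) ^+ 3).
  rewrite -expectB; [|exact: bgS tg1.1|exact: bgS tg2.1].
  apply: expect_bound => [|w].
    by apply: bmeasB; [exact: bgS tg1.1|exact: bgS tg2.1].
  exact: (taylor3_swap K0 th (cu i) (gaussian_centred (v0 i))).
have D2 := IH g2 x us' tg2.
have E2 : \int[gaussian 0 (\sum_(i <- s) v i)]_z g2 (x + z) =
    \int[gaussian 0 (\sum_(j <- i :: s) v j)]_z h (x + z).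
  rewrite big_cons [v i + _]addrC.
  transitivity (\int[gaussian 0 (\sum_(i <- s) v i)]_z
      \int[gaussian 0 (v i)]_y h (x + (z + y))).
    by apply: eq_Rintegral => z _; apply: eq_Rintegral => y _; rewrite addrA.
  apply: (gaussian_semigroup _ (v0 i) (h := fun z => h (x + z))).
  - exact: sumr_ge0.
  - exact: bmeas_translate.
  - move=> z; apply: (continuous_comp (f := fun z : R => x + z)); last exact: ch.
    by apply: cvgD; [exact: cvg_cst|exact: cvg_id].
rewrite E1 -E2 [in leRHS]big_cons mulrDr.
apply: le_trans (lerD D1 D2).
exact: ler_distD.
Qed.

End lindeberg.

(** * Smooth test functions and convergence in law *)

Section smoothing.
Context (R : realType).
Notation mu := (@lebesgue_measure R).
Implicit Types (g h : R -> R) (s : R).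

Definition average s g x := s^-1 * \int[mu]_(t in `[x, x + s]) g t.

Lemma continuous_integrable g (a b : R) : continuous g ->
  mu.-integrable `[a, b] (EFin \o g).
Proof.
move=> cg; apply: continuous_compact_integrable; first exact: segment_compact.
exact: continuous_subspaceT.
Qed.

Lemma average_near s g x c e : 0 < s -> continuous g ->
  (forall t, x <= t <= x + s -> `|g t - c| <= e) -> `|average s g x - c| <= e.
Proof.
move=> s0 cg H; rewrite /average.
have len : fine (mu `[x, x + s]) = s.
  by rewrite lebesgue_measure_itv/= lte_fin ltrDl s0/= addrAC subrr add0r.
have ic k : mu.-integrable `[x, x + s] (EFin \o (fun=> k)).
  by apply: continuous_integrable => y; exact: cvg_cst.
have cE k : \int[mu]_(t in `[x, x + s]) k = k * s by rewrite Rintegral_cst// len.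
have -> : s^-1 * (\int[mu]_(t in `[x, x + s]) g t) - c =
    s^-1 * (\int[mu]_(t in `[x, x + s]) (g t - c)).
  rewrite RintegralB//; last exact: continuous_integrable.
  by rewrite cE mulrBr mulrCA mulVf ?mulr1// gt_eqF.
have igc : mu.-integrable `[x, x + s] (EFin \o (fun t => g t - c)).
  by apply: continuous_integrable => y; apply: cvgB; [exact: cg|exact: cvg_cst].
rewrite normrM gtr0_norm ?invr_gt0// ler_pdivrMl// mulrC.
apply: le_trans (le_normr_Rintegral _ igc) _ => //.
rewrite -cE; apply: le_Rintegral => //.
  exact: (integrable_norm igc).
Qed.

Lemma average_bounded s g K x : 0 < s -> continuous g ->
  (forall t, `|g t| <= K) -> `|average s g x| <= K.
Proof.
move=> s0 cg gK; rewrite -[average s g x]subr0.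
by apply: average_near => // t _; rewrite subr0.
Qed.

(** An average over a moving interval gains one derivative, given by a difference
    quotient; this is what makes the average of a continuous function smoother. *)
Lemma is_derive_average s g (x : R) : 0 < s -> continuous g ->
  is_derive x 1 (average s g) ((g (x + s) - g x) / s).
Proof.
(* The average is a difference of two values of a primitive, based below x. *)
move=> s0 cg; pose a := x - 1.
pose F z := \int[mu]_(t in `[a, z]) g t.
have dF z : a < z -> is_derive z 1 F (g z).
  move=> az; have [d1 d2] := @continuous_FTC1_closed _ g a z (z + 1)
    (ltr_pwDr ltr01 (lexx z)) (continuous_integrable a (z + 1) cg) az (cg z).
  exact: (DeriveDef d1 (etrans (esym (derive1E F z)) d2)).
have ax : a < x by rewrite /a ltrBlDr ltrDl.
have dG : is_derive x 1 (fun z => s^-1 * (F (z + s) - F z)) ((g (x + s) - g x) / s).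
  have d1 : is_derive x 1 (F \o (fun z => z + s)) (g (x + s) * 1).
    apply: is_derive1_comp; first by apply: dF; rewrite ltr_wpDr ?ltW.
    by apply: is_derive_eq; rewrite addr0.
  have d2 := dF x ax.
  have -> : (fun z => s^-1 * (F (z + s) - F z)) =
    cst s^-1 * ((F \o (fun z => z + s)) - F) by [].
  apply: is_derive_eq; rewrite /GRing.scale/= mulr0 addr0 mulr1; ring.
apply: near_eq_is_derive dG; near=> z.
have az : a < z by near: z; exact: lt_nbhsr.
rewrite /average /F; congr (_ * _).
rewrite (@Rintegral_itvB _ g (BLeft a) (BRight (z + s)) z).
- rewrite Rintegral_itv_obnd_cbnd//.
  apply: integrableS (continuous_integrable z (z + s) cg) => //.
  by apply: subset_itvr; rewrite bnd_simp.
- exact: continuous_integrable.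
- by rewrite bnd_simp ltW.
- by rewrite bnd_simp lerDl ltW.
Unshelve. all: by end_near. Qed.

Lemma derivable_continuous (F f : R -> R) :
  (forall x : R, is_derive x 1 F (f x)) -> continuous F.
Proof.
by move=> dF x; apply/differentiable_continuous/derivable1_diffP; exact: ex_derive.
Qed.

Lemma mean_value_bound (F f : R -> R) B (x t : R) :
  (forall y : R, is_derive y 1 F (f y)) ->
  (forall u, `|u| <= `|t| -> `|f (x + u)| <= B) ->
  `|F (x + t) - F x| <= B * `|t|.
Proof.
move=> dF fB; have cF := derivable_continuous dF.
have [t0|t0] := leP 0 t.
  have [||c cI ->] := @MVT_segment _ F f x (x + t).
  - by rewrite lerDl.
  - exact: continuous_subspaceT.
  rewrite normrM addrAC subrr add0r ler_wpM2r//.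
  rewrite (_ : c = x + (c - x)); last by ring.
  apply: fB; move: cI; rewrite in_itv/= => /andP[c1 c2].
  by rewrite !ger0_norm ?subr_ge0// lerBlDl.
have [||c cI E] := @MVT_segment _ F f (x + t) x.
- by rewrite gerDl ltW.
- exact: continuous_subspaceT.
rewrite distrC E normrM (_ : x - (x + t) = - t); last by ring.
rewrite normrN ler_wpM2r// (_ : c = x + (c - x)); last by ring.
apply: fB; move: cI; rewrite in_itv/= => /andP[c1 c2].
by rewrite distrC ger0_norm ?subr_ge0// ltr0_norm//; lra.
Qed.

(** Integrating the bound of the third derivative three times, by means of the mean
    value inequality. *)
Lemma taylor3_derivatives (h0 h1 h2 h3 : R -> R) M K :
  (forall x : R, is_derive x 1 h0 (h1 x)) ->
  (forall x : R, is_derive x 1 h1 (h2 x)) ->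
  (forall x : R, is_derive x 1 h2 (h3 x)) ->
  (forall x, `|h0 x| <= M) -> (forall x, `|h1 x| <= M) ->
  (forall x, `|h2 x| <= M) -> (forall x, `|h3 x| <= K) -> taylor3 K h0.
Proof.
move=> d0 d1 d2 b0 b1 b2 b3.
have bm (F f : R -> R) : (forall x : R, is_derive x 1 F (f x)) ->
    (forall x, `|F x| <= M) -> bmeas F.
  move=> dF FM; split; last by exists M.
  by apply: continuous_measurable_fun; exact: derivable_continuous dF.
split; first exact: bm d0 b0.
exists h1, h2; split; [exact: bm d1 b1|exact: bm d2 b2|move=> x t].
have s2 u : `|h2 (x + u) - h2 x| <= K * `|u|.
  exact: mean_value_bound.
have tr (F f : R -> R) (dF : forall x : R, is_derive x 1 F (f x)) (y : R) :
    is_derive y 1 (fun z => F (x + z)) (f (x + y)).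
  have dx : is_derive y 1 (fun z : R => x + z) 1.
    by apply: is_derive_eq; rewrite add0r mulr1.
  have : is_derive y 1 (F \o (fun z => x + z)) (f (x + y) * 1).
    exact: is_derive1_comp.
  by rewrite mulr1.
have K0 : 0 <= K := le_trans (normr_ge0 _) (b3 0).
have s1 u : `|h1 (x + u) - h1 x - u * h2 x| <= K * `|u| ^+ 2.
  pose G z := h1 (x + z) - h1 x - z * h2 x.
  have dG (y : R) : is_derive y 1 G (h2 (x + y) - h2 x).
    have := tr _ _ d1 y => dt.
    have -> : G = (fun z => h1 (x + z)) - cst (h1 x) - id * cst (h2 x) by [].
    apply: is_derive_eq; rewrite /GRing.scale/=; ring.
  have := @mean_value_bound G _ (K * `|u|) 0 u dG.
  rewrite /G add0r addr0 mul0r subr0 subrr subr0 -mulrA -expr2; apply.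
  move=> z zu; rewrite add0r; apply: le_trans (s2 z) _.
  by rewrite ler_wpM2l.
pose G z := h0 (x + z) - h0 x - z * h1 x - z ^+ 2 / 2 * h2 x.
have dG (y : R) : is_derive y 1 G (h1 (x + y) - h1 x - y * h2 x).
  have := tr _ _ d0 y => dt.
  have -> : G = (fun z => h0 (x + z)) - cst (h0 x) - id * cst (h1 x)
     - (id * id) * cst (2^-1 * h2 x).
    by apply/funext => z; rewrite /G !fctE/=; ring.
  by apply: is_derive_eq; rewrite /GRing.scale/=; field.
have := @mean_value_bound G _ (K * `|t| ^+ 2) 0 t dG.
rewrite {2}/G addr0 mul0r subrr expr0n/= !mul0r !subr0 add0r -mulrA -exprSr; apply.
move=> z zu; rewrite add0r; apply: le_trans (s1 z) _.
by rewrite ler_wpM2l// lerXn2r ?nnegrE.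
Qed.

(** Each average gains one derivative, and difference quotients of bounded functions are
    bounded. *)
Lemma taylor3_average3 s g M : 0 < s -> continuous g -> (forall t, `|g t| <= M) ->
  exists2 K, 0 <= K & taylor3 K (average s (average s (average s g))).
Proof.
move=> s0 cg gM.
(* The derivative of an average. *)
pose D f x := (f (x + s) - f x) / s : R.
have ca f : continuous f -> continuous (average s f).
  by move=> cf; apply: (derivable_continuous (f := D f)) => x; exact: is_derive_average.
have M0 : 0 <= M := le_trans (normr_ge0 _) (gM 0).
have DB f B : (forall x, `|f x| <= B) -> forall x, `|D f x| <= 2 * B / s.
  move=> fB x; rewrite /D normrM normfV (gtr0_norm s0) ler_pM2r ?invr_gt0//.
  by rewrite (le_trans (ler_normB _ _))// mulr_natl mulr2n lerD.
have aB f B : continuous f -> (forall x, `|f x| <= B) ->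
    forall x, `|average s f x| <= B.
  by move=> cf fB x; exact: average_bounded.
have dD (f k : R -> R) : (forall x : R, is_derive x 1 f (k x)) ->
    forall x : R, is_derive x 1 (D f) (D k x).
  move=> df x.
  have -> : D f = ((f \o (fun z => z + s)) - f) * cst s^-1 by [].
  apply: is_derive_eq; rewrite /GRing.scale/= /D; ring.
have da f : continuous f -> forall x : R, is_derive x 1 (average s f) (D f x).
  by move=> cf x; exact: is_derive_average.
have c1 := ca _ cg; have c2 := ca _ c1.
pose M' := M + 2 * M / s + 2 * (2 * M / s) / s.
have q1 : 0 <= 2 * M / s by rewrite !mulr_ge0// invr_ge0 ltW.
have q2 : 0 <= 2 * (2 * M / s) / s by rewrite !mulr_ge0// invr_ge0 ltW.
have q3 : 0 <= 2 * (2 * (2 * M / s) / s) / s by rewrite !mulr_ge0// invr_ge0 ltW.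
exists (2 * (2 * (2 * M / s) / s) / s) => //.
have b1 := aB _ _ cg gM; have b2 := aB _ _ c1 b1; have b3 := aB _ _ c2 b2.
have e1 := da _ c2; have e2 := dD _ _ (da _ c1); have e3 := dD _ _ (dD _ _ (da _ cg)).
refine (taylor3_derivatives e1 e2 e3 (M := M') _ _ _ (DB _ _ (DB _ _ (DB _ _ gM)))) => x.
- by apply: le_trans (b3 x) _; rewrite /M'; lra.
- by apply: le_trans (DB _ _ b2 x) _; rewrite /M'; lra.
- by apply: le_trans (DB _ _ (DB _ _ b1) x) _; rewrite /M'; lra.
Qed.

Lemma average3_near s g L x : 0 < s -> 0 <= L ->
  (forall x y, `|g x - g y| <= L * `|x - y|) ->
  `|average s (average s (average s g)) x - g x| <= 3 * s * L.
Proof.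
move=> s0 L0 gL; have cg : continuous g := lipschitz_continuousR gL.
have ca f : continuous f -> continuous (average s f).
  move=> cf; apply: (derivable_continuous (f := fun x => (f (x + s) - f x) / s)) => y.
  exact: is_derive_average.
have c1 := ca _ cg; have c2 := ca _ c1.
have near0 t : x <= t <= x + 3 * s -> `|g t - g x| <= 3 * s * L.
  move=> /andP[t1 t2]; apply: le_trans (gL t x) _.
  by rewrite mulrC ler_wpM2r// ger0_norm ?subr_ge0//; lra.
apply: average_near => // t /andP[t1 t2].
apply: average_near => // t' /andP[t1' t2'].
apply: average_near => // t'' /andP[t1'' t2''].
by apply: near0; apply/andP; split; lra.
Qed.

End smoothing.

Section minorants.
Context (R : realType).
Implicit Types (g h : R -> R).

(** The infimal convolution of h with a cone: the greatest k-Lipschitz function below h. *)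
Definition lipschitz_minorant h (k : R) x := inf [set h y + k * `|x - y| | y in setT].

Section minorant.
Variables (h : R -> R) (M k : R).
Hypotheses (k0 : 0 <= k) (hM : forall x, `|h x| <= M).
Let g := lipschitz_minorant h k.

Let hlo x : - M <= h x. Proof. by have := hM x; rewrite ler_norml => /andP[]. Qed.
Let hup x : h x <= M. Proof. by have := hM x; rewrite ler_norml => /andP[]. Qed.

Lemma lipschitz_minorant_le x y : g x <= h y + k * `|x - y|.
Proof.
apply: inf_lbound; last by exists y.
by exists (- M) => _ [z _ <-]; rewrite (le_trans (hlo z))// lerDl mulr_ge0.
Qed.

Lemma lipschitz_minorant_ge x c : (forall y, c <= h y + k * `|x - y|) -> c <= g x.
Proof.
move=> cle; apply: lb_le_inf; first by exists (h 0 + k * `|x - 0|), 0.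
by move=> _ [y _ <-].
Qed.

Lemma lipschitz_minorant_le_self x : g x <= h x.
Proof. by have := lipschitz_minorant_le x x; rewrite subrr normr0 mulr0 addr0. Qed.

Lemma lipschitz_minorant_bounded x : `|g x| <= M.
Proof.
rewrite ler_norml (le_trans (lipschitz_minorant_le_self x))// andbT.
by apply: lipschitz_minorant_ge => y; rewrite (le_trans (hlo y))// lerDl mulr_ge0.
Qed.

Lemma lipschitz_minorant_lipschitz x y : `|g x - g y| <= k * `|x - y|.
Proof.
have one a b : g a - g b <= k * `|a - b|.
  rewrite lerBlDr -lerBlDl; apply: lipschitz_minorant_ge => z.
  rewrite lerBlDr (le_trans (lipschitz_minorant_le a z))// -addrA lerD2l.
  by rewrite -mulrDr ler_wpM2l// [leRHS]addrC ler_distD.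
by rewrite ler_norml lerNl opprB one andbT distrC one.
Qed.

(** A point farther than r from x does not matter once the cone exceeds the oscillation
    of h there. *)
Lemma lipschitz_minorant_close x e r : 0 < e -> 0 < r ->
  (forall y, `|x - y| < r -> h x - e <= h y) -> 2 * M <= k * r -> h x - e <= g x.
Proof.
move=> e0 r0 near Mk; apply: lipschitz_minorant_ge => y.
have [xy|xy] := ltP `|x - y| r.
  by rewrite (le_trans (near y xy))// lerDl mulr_ge0.
have : k * r <= k * `|x - y| by rewrite ler_wpM2l.
by have := hlo y; have := hup x; move=> ? ? ?; lra.
Qed.

End minorant.

Lemma taylor3_subC K h c : taylor3 K h -> taylor3 K (fun x => h x - c).
Proof.
move=> [bh [h1 [h2 [bh1 bh2 hK]]]]; split.
  by apply: bmeasB => //; exact: bmeas_cst.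
exists h1, h2; split => // x t.
by rewrite (_ : h (x + t) - c - (h x - c) = h (x + t) - h x)//; ring.
Qed.

(** A bounded continuous function is the pointwise limit of smooth functions
    below it: average its Lipschitz minorants over short intervals. *)
Lemma taylor3_minorants h M : continuous h -> (forall x, `|h x| <= M) ->
  exists H : nat -> R -> R,
  [/\ forall n, exists2 K, 0 <= K & taylor3 K (H n),
      forall n x, H n x <= h x,
      forall n x, `|H n x| <= M + 3 &
      forall x, H n x @[n --> \oo] --> h x].
Proof.
move=> ch hM; have [v vE] : exists v : nat -> R, forall n, v n = n.+1%:R^-1.
  by exists (fun n => n.+1%:R^-1).
(* The error of averaging is of the order of s n times the Lipschitz constant n. *)
pose s n : R := v n ^+ 2.
pose g n := lipschitz_minorant h n%:R.
have n1 n : 0 < v n by rewrite vE invr_gt0.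
have s0 n : 0 < s n by rewrite exprn_gt0.
have gL n x y : `|g n x - g n y| <= n%:R * `|x - y|.
  by apply: (lipschitz_minorant_lipschitz (ler0n _ n) hM).
have cg n : continuous (g n) := lipschitz_continuousR (gL n).
pose a n := average (s n) (average (s n) (average (s n) (g n))).
have ag n x : `|a n x - g n x| <= 3 * v n.
  apply: le_trans (average3_near x (s0 n) (ler0n _ n) (gL n)) _.
  rewrite -mulrA ler_wpM2l// /s expr2 -mulrA ler_piMr// ?ltW//.
  by rewrite mulrC vE ltr_pdivrMr ?ltr0n// mul1r ltr_nat.
have agl n x : a n x - 3 * v n <= g n x.
  by have := ag n x; rewrite ler_norml => /andP[_ ?]; lra.
have agr n x : g n x - 6 * v n <= a n x - 3 * v n.
  by have := ag n x; rewrite ler_norml => /andP[? _]; lra.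
have gh n x : g n x <= h x by exact: (lipschitz_minorant_le_self (ler0n _ n) hM).
(* Subtracting the error of averaging keeps the smooth function below h. *)
exists (fun n x => a n x - 3 * v n); split.
- move=> n; have [K K0 tK] := taylor3_average3 (s0 n) (cg n)
    (lipschitz_minorant_bounded (ler0n _ n) hM).
  by exists K => //; exact: taylor3_subC.
- by move=> n x; exact: le_trans (agl n x) (gh n x).
- move=> n x; apply: (le_trans (ler_normB _ _)); apply: lerD.
    have cA f : continuous f -> continuous (average (s n) f).
      move=> cf; apply: (derivable_continuous (f := fun x => (f (x + s n) - f x) / s n)) => y.
      exact: is_derive_average.
    apply: average_bounded => //; first by apply: (cA); exact: (cA).
    move=> ?; apply: average_bounded => //; first by apply: (cA).
    move=> ?; apply: average_bounded => // ?.
    exact: (lipschitz_minorant_bounded (ler0n _ n) hM).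
  have vn0 := ltW (n1 n).
  rewrite ger0_norm ?mulr_ge0// -[leRHS]mulr1 ler_wpM2l// vE invf_le1//.
  by rewrite ler1n.
- move=> x; apply/cvgrPdist_le => e e0.
  have e2 : 0 < e / 2 by rewrite divr_gt0.
  have [r /= r0 hr] : \forall y \near x, `|h x - h y| < e / 2.
    by move/cvgrPdist_lt : (ch x) => /(_ _ e2).
  have near0 y : `|x - y| < r -> h x - e / 2 <= h y.
    move=> /hr /=; rewrite ltr_norml => /andP[_ ?]; lra.
  near=> n.
  have nr : 2 * M <= n%:R * r.
    rewrite -ler_pdivrMr//; near: n; exact: nbhs_infty_ger.
  have ne : 12 / e <= n.+1%:R.
    apply: (@le_trans _ _ n%:R); last by rewrite ler_nat.
    near: n; exact: nbhs_infty_ger.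
  have ne' : 6 * v n <= e / 2.
    rewrite vE ler_pdivrMr ?ltr0n// mulrC.
    by move: ne; rewrite ler_pdivrMr// => ?; lra.
  have gx : h x - e / 2 <= g n x.
    exact: (lipschitz_minorant_close (ler0n _ n) hM e2 r0 near0 nr).
  have u1 := agl n x; have u2 := agr n x; have u3 := gh n x.
  by rewrite ger0_norm; lra.
Unshelve. all: by end_near. Qed.

End minorants.

Section cvg_in_law.
Context (R : realType).
Context dO (Om : measurableType dO) (P : probability Om R).
Context (Y : nat -> Om -> R) (mu : probability (measurableTypeR R) R).
Hypothesis mY : forall n, measurable_fun setT (Y n).
Hypothesis Ytaylor : forall K h, 0 <= K -> taylor3 K h ->
  \int[P]_w h (Y n w) @[n --> \oo] --> \int[mu]_y h y.

Let lower (h : R -> R) M e : continuous h -> (forall x, `|h x| <= M) -> 0 < e ->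
  \forall n \near \oo, \int[mu]_y h y - e <= \int[P]_w h (Y n w).
Proof.
move=> ch hM e0; have [H [HK Hh HM Hc]] := taylor3_minorants ch hM.
have e2 : 0 < e / 2 by rewrite divr_gt0.
have bH n : bmeas (H n) by have [K _ []] := HK n.
have bh : bmeas h by split; [exact: continuous_measurable_fun|exists M].
have DC : \int[mu]_y H n y @[n --> \oo] --> \int[mu]_y h y.
  apply: fine_cvg; rewrite Rintegral_EFin//.
  have [] := @dominated_convergence _ _ R mu setT measurableT
    (fun n => EFin \o H n) (EFin \o h) (cst (M + 3)%:E) _ _ _ _ _ => //.
  - move=> n; apply/measurable_EFinP; exact: (bmeas_meas (bH n)).
  - apply/measurable_EFinP; exact: (bmeas_meas bh).
  - by apply: aeW => x _; apply: cvg_EFin; [near=> n|exact: Hc].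
  - exact: (bmeas_integrable mu (@bmeas_cst _ _ R (M + 3))).
  - by apply: aeW => x n _ /=; rewrite lee_fin.
have [k _ /(_ k (leqnn k)) hk] : \forall n \near \oo,
    `|\int[mu]_y h y - \int[mu]_y H n y| < e / 2.
  by move/cvgrPdist_lt : DC => /(_ _ e2).
have [K K0 tK] := HK k.
have /cvgrPdist_lt/(_ _ e2) := Ytaylor K0 tK; apply: filterS => n hn.
have : \int[P]_w H k (Y n w) <= \int[P]_w h (Y n w).
  by apply: expect_le => [||w]; [exact: bmeas_comp|exact: bmeas_comp|].
by move: hk hn; rewrite !ltr_norml => /andP[_ ?] /andP[_ ?] ?; lra.
Unshelve. all: by end_near. Qed.

(** Smooth test functions suffice: a bounded continuous function is the limit of
    smooth ones from below, which bounds the lower limit of the expectations, and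
    its opposite bounds the upper limit. *)
Lemma cvg_in_law_taylor3 : cvg_in_law P Y mu.
Proof.
split=> // h ch [M0 [_ hM0]].
pose M := M0 + 1.
have hM x : `|h x| <= M by apply: hM0 => //; rewrite ltrDl.
have bh : bmeas h by split; [exact: continuous_measurable_fun|exists M].
have bhY n : bmeas (fun w => h (Y n w)) by exact: bmeas_comp.
rewrite -Rintegral_EFin//; under eq_fun do rewrite -Rintegral_EFin//.
apply: cvg_EFin; first by near=> n.
apply/cvgrPdist_le => e e0.
have L1 := lower ch hM e0.
have cN : continuous (fun x => - h x) by move=> x; apply: cvgN; exact: ch.
have hN x : `|- h x| <= M by rewrite normrN.
have L2 := lower cN hN e0.
have NE d' (T' : measurableType d') (Q : probability T' R) (f : T' -> R) : bmeas f ->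
    \int[Q]_x (- f x) = - \int[Q]_x f x.
  move=> bf; under eq_Rintegral do rewrite -mulN1r.
  by rewrite expectZ// mulN1r.
near=> n; have h1 : \int[mu]_y h y - e <= \int[P]_w h (Y n w) by near: n.
have h2 : \int[mu]_y (- h y) - e <= \int[P]_w (- h (Y n w)) by near: n.
by move: h2; rewrite !NE// => h2; rewrite /= ler_norml; apply/andP; split; lra.
Unshelve. all: by end_near. Qed.

End cvg_in_law.

(** * Averages over multi-indices *)

Section index_average.
Context (R : realFieldType) (m n : nat).
Notation J := {ffun 'I_m -> 'I_n.+1}.
Implicit Types (F G : J -> R) (phi psi : 'I_n.+1 -> R) (j k : 'I_m) (l : 'I_n.+1).

Definition avg1 phi : R := n.+1%:R^-1 * \sum_l phi l.
Definition avg F : R := n.+1%:R^-1 ^+ m * \sum_i F i.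
(** The factor n.+1 makes it a conditional average given that the j-th coordinate is l:
    for a density on the multi-indices, this is the density of its j-th marginal. *)
Definition marg j l F : R := n.+1%:R * avg (fun i => (i j == l)%:R * F i).

Lemma eq_avg F G : F =1 G -> avg F = avg G.
Proof. by move=> FG; rewrite /avg (eq_bigr G). Qed.

Lemma eq_avg1 phi psi : phi =1 psi -> avg1 phi = avg1 psi.
Proof. by move=> FG; rewrite /avg1 (eq_bigr psi). Qed.

Lemma eq_marg j l F G : (forall i : J, i j = l -> F i = G i) -> marg j l F = marg j l G.
Proof.
move=> FG; congr (_ * _); apply: eq_avg => i.
by case: eqP => [/FG ->//|_]; rewrite !mul0r.
Qed.

Lemma avgD F G : avg (fun i => F i + G i) = avg F + avg G.
Proof. by rewrite /avg big_split mulrDr. Qed.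

Lemma avgZ c F : avg (fun i => c * F i) = c * avg F.
Proof. by rewrite /avg -mulr_sumr mulrCA. Qed.

Lemma avg1D phi psi : avg1 (fun i => phi i + psi i) = avg1 phi + avg1 psi.
Proof. by rewrite /avg1 big_split mulrDr. Qed.

Lemma avg1Z c phi : avg1 (fun i => c * phi i) = c * avg1 phi.
Proof. by rewrite /avg1 -mulr_sumr mulrCA. Qed.

Lemma avg_sum (I : Type) (r : seq I) (Q : pred I) (F : I -> J -> R) :
  avg (fun i => \sum_(t <- r | Q t) F t i) = \sum_(t <- r | Q t) avg (F t).
Proof. by rewrite /avg exchange_big mulr_sumr. Qed.

Lemma avg1_cst c : avg1 (fun=> c) = c.
Proof.
by rewrite /avg1 sumr_const card_ord -(mulr_natl c) mulrA mulVf ?mul1r// pnatr_eq0.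
Qed.

Lemma avg_prod (f : 'I_m -> 'I_n.+1 -> R) :
  avg (fun i : J => \prod_j f j (i j)) = \prod_j avg1 (f j).
Proof.
rewrite /avg /avg1 -bigA_distr_bigA/=.
rewrite big_split/= prodr_const card_ord; congr (_ * _).
Qed.

Lemma avg_coord j phi : avg (fun i : J => phi (i j)) = avg1 phi.
Proof.
pose f k := if k == j then phi else fun=> 1.
rewrite (_ : avg _ = avg (fun i : J => \prod_k f k (i k))).
  rewrite avg_prod (bigD1 j)//= /f eqxx big1 ?mulr1// => k /negbTE ->.
  exact: avg1_cst.
apply: eq_avg => i; rewrite (bigD1 j)//= /f eqxx big1 ?mulr1// => k /negbTE ->.
by [].
Qed.

Lemma avg_coord2 j k phi psi : j != k ->
  avg (fun i : J => phi (i j) * psi (i k)) = avg1 phi * avg1 psi.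
Proof.
move=> jk; pose f t := if t == j then phi else if t == k then psi else fun=> 1.
have kj : (k == j) = false by rewrite eq_sym; exact: negbTE.
rewrite (_ : avg _ = avg (fun i : J => \prod_t f t (i t))).
  rewrite avg_prod (bigD1 j)//= (bigD1 k)/= ?kj// /f eqxx kj eqxx.
  rewrite big1 ?mulr1// => t /andP[/negbTE -> /negbTE ->]; exact: avg1_cst.
apply: eq_avg => i; rewrite (bigD1 j)//= (bigD1 k)/= ?kj// /f eqxx kj eqxx.
by rewrite big1 ?mulr1// => t /andP[/negbTE -> /negbTE ->].
Qed.

Lemma avg1_eq l phi : avg1 (fun t => (t == l)%:R * phi t) = n.+1%:R^-1 * phi l.
Proof.
rewrite /avg1 (bigD1 l)//= eqxx mul1r big1 ?addr0// => t /negbTE ->.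
by rewrite mul0r.
Qed.

Lemma avg1_eq1 l : avg1 (fun t => (t == l)%:R) = n.+1%:R^-1.
Proof.
have := avg1_eq l (fun=> 1); rewrite mulr1 => <-.
by apply: eq_avg1 => t; rewrite mulr1.
Qed.

Lemma avg_ge0 F : (forall i, 0 <= F i) -> 0 <= avg F.
Proof. by move=> F0; rewrite mulr_ge0 ?exprn_ge0 ?invr_ge0// sumr_ge0. Qed.

Lemma le_avg F G : (forall i, F i <= G i) -> avg F <= avg G.
Proof. by move=> FG; rewrite ler_wpM2l ?exprn_ge0 ?invr_ge0// ler_sum. Qed.

Lemma le_avg1 phi psi : (forall i, phi i <= psi i) -> avg1 phi <= avg1 psi.
Proof. by move=> FG; rewrite ler_wpM2l ?invr_ge0// ler_sum. Qed.

Lemma avg1_ge0 phi : (forall i, 0 <= phi i) -> 0 <= avg1 phi.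
Proof. by move=> F0; rewrite mulr_ge0 ?invr_ge0// sumr_ge0. Qed.

Lemma margD j l F G : marg j l (fun i => F i + G i) = marg j l F + marg j l G.
Proof.
by rewrite /marg -mulrDr -avgD; congr (_ * _); apply: eq_avg => i; rewrite mulrDr.
Qed.

Lemma margZ j l c F : marg j l (fun i => c * F i) = c * marg j l F.
Proof.
by rewrite /marg [RHS]mulrCA -(avgZ c); congr (_ * _); apply: eq_avg => i; rewrite mulrCA.
Qed.

Lemma marg_sum j l (I : Type) (r : seq I) (Q : pred I) (F : I -> J -> R) :
  marg j l (fun i => \sum_(t <- r | Q t) F t i) = \sum_(t <- r | Q t) marg j l (F t).
Proof.
rewrite /marg -mulr_sumr -avg_sum; congr (_ * _).
by apply: eq_avg => i; rewrite mulr_sumr.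
Qed.

Lemma le_marg j l F G : (forall i : J, i j = l -> F i <= G i) -> marg j l F <= marg j l G.
Proof.
move=> FG; rewrite ler_wpM2l//; apply: le_avg => i.
by case: eqP => [/FG|_]; rewrite ?mul1r ?mul0r.
Qed.

Lemma marg_norm j l F : `|marg j l F| <= marg j l (fun i => `|F i|).
Proof.
rewrite ler_norml -mulN1r -margZ; apply/andP; split; apply: le_marg => i _.
  by rewrite mulN1r lerNl -normrN ler_norm.
exact: ler_norm.
Qed.

Lemma marg_coord j l phi : marg j l (fun i : J => phi (i j)) = phi l.
Proof.
rewrite /marg (avg_coord j (fun t => (t == l)%:R * phi t)) avg1_eq mulrA.
by rewrite divff ?mul1r// pnatr_eq0.
Qed.

Lemma marg_cst j l c : marg j l (fun=> c) = c.
Proof. exact: (marg_coord j l (fun=> c)). Qed.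

Lemma marg_coord_neq j k l phi : j != k -> marg j l (fun i : J => phi (i k)) = avg1 phi.
Proof.
move=> jk; rewrite /marg (avg_coord2 (fun t => (t == l)%:R) _ jk) avg1_eq1 mulrA.
by rewrite divff ?mul1r// pnatr_eq0.
Qed.

Lemma avg1_marg j F : avg1 (fun l => marg j l F) = avg F.
Proof.
rewrite /avg1 /marg -mulr_sumr mulrA mulVf ?pnatr_eq0// mul1r -avg_sum.
apply: eq_avg => i; rewrite (bigD1 (i j))//= eqxx mul1r big1 ?addr0// => l.
by rewrite eq_sym => /negbTE ->; rewrite mul0r.
Qed.

Lemma avg_cst c : avg (fun=> c) = c.
Proof.
rewrite /avg sumr_const card_ffun !card_ord -(mulr_natl c) natrX mulrA -exprMn.
by rewrite mulVf ?expr1n ?mul1r// pnatr_eq0.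
Qed.

Lemma avg_sqr F : avg F ^+ 2 <= avg (fun i => F i ^+ 2).
Proof.
have : 0 <= avg (fun i => (F i - avg F) ^+ 2) by apply: avg_ge0 => i; exact: sqr_ge0.
rewrite (@eq_avg _ (fun i => (F i ^+ 2 + (- 2 * avg F) * F i) + avg F ^+ 2)); last first.
  by move=> i; ring.
rewrite !avgD avgZ avg_cst => h; rewrite -subr_ge0; apply: le_trans h _.
by rewrite le_eqVlt; apply/orP; left; apply/eqP; ring.
Qed.

Lemma sum_sqr (I : finType) (x : I -> R) :
  (\sum_i x i) ^+ 2 <= #|I|%:R * \sum_i x i ^+ 2.
Proof.
rewrite expr2 mulr_suml.
apply: (@le_trans _ _ (\sum_i \sum_j (x i ^+ 2 + x j ^+ 2) / 2)).
  apply: ler_sum => i _; rewrite mulr_sumr; apply: ler_sum => j _.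
  by have := sqr_ge0 (x i - x j); rewrite sqrrB => ?; lra.
under eq_bigr do under eq_bigr do rewrite mulrDl.
under eq_bigr do rewrite big_split/=.
rewrite big_split/= [X in _ + X]exchange_big/=.
have -> : \sum_i \sum_(j : I) x i ^+ 2 / 2 = #|I|%:R * (\sum_i x i ^+ 2) / 2.
  rewrite mulr_sumr mulr_suml; apply: eq_bigr => i _.
  by rewrite sumr_const -(mulr_natl (x i ^+ 2 / 2)) mulrA.
by rewrite -splitr.
Qed.

End index_average.

(** * Rounding a density to exact marginals *)

Section rounding.
Context (R : realFieldType) (m : nat).
Variables (del K : R).
Hypotheses (m0 : (0 < m)%N) (del0 : 0 < del) (del1 : del <= 1) (K1 : 1 <= K).

Let M : R := m%:R.
Let tau := del / (4 * M).
Let rounding_constant : R :=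
  K ^+ 3 / tau ^+ 3 + 3 * (K ^+ 2 / tau ^+ 2 + 2 * M * (2 + 2 * M * (K ^+ 2 / tau ^+ 2))).

Let M1 : 1 <= M. Proof. by rewrite ler1n. Qed.
Let M0 : 0 < M. Proof. exact: lt_le_trans M1. Qed.
Let K0 : 0 < K. Proof. exact: lt_le_trans K1. Qed.
Let tau0 : 0 < tau. Proof. by rewrite divr_gt0// mulr_gt0. Qed.
Let tau1 : tau <= 1.
Proof. by rewrite ler_pdivrMr ?mulr_gt0// mul1r; move: M1 del1 => ? ?; lra. Qed.
Let tau4 : 4 * M * tau = del.
Proof. by rewrite /tau; field; rewrite gt_eqF. Qed.

Let rounding_constant_ge0 : 0 <= rounding_constant.
Proof.
have K0' := ltW K0; have tau0' := ltW tau0; have M0' := ltW M0.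
by rewrite !(addr_ge0, mulr_ge0)// ?invr_ge0 ?exprn_ge0.
Qed.

Section density.
Variables (n : nat) (p : {ffun 'I_m -> 'I_n.+1} -> R).
Notation J := {ffun 'I_m -> 'I_n.+1}.
Hypothesis pK : forall i, del <= p i <= K.

Let a j l := marg j l p - 1.
Let eta := \sum_j avg1 (fun l => a j l ^+ 2).

(** Resetting the density to 1 as soon as one coordinate is bad, that is, has a marginal
    density far from 1, makes all the marginal densities uniformly close to 1; the
    bad indices are few by Chebyshev's inequality. *)
Let bad j l := tau < `|a j l|.
Let beta j := avg1 (fun l => (bad j l)%:R : R).
Let b := \sum_j beta j.
Let isbad (i : J) := [exists j, bad j (i j)].
Let p1 i := if isbad i then 1 else p i.
Let a1 j l := marg j l p1 - 1.
Let a0 := avg p1 - 1.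
(** The marginal errors of p1 are removed additively. Subtracting one of them changes
    the other marginals by the constant a0, whence the last term. Where the errors are
    small, q stays nonnegative because p1 is at least del. *)
Let q i := p1 i - \sum_j a1 j (i j) + (M - 1) * a0.

Let beta0 j : 0 <= beta j.
Proof. by apply: avg1_ge0 => l; rewrite ler0n. Qed.

Let b0 : 0 <= b. Proof. exact: sumr_ge0. Qed.

Let eta_j0 j : 0 <= avg1 (fun l => a j l ^+ 2).
Proof. by apply: avg1_ge0 => l; exact: sqr_ge0. Qed.

Let beta_le j : tau ^+ 2 * beta j <= avg1 (fun l => a j l ^+ 2).
Proof.
rewrite -avg1Z; apply: le_avg1 => l; rewrite /bad.
case: ltP => [h|_]; last by rewrite mulr0 sqr_ge0.
by rewrite mulr1 -[leRHS]real_normK ?num_real// lerXn2r// ?nnegrE// ltW.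
Qed.

Let b_le : tau ^+ 2 * b <= eta.
Proof. by rewrite mulr_sumr; apply: ler_sum => j _; exact: beta_le. Qed.

Let p_close i : `|p i - 1| <= K.
Proof.
have /andP[h1 h2] := pK i; move: K1 del0 => ? ?.
by rewrite ler_norml; apply/andP; split; lra.
Qed.

Let isbad_le i : (isbad i)%:R <= \sum_j (bad j (i j))%:R :> R.
Proof.
rewrite /isbad; case: existsP => [[j bj]|_]; last by apply: sumr_ge0.
by rewrite (bigD1 j)//= bj lerDl sumr_ge0.
Qed.

Let p1_close i : `|p1 i - p i| <= K * (isbad i)%:R.
Proof.
rewrite /p1; case: ifP => _; last by rewrite subrr normr0 mulr0.
by rewrite mulr1 distrC.
Qed.

Let a1_bad j l : bad j l -> a1 j l = 0.
Proof.
move=> bjl; rewrite /a1 (@eq_marg _ _ _ j l p1 (fun=> 1)) ?marg_cst ?subrr//.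
move=> i ij; rewrite /p1 ifT//; apply/existsP; exists j; by rewrite ij.
Qed.

(** Resetting the density changes the marginal at a good point only through the bad
    values of the other coordinates. *)
Let a1_close j l : `|a1 j l| <= `|a j l| + K * b.
Proof.
have [/a1_bad ->|nb] := boolP (bad j l).
  by rewrite normr0 addr_ge0// mulr_ge0// ltW.
have -> : a1 j l = a j l + marg j l (fun i => p1 i + -1 * p i).
  by rewrite margD margZ /a1 /a; ring.
apply: le_trans (ler_normD _ _) _; rewrite lerD2l.
apply: le_trans (marg_norm _ _ _) _.
apply: (@le_trans _ _ (marg j l (fun i => K * \sum_k (bad k (i k))%:R))).
  apply: le_marg => i _; rewrite mulN1r (le_trans (p1_close i))//.
  by rewrite ler_wpM2l ?isbad_le// ltW.
rewrite margZ marg_sum ler_wpM2l//; first exact: ltW.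
apply: ler_sum => k _; have [<-|jk] := eqVneq j k.
  by rewrite (marg_coord j l (fun l => (bad j l)%:R)) (negbTE nb).
by rewrite (marg_coord_neq l (fun l => (bad k l)%:R) jk).
Qed.

Let avg1_a1 j : avg1 (a1 j) = a0.
Proof.
rewrite /a1 (@eq_avg1 _ _ _ (fun l => marg j l p1 + -1 * 1)); last first.
  by move=> l; ring.
by rewrite avg1D avg1_marg avg1_cst /a0; ring.
Qed.

Let marg_q j l : marg j l q = 1.
Proof.
rewrite /q margD marg_cst.
have -> : marg j l (fun i => p1 i - \sum_k a1 k (i k)) =
    marg j l p1 + -1 * \sum_k marg j l (fun i : J => a1 k (i k)).
  by rewrite -marg_sum -margZ -margD; apply: eq_marg => i _; rewrite mulN1r.
rewrite (bigD1 j)//= marg_coord (eq_bigr (fun=> a0)); last first.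
  by move=> k kj; rewrite marg_coord_neq 1?eq_sym// avg1_a1.
rewrite sumr_const (_ : #|_| = m.-1); last first.
  by rewrite cardC1 card_ord.
have -> : a0 *+ m.-1 = (M - 1) * a0.
  by rewrite -(mulr_natl a0) /M -[in RHS](prednK m0) -natr1 addrK.
by rewrite /a1; ring.
Qed.

Section small.
Hypothesis Kb : K * b <= tau.

Let a1_small j l : `|a1 j l| <= 2 * tau.
Proof.
have [/a1_bad ->|nb] := boolP (bad j l); first by rewrite normr0 mulr_ge0// ltW.
have := a1_close j l; move: nb; rewrite /bad -leNgt => ? ?; move: Kb => ?; lra.
Qed.

Let a0_small : `|a0| <= 2 * tau.
Proof.
rewrite -(avg1_a1 (Ordinal m0)) ler_norml.
have cst c : c = avg1 (fun _ : 'I_n.+1 => c) :> R by rewrite avg1_cst.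
apply/andP; split; [rewrite [leLHS]cst|rewrite [leRHS]cst]; apply: le_avg1 => l;
  by have := a1_small (Ordinal m0) l; rewrite ler_norml => /andP[].
Qed.

Let q_ge0 i : 0 <= q i.
Proof.
have h1 : del <= p1 i by rewrite /p1; case: ifP => // _; have /andP[] := pK i.
have h2 : \sum_j a1 j (i j) <= M * (2 * tau).
  apply: (@le_trans _ _ (\sum_(j < m) 2 * tau)).
    by apply: ler_sum => j _; exact: le_trans (ler_norm _) (a1_small _ _).
  by rewrite sumr_const card_ord -(mulr_natl (2 * tau)).
have h3 : - ((M - 1) * (2 * tau)) <= (M - 1) * a0.
  rewrite -mulrN ler_wpM2l//; first by rewrite subr_ge0.
  by have := a0_small; rewrite ler_norml => /andP[].
rewrite /q; move: tau4 tau0 => ? ?; nra.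
Qed.

Let q_close : avg (fun i => (q i - p i) ^+ 2) <= rounding_constant * eta.
Proof.
have K0' := ltW K0; have tau0' := ltW tau0; have M0' := ltW M0.
have three (x y z : R) : (x - y + z) ^+ 2 <= 3 * (x ^+ 2 + y ^+ 2 + z ^+ 2).
  by have := sqr_ge0 (x + y); have := sqr_ge0 (x - z); have := sqr_ge0 (y + z);
    rewrite !sqrrD !sqrrN => ? ? ?; nra.
pose S i := \sum_j a1 j (i j).
have S2 : avg (fun i => S i ^+ 2) <= M * \sum_j avg1 (fun l => a1 j l ^+ 2).
  apply: (@le_trans _ _ (avg (fun i => M * \sum_j a1 j (i j) ^+ 2))).
    by apply: le_avg => i; have := sum_sqr (fun j => a1 j (i j)); rewrite card_ord.
  rewrite avgZ avg_sum ler_wpM2l//; apply: ler_sum => j _.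
  by rewrite (avg_coord j (fun l => a1 j l ^+ 2)).
have avgS : avg S = M * a0.
  rewrite avg_sum (eq_bigr (fun=> a0)); last by move=> j _; rewrite avg_coord avg1_a1.
  by rewrite sumr_const card_ord -(mulr_natl a0).
have a02 : ((M - 1) * a0) ^+ 2 <= avg (fun i => S i ^+ 2).
  apply: le_trans (avg_sqr S); rewrite avgS !exprMn ler_wpM2r ?sqr_ge0//.
  by rewrite lerXn2r// ?nnegrE ?subr_ge0//; move: M1 => ?; lra.
have p12 : avg (fun i => (p1 i - p i) ^+ 2) <= K ^+ 2 * b.
  apply: (@le_trans _ _ (avg (fun i => K ^+ 2 * \sum_j (bad j (i j))%:R))).
    apply: le_avg => i; rewrite -real_normK ?num_real//.
    apply: (@le_trans _ _ ((K * (isbad i)%:R) ^+ 2)).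
      by rewrite lerXn2r// ?nnegrE ?mulr_ge0.
    rewrite exprMn ler_wpM2l ?sqr_ge0// (le_trans _ (isbad_le i))//.
    by case: isbad; rewrite ?expr1n ?expr0n.
  rewrite avgZ avg_sum ler_wpM2l ?sqr_ge0//; apply: ler_sum => j _.
  by rewrite (avg_coord j (fun l => (bad j l)%:R)).
have a12 : \sum_j avg1 (fun l => a1 j l ^+ 2) <= 2 * eta + 2 * M * (K ^+ 2 * b).
  apply: (@le_trans _ _ (\sum_j (2 * avg1 (fun l => a j l ^+ 2) + 2 * (K ^+ 2 * b)))).
    apply: ler_sum => j _; rewrite -avg1Z -[X in _ + X](@avg1_cst _ n) -avg1D.
    apply: le_avg1 => l; rewrite -[leLHS]real_normK ?num_real//.
    have Kb0 : 0 <= K * b by rewrite mulr_ge0.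
    have h : `|a1 j l| ^+ 2 <= (`|a j l| + K * b) ^+ 2.
      by rewrite lerXn2r// ?nnegrE ?addr_ge0.
    apply: le_trans h _; rewrite -[a j l ^+ 2]real_normK ?num_real//.
    have hb : (K * b) ^+ 2 <= K ^+ 2 * b.
      rewrite exprMn ler_wpM2l ?sqr_ge0// expr2 ler_piMl//.
      have := Kb; have := tau1; have := K1; have := b0 => ? ? ? ?.
      have : b <= K * b by rewrite ler_peMl.
      by move=> ?; lra.
    have := sqr_ge0 (`|a j l| - K * b); rewrite sqrrB => ?; rewrite sqrrD; lra.
  rewrite big_split/= -mulr_sumr sumr_const card_ord -(mulr_natl (2 * _)).
  by rewrite -/eta le_eqVlt; apply/orP; left; apply/eqP; rewrite /M; ring.
have bE : b <= eta / tau ^+ 2 by rewrite ler_pdivlMr ?exprn_gt0// mulrC.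
have eta0 : 0 <= eta by apply: sumr_ge0.
apply: (@le_trans _ _ (3 * (K ^+ 2 * b + 2 * (M * (2 * eta + 2 * M * (K ^+ 2 * b)))))).
  apply: (@le_trans _ _ (avg (fun i => 3 * ((p1 i - p i) ^+ 2 + S i ^+ 2 +
      ((M - 1) * a0) ^+ 2)))).
    apply: le_avg => i; apply: le_trans (three _ _ _).
    by rewrite le_eqVlt; apply/orP; left; apply/eqP; rewrite /q /S; ring.
  rewrite avgZ !avgD avg_cst ler_wpM2l// -addrA lerD// mulr_natl mulr2n.
  have SM : avg (fun i => S i ^+ 2) <= M * (2 * eta + 2 * M * (K ^+ 2 * b)).
    by apply: le_trans S2 _; rewrite ler_wpM2l.
  by rewrite lerD//; exact: le_trans a02 SM.
have Kb2 : K ^+ 2 * b <= K ^+ 2 / tau ^+ 2 * eta.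
  by rewrite -mulrA ler_wpM2l ?sqr_ge0// mulrC.
rewrite /rounding_constant.
set k := K ^+ 2 / tau ^+ 2 in Kb2 *; set X := K ^+ 2 * b in Kb2 *.
have k3 : 0 <= K ^+ 3 / tau ^+ 3 * eta by rewrite !mulr_ge0// ?invr_ge0 ?exprn_ge0.
have MMX : M * (M * X) <= M * (M * (k * eta)) by rewrite !ler_wpM2l.
rewrite [leRHS]mulrDl; apply: (@le_trans _ _
  (0 + (3 * (k * eta) + 12 * (M * eta) + 12 * (M * (M * (k * eta)))))).
  by rewrite add0r; lra.
apply: lerD; first exact: k3.
by rewrite le_eqVlt; apply/orP; left; apply/eqP; ring.
Qed.

Lemma rounding_small : exists q : J -> R, [/\ forall i, 0 <= q i,
  forall j l, marg j l q = 1 &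
  avg (fun i => (q i - p i) ^+ 2) <= rounding_constant * eta].
Proof. by exists q. Qed.

End small.

(** If there are many bad indices, the marginal errors are so large that the constant
    density 1 is good enough. *)
Lemma rounding_large : tau < K * b -> exists q : J -> R, [/\ forall i, 0 <= q i,
  forall j l, marg j l q = 1 &
  avg (fun i => (q i - p i) ^+ 2) <= rounding_constant * eta].
Proof.
have K0' := ltW K0; have tau0' := ltW tau0; have M0' := ltW M0.
move=> Kb; exists (fun=> 1); split => // [j l|]; first exact: marg_cst.
apply: (@le_trans _ _ (K ^+ 2)).
  rewrite -[leRHS](@avg_cst _ m n); apply: le_avg => i.
  by rewrite -real_normK ?num_real// distrC lerXn2r// ?nnegrE.
(* Chebyshev's inequality turns the abundance of bad indices into a lower bound of eta. *)
have h : tau ^+ 3 <= K * eta.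
  rewrite exprSr; apply: (@le_trans _ _ (tau ^+ 2 * (K * b))).
    by rewrite ler_wpM2l ?sqr_ge0// ltW.
  by rewrite mulrCA ler_wpM2l.
have t3 : 0 < tau ^+ 3 by rewrite exprn_gt0.
have eta0 : 0 <= eta by apply: sumr_ge0.
apply: (@le_trans _ _ (K ^+ 3 / tau ^+ 3 * eta)).
  rewrite [leRHS](_ : _ = K ^+ 2 * (K * eta) / tau ^+ 3); last by ring.
  rewrite ler_pdivlMr//.
  by rewrite ler_wpM2l ?sqr_ge0.
rewrite ler_wpM2r// /rounding_constant lerDl.
by rewrite !(addr_ge0, mulr_ge0)// ?invr_ge0 ?exprn_ge0.
Qed.

Lemma rounding_density : exists q : J -> R, [/\ forall i, 0 <= q i,
  forall j l, marg j l q = 1 &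
  avg (fun i => (q i - p i) ^+ 2) <= rounding_constant * eta].
Proof. by have [/rounding_small|/rounding_large] := leP (K * b) tau. Qed.

End density.

(** The additive correction of the marginals when there are few bad indices, the constant
    density 1 otherwise; the constant C is uniform in n. *)
Lemma rounding : exists2 C : R, 0 <= C &
  forall n (p : {ffun 'I_m -> 'I_n.+1} -> R), (forall i, del <= p i <= K) ->
  exists q : {ffun 'I_m -> 'I_n.+1} -> R, [/\ forall i, 0 <= q i,
    forall j l, marg j l q = 1 &
    avg (fun i => (q i - p i) ^+ 2) <=
      C * \sum_j avg1 (fun l => (marg j l p - 1) ^+ 2)].
Proof.
by exists rounding_constant => // n p pK; exact: rounding_density.
Qed.

End rounding.

(** * Relative entropy *)

Section density_probability.
Local Open Scope ereal_scope.
Context d (U : measurableType d) (R : realType) (Q : probability U R) (g : U -> R).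

Definition with_density (bg : bmeas g) (g0 : forall x, (0 <= g x)%R)
    (g1 : (\int[Q]_x g x = 1)%R) : set U -> \bar R :=
  fun V => \int[Q]_(x in V) (g x)%:E.

Variables (bg : bmeas g) (g0 : forall x, (0 <= g x)%R) (g1 : (\int[Q]_x g x = 1)%R).

Let density0 : with_density bg g0 g1 set0 = 0.
Proof. by rewrite /with_density integral_set0. Qed.

Let density_ge0 V : 0 <= with_density bg g0 g1 V.
Proof. by apply: integral_ge0 => x _; rewrite lee_fin. Qed.

Let density_sigma_additive : semi_sigma_additive (with_density bg g0 g1).
Proof.
move=> A mA tA mUA; rewrite /with_density integral_bigcup//=; last first.
  by apply: (integrableS _ _ (subsetT _)) => //; exact: bmeas_integrable.
apply: is_cvg_ereal_nneg_natsum_cond => n _ _.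
by apply: integral_ge0 => x _; rewrite lee_fin.
Qed.

HB.instance Definition _ := isMeasure.Build _ _ _
  (with_density bg g0 g1) density0 density_ge0 density_sigma_additive.

Let density_setT : with_density bg g0 g1 setT = 1.
Proof. by rewrite /with_density -Rintegral_EFin// g1. Qed.

HB.instance Definition _ :=
  @Measure_isProbability.Build _ _ R (with_density bg g0 g1) density_setT.

End density_probability.

Section kullback_leibler.
Local Open Scope ereal_scope.
Context d (U : measurableType d) (R : realType).
Implicit Types (P Q : probability U R) (f : U -> \bar R).

Lemma measurable_lne f : measurable_fun setT f -> (forall x, f x \is a fin_num) ->
  measurable_fun setT (fun x => lne (f x)).
Proof.
move=> mf ff; have mff : measurable_fun setT (fun x => fine (f x)).
  exact: measurableT_comp.
rewrite (_ : (fun x => _) = fun x => if (0 < fine (f x))%R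
    then (ln (fine (f x)))%:E else -oo).
  apply: measurable_fun_ifT => //; last first.
    by apply/measurable_EFinP; exact: measurableT_comp.
  exact: measurable_fun_ltr.
apply/funext => x; rewrite -[in LHS](fineK (ff x)); case: ltP => h.
  by rewrite lne_EFin.
by rewrite le0_lneNy ?lee_fin.
Qed.

(** Positive and negative parts are monotone, and the convention +oo - +oo = -oo agrees
    with this when both are infinite. *)
Lemma le_integral_lower P f f' : measurable_fun setT f -> measurable_fun setT f' ->
  (forall x, f' x <= f x) -> \int[P]_x f' x <= \int[P]_x f x.
Proof.
move=> mf mf' ff'; rewrite [leLHS]integralE [leRHS]integralE.
apply: leeB; apply: ge0_le_integral => //.
- exact: measurable_funepos.
- exact: measurable_funepos.
- by move=> x _; apply: (@funepos_le _ _ setT) => //; rewrite inE.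
- exact: measurable_funeneg.
- exact: measurable_funeneg.
- by move=> x _; apply: (@funeneg_le _ _ setT) => //; rewrite inE.
Qed.

Section Radon_Nikodym_facts.
Variables (P Q : probability U R).
Hypothesis PQ : P `<< Q.
Let h := Radon_Nikodym (charge_of_finite_measure P) Q.

Lemma RN_fin_num x : h x \is a fin_num.
Proof. exact: Radon_Nikodym_fin_num. Qed.

Lemma measurable_RN : measurable_fun setT h.
Proof. by apply: measurable_int; exact: Radon_Nikodym_integrable. Qed.

Lemma RN_integral B : measurable B -> P B = \int[Q]_(x in B) h x.
Proof. by move=> mB; rewrite -Radon_Nikodym_integral. Qed.

Lemma measurable_RN_gt0 : measurable [set x | (0 < fine (h x))%R].
Proof.
rewrite [X in measurable X](_ : _ = (fine \o h) @^-1` `]0%R, +oo[); last first.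
  by apply/seteqP; split => x /=; rewrite in_itv/= andbT.
rewrite -[X in measurable X]setTI.
have : measurable_fun setT (fine \o h) by apply: measurableT_comp => //; exact: measurable_RN.
by apply => //; exact: measurable_itv.
Qed.

(** P charges a set where its density is at most 0 with a mass at most 0. *)
Lemma RN_le0_null : P (~` [set x | (0 < fine (h x))%R]) = 0.
Proof.
set D := ~` _; have mD : measurable D by apply: measurableC; exact: measurable_RN_gt0.
apply/eqP; rewrite eq_le measure_ge0 andbT RN_integral// integral_mkcond.
rewrite -[leRHS](integral0 Q setT); apply: le_integral_lower => //.
  by apply/(measurable_restrictT _ mD).1; apply: measurable_funTS; exact: measurable_RN.
move=> x; rewrite patchE; case: ifPn => // /set_mem /negP.
by rewrite -leNgt -(fineK (RN_fin_num x)) lee_fin.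
Qed.

(** The Radon-Nikodym derivative is only almost everywhere nonnegative; its positive part
    is a density of P that can be evaluated and compared at every point. *)
Definition RN_pos x := Num.max (fine (h x)) 0%R.

Lemma measurable_RN_pos : measurable_fun setT RN_pos.
Proof.
apply: measurable_maxr => //; apply: measurableT_comp => //; exact: measurable_RN.
Qed.

Lemma RN_pos_ge0 x : (0 <= RN_pos x)%R.
Proof. by rewrite /RN_pos le_max lexx orbT. Qed.

Lemma RN_posE x : (0 < fine (h x))%R -> (RN_pos x)%:E = h x.
Proof. by move=> hx; rewrite /RN_pos max_l ?fineK ?RN_fin_num// ltW. Qed.

Lemma RN_pos_density B : measurable B -> P B = \int[Q]_(x in B) (RN_pos x)%:E.
Proof.
move=> mB; set D := [set x | (0 < fine (h x))%R].
have mD : measurable D := measurable_RN_gt0.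
have PBD : P B = P (B `&` D).
  rewrite (measureDI P mB mD) (subset_measure0 _ _ _ RN_le0_null) ?add0e//.
  - exact: measurableD.
  - exact: measurableC.
rewrite PBD RN_integral; last exact: measurableI.
rewrite integral_mkcondr; apply: eq_integral => x _.
rewrite patchE; case: ifPn => [/set_mem /RN_posE ->//|].
move=> /negP; rewrite inE /D/= => /negP; rewrite -leNgt => hx.
by rewrite /RN_pos max_r.
Qed.

End Radon_Nikodym_facts.

(** Pointwise, ln h >= g + 1 - exp g / h by ln x <= x - 1; then integrate against P,
    whose density is h. *)
Lemma KL_ge P Q (g : U -> R) : bmeas g ->
  (\int[P]_x g x + 1 - \int[Q]_x expR (g x))%:E <= KL P Q.
Proof.
move=> bg; rewrite /KL; case: asboolP => PQ; last by rewrite leey.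
set h := Radon_Nikodym _ _.
pose r x := (if 0 < fine (h x) then expR (g x - ln (fine (h x))) else 0)%R.
have mh : measurable_fun setT h := measurable_RN PQ.
have mfh : measurable_fun setT (fine \o h) by exact: measurableT_comp.
have mr : measurable_fun setT r.
  apply: measurable_fun_ifT => //; first exact: measurable_fun_ltr.
  apply: measurableT_comp => //; apply: measurable_funB; first exact: bmeas_meas.
  exact: measurableT_comp.
have r0 x : (0 <= r x)%R.
  by rewrite /r; case: ifP => // _; exact: expR_ge0.
have be := bmeas_expR bg.
have rint : \int[P]_x (r x)%:E <= (\int[Q]_x expR (g x))%:E.
  rewrite Rintegral_EFin//.
  rewrite (ge0_integral_density (measurable_RN_pos PQ) (RN_pos_density PQ)).
  - apply: ge0_le_integral => //.
    + by move=> x _; rewrite -EFinM lee_fin mulr_ge0// RN_pos_ge0.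
    + apply: emeasurable_funM; apply/measurable_EFinP => //.
      exact: measurable_RN_pos.
    + by apply/measurable_EFinP; exact: (bmeas_meas be).
    + move=> x _; rewrite -EFinM lee_fin /r; case: ifPn => hx.
        by rewrite /RN_pos max_l ?(ltW hx)// expRD expRN lnK ?posrE// divfK// gt_eqF.
      by rewrite mul0r expR_ge0.
  - exact/measurable_EFinP.
  - by move=> x; rewrite lee_fin.
have ir : P.-integrable setT (EFin \o r).
  apply/integrableP; split; first exact/measurable_EFinP.
  rewrite (eq_integral (fun x => (r x)%:E)); last first.
    by move=> x _ /=; rewrite ger0_norm.
  exact: le_lt_trans rint (ltry _).
have bg1 : bmeas (fun x => g x + 1)%R by apply: bmeasD => //; exact: bmeas_cst.
pose L x := (g x + 1 - r x)%R.
have mL : measurable_fun setT L by apply: measurable_funB => //; exact: bmeas_meas.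
(* P does not see where h is not positive; f is chosen there to satisfy the inequality. *)
pose f x := if (0 < fine (h x))%R then lne (h x) else (L x)%:E.
have mlne : measurable_fun setT (fun x => lne (h x)).
  by apply: measurable_lne => //; exact: RN_fin_num.
have mf : measurable_fun setT f.
  apply: measurable_fun_ifT => //; first exact: measurable_fun_ltr.
  exact/measurable_EFinP.
have -> : \int[P]_x lne (h x) = \int[P]_x f x.
  apply: ae_eq_integral => //.
  exists (~` [set x | (0 < fine (h x))%R]); split.
  - by apply: measurableC; exact: measurable_RN_gt0.
  - exact: RN_le0_null.
  - by move=> x /= + hx; apply => _; rewrite /f hx.
apply: (@le_trans _ _ (\int[P]_x (L x)%:E)); last first.
  apply: le_integral_lower => //; first exact/measurable_EFinP.
  move=> x; rewrite /f; case: ifPn => // hx.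
  rewrite -[h x]fineK ?(RN_fin_num PQ)// lne_EFin// lee_fin /L /r hx.
  by have := expR_ge1Dx (g x - ln (fine (h x)))%R => ?; lra.
rewrite integralB_EFin//; last exact: bmeas_integrable.
rewrite -Rintegral_EFin// expectD ?expect_cst//; last exact: bmeas_cst.
by rewrite EFinB leeB.
Qed.

Lemma KL_density P Q (g : U -> R) : bmeas g ->
  (forall B, measurable B -> P B = \int[Q]_(x in B) (expR (g x))%:E) ->
  KL P Q = (\int[P]_x g x)%:E.
Proof.
move=> bg Pg; have mg := bmeas_meas bg.
have me : measurable_fun setT (fun x => expR (g x)) := bmeas_meas (bmeas_expR bg).
have PQ : P `<< Q := density_dominates me Pg.
rewrite /KL; case: asboolP => // _; rewrite Rintegral_EFin//.
apply: ae_eq_integral => //.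
- by apply: measurable_lne; [exact: measurable_RN|exact: RN_fin_num].
- exact/measurable_EFinP.
have [N [mN QN0 Nsub]] := density_Radon_Nikodym me Pg.
exists N; split => //; first by move/null_content_dominatesP : PQ => /(_ N mN QN0).
apply: subset_trans Nsub => x /= H G; apply: H => _.
have {}G : Radon_Nikodym (charge_of_finite_measure P) Q x = (expR (g x))%:E := G I.
by rewrite G lne_EFin ?expR_gt0// expRK.
Qed.

End kullback_leibler.

(** * Duality and the Gibbs coupling *)

Section essentially_bounded.
Context d (T : measurableType d) (R : realType) (mu : probability T R).

Lemma bmeas_Lfun (f : T -> R) : bmeas f -> f \in Lfun mu +oo%E.
Proof.
move=> [mf [K hK]]; rewrite inE; apply/andP; split; first by rewrite inE.
rewrite inE /finite_norm/= unlock /Lnorm; case: ifP => _; last exact: ltry.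
apply: (@le_lt_trans _ _ K%:E); last exact: ltry.
by apply/ess_supP; apply: aeW => x /=; rewrite lee_fin.
Qed.

(** Essentially bounded potentials have bounded representatives, for which the Gibbs
    density is bounded above and away from 0 at every point. *)
Lemma Lfun_truncation (f : T -> R) : f \in Lfun mu +oo%E ->
  exists2 u, bmeas u & {ae mu, forall x, f x = u x}.
Proof.
rewrite inE => /andP[]; rewrite inE => /= mf.
rewrite inE /finite_norm/= unlock /Lnorm.
have mu1 : mu [set: T] = 1%E by exact: probability_setT.
case: ifPn => [_|]; last by move=> /negP[]; rewrite [X in (_ < X)%E]mu1 lte01.
move=> fin.
pose K := fine (ess_sup mu (abse \o (EFin \o f))) : R.
have fK : {ae mu, forall x, `|f x| <= K}.
  have := ess_sup_ge mu (abse \o (EFin \o f)).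
  apply: filterS => x /= fx; rewrite -lee_fin /K fineK// fin_numElt fin andbT.
  exact: lt_le_trans (ltNyr _) fx.
exists (fun x => Num.max (- `|K|) (Num.min `|K| (f x))).
  split; last first.
    exists `|K| => x; rewrite ler_norml le_max lexx/= ge_max ge_min lexx/= andbT.
    by rewrite ge0_cp.
  apply: measurable_maxr => //; exact: measurable_minr.
apply: filterS fK => x fx; have := le_trans fx (ler_norm K).
by rewrite ler_norml => /andP[h1 h2]; rewrite min_r// max_r.
Qed.

End essentially_bounded.

Lemma bmeas_patch d (T : measurableType d) (R : realType) (D : set T) (c : T -> R) :
  measurable D -> measurable_fun D c -> [bounded c x | x in D] -> bmeas (c \_ D).
Proof.
move=> mD mc [M0 [_ hM]]; split; first exact/(measurable_restrictT _ mD).1.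
exists (Num.max 0 (M0 + 1)) => x; rewrite patchE; case: ifPn => [/set_mem Dx|_].
  by rewrite le_max; apply/orP; right; apply: hM => //; rewrite ltrDl.
by rewrite normr0 le_max lexx.
Qed.

Section transport.
Context d (T : measurableType d) (R : realType) (m : nat).
Variables (A : 'I_m -> set T) (c : m.-tuple T -> R) (eps : R).
Hypotheses (mA : forall j, measurable (A j)) (eps0 : 0 < eps).
Implicit Types (mu : 'I_m -> probability T R) (u : 'I_m -> T -> R).

Let mbox : measurable (box A) := measurable_box mA.
Let cA := c \_ (box A).
Hypothesis bcA : bmeas cA.

(** The exponent of the Gibbs density of the potentials u; the cost is extended by 0
    outside of the box, where it may be arbitrary. *)
Definition gibbs u (x : m.-tuple T) : R := (\sum_(j < m) u j (tnth x j) - cA x) / eps.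

Lemma bmeas_gibbs u : (forall j, bmeas (u j)) -> bmeas (gibbs u).
Proof.
move=> bu; apply: bmeasM; last exact: bmeas_cst.
by apply: bmeasB => //; apply: bmeas_sum => j _; exact: bmeas_tnth.
Qed.

Lemma expect_coupling mu (pi : probability (m.-tuple T) R) j g :
  coupling A mu pi -> bmeas g -> \int[pi]_x g (tnth x j) = \int[mu j]_y g y.
Proof.
move=> [_ piE] bg; apply/esym/expect_law => //; first exact: measurable_tnth.
by move=> B mB; rewrite piE.
Qed.

Lemma integral_cost (pi : probability (m.-tuple T) R) :
  (\int[pi]_(x in box A) (c x)%:E = (\int[pi]_x cA x)%:E)%E.
Proof.
rewrite integral_mkcond Rintegral_EFin//; apply: eq_integral => x _.
by rewrite /cA !patchE; case: ifP.
Qed.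

(** The potentials integrate to constants on couplings, so that minus the cost is the
    Gibbs exponent up to a constant. *)
Lemma expect_gibbs mu (pi : probability (m.-tuple T) R) u :
  coupling A mu pi -> (forall j, bmeas (u j)) ->
  \int[pi]_x cA x + eps * \int[pi]_x gibbs u x = \sum_j \int[mu j]_y u j y.
Proof.
move=> cpi bu; have bg := bmeas_gibbs bu.
rewrite -expectZ// -expectD//; last exact: bmeasZ.
transitivity (\int[pi]_x (\sum_(j < m) u j (tnth x j))).
  apply: eq_Rintegral => x _; rewrite /gibbs mulrC divfK ?gt_eqF//.
  by rewrite subrKC.
rewrite expect_sum; last by move=> j _; exact: bmeas_tnth.
by apply: eq_bigr => j _; exact: (expect_coupling j cpi).
Qed.

(** The entropy is bounded below by its Legendre transform at the Gibbs exponent, and the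
    cost then cancels. *)
Lemma eot_ge mu u : (forall j, bmeas (u j)) ->
  ((\sum_j \int[mu j]_y u j y +
    eps * (1 - \int[prod_prob mu]_x expR (gibbs u x)))%:E <= eot A c eps mu)%E.
Proof.
move=> bu; apply: le_ereal_inf_tmp => _ [pi cpi <-].
rewrite integral_cost.
apply: (@le_trans _ _ ((\int[pi]_x cA x)%:E + eps%:E *
    (\int[pi]_x gibbs u x + 1 - \int[prod_prob mu]_x expR (gibbs u x))%:E)%E).
  rewrite -EFinM -EFinD lee_fin -(expect_gibbs cpi bu).
  by rewrite le_eqVlt; apply/orP; left; apply/eqP; ring.
rewrite leeD2l// lee_wpmul2l//; first by rewrite lee_fin ltW.
exact: (KL_ge pi (prod_prob mu) (bmeas_gibbs bu)).
Qed.

(** The complement of the box is the union of m null sets. *)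
Lemma box_full (pi : probability (m.-tuple T) R) :
  (forall j, pi ((fun x => tnth x j) @^-1` A j) = 1%E) -> pi (box A) = 1%E.
Proof.
move=> piA.
have mj j : measurable ((fun x : m.-tuple T => tnth x j) @^-1` A j).
  rewrite -[X in measurable X]setTI; exact: measurable_tnth.
have null : pi (~` box A) = 0%E.
  have aj j : {ae pi, forall x, A j (tnth x j)}.
    exists (~` ((fun x : m.-tuple T => tnth x j) @^-1` A j)); split => //.
      exact: measurableC.
    rewrite probability_setC//.
    by rewrite (_ : pi _ = 1%E) ?subee//; exact: piA.
  have : {ae pi, forall x, box A x} by exact: filter_forall.
  by move/negligibleP; apply; exact: measurableC.
have := probability_setC pi mbox; rewrite [LHS]null.
by have := fin_num_measure pi _ mbox; case: (pi (box A)) => // r _ [] /eqP;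
  rewrite eq_sym subr_eq0 => /eqP ->.
Qed.

Section optimal.
Variables (mu : 'I_m -> probability T R) (u : 'I_m -> T -> R).
Hypotheses (muA : forall j, mu j (A j) = 1%E) (bu : forall j, bmeas (u j)).
Hypothesis m0 : (0 < m)%N.
Hypothesis marginals : forall j B, measurable B ->
  \int[prod_prob mu]_x (\1_B (tnth x j) * expR (gibbs u x)) = fine (mu j B).

Lemma gibbs_mass1 : \int[prod_prob mu]_x expR (gibbs u x) = 1.
Proof.
have := marginals (Ordinal m0) measurableT.
rewrite probability_setT/= => <-; apply: eq_Rintegral => x _.
by rewrite indicT mul1r.
Qed.

Let pstar : probability (m.-tuple T) R :=
  with_density (bmeas_expR (bmeas_gibbs bu)) (fun x => expR_ge0 (gibbs u x)) gibbs_mass1.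

Lemma coupling_gibbs : coupling A mu pstar.
Proof.
have law j (B : set T) : measurable B -> pstar ((fun x => tnth x j) @^-1` B) = mu j B.
  move=> mB; rewrite -[RHS]fineK ?fin_num_measure// -marginals//.
  have bp := bmeas_expR (bmeas_gibbs bu).
  have bi : bmeas (fun x : m.-tuple T => \1_B (tnth x j) : R).
    by apply: (@bmeas_tnth _ _ _ _ (\1_B)); exact: bmeas_indic.
  rewrite Rintegral_EFin; last exact: bmeasM.
  rewrite [LHS]integral_mkcond; apply: eq_integral => x _.
  rewrite patchE indicE; case: ifPn => [/set_mem h|/negP h].
    by rewrite mem_set ?mul1r.
  by rewrite memNset ?mul0r// => Bx; apply: h; exact/mem_set.
split=> //; apply: box_full => j; rewrite -(muA j); exact: law.
Qed.

(** Strong duality: once the Gibbs density has the right marginals, the coupling that it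
    defines attains the lower bound of weak duality. *)
Lemma eot_optimal : eot A c eps mu = (\sum_j \int[mu j]_y u j y)%:E.
Proof.
apply/eqP; rewrite eq_le; apply/andP; split; last first.
  by have := eot_ge mu bu; rewrite gibbs_mass1 subrr mulr0 addr0.
have cp := coupling_gibbs.
apply: (@le_trans _ _ (\int[pstar]_(x in box A) (c x)%:E +
    eps%:E * KL pstar (prod_prob mu))%E).
  by apply: ereal_inf_lbound; exists pstar.
rewrite integral_cost (@KL_density _ _ _ pstar (prod_prob mu) (gibbs u))//.
  by rewrite -EFinM -EFinD (expect_gibbs cp bu).
exact: bmeas_gibbs.
Qed.

End optimal.

End transport.

(** * The first-order condition for optimal potentials *)

Section first_order_condition.
Context d (T : measurableType d) (R : realType) (m : nat).
Variables (A : 'I_m -> set T) (c : m.-tuple T -> R) (eps : R).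
Hypotheses (mA : forall j, measurable (A j)) (eps0 : 0 < eps).
Let cA := c \_ (box A).
Hypothesis bcA : bmeas cA.
Variable (nu : 'I_m -> probability T R).
Hypothesis nuA : forall j, nu j (A j) = 1%E.

Let Q := prod_prob nu.
Let mbox : measurable (box A) := measurable_box mA.
Let gib (u : 'I_m -> T -> R) := gibbs A c eps u.

Lemma ae_tnth (S : set T) j : {ae nu j, forall x, S x} ->
  {ae Q, forall x, S (tnth x j)}.
Proof.
move=> [N [mN N0 sub]]; exists ((fun x : m.-tuple T => tnth x j) @^-1` N); split.
- by rewrite -[X in measurable X]setTI; exact: measurable_tnth.
- by rewrite /Q prod_prob_tnth.
- by move=> x /= Sx; apply: sub.
Qed.

Lemma ae_box : {ae Q, forall x, box A x}.
Proof.
apply: filter_forall => j; apply: (@ae_tnth (A j)).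
exists (~` A j); split => //; first exact: measurableC.
by rewrite probability_setC// nuA subee.
Qed.

Lemma dual_objectiveE (f u : 'I_m -> T -> R) : (forall j, measurable_fun setT (f j)) ->
  (forall j, bmeas (u j)) -> (forall j, {ae nu j, forall x, f j x = u j x}) ->
  dual_objective A c eps nu f =
  (\sum_j \int[nu j]_x u j x - eps * \int[Q]_x expR (gib u x))%:E.
Proof.
move=> mf bu fu; rewrite /dual_objective EFinB EFinM; congr (_ - _ * _)%E.
  rewrite -sumEFin; apply: eq_bigr => j _; rewrite Rintegral_EFin//.
  apply: ae_eq_integral => //; try by apply/measurable_EFinP => //; exact: bmeas_meas.
  by apply: filterS (fu j) => x -> _.
have bg : bmeas (fun x => expR (gib u x)).
  exact: bmeas_expR (bmeas_gibbs eps bcA bu).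
rewrite Rintegral_EFin// integral_mkcond.
have mF : measurable_fun setT (fun x : m.-tuple T =>
    expR ((\sum_(j < m) f j (tnth x j) - cA x) / eps)).
  apply: measurableT_comp => //; apply: measurable_funM => //.
  apply: measurable_funB; last exact: bmeas_meas.
  apply: measurable_sum => j.
  exact: measurableT_comp (mf j) (measurable_tnth j).
rewrite (eq_integral ((fun x => (expR ((\sum_(j < m) f j (tnth x j) - cA x) / eps))%:E)
    \_ (box A))); last first.
  by move=> x _; rewrite !patchE; case: ifPn => // xA; rewrite /cA patchE xA.
apply: ae_eq_integral => //.
- have /measurable_EFinP mEF := mF.
  exact: ((measurable_restrictT _ mbox).1 (measurable_funTS mEF)).
- by apply/measurable_EFinP; exact: bmeas_meas.
- have aeu : {ae Q, forall x, forall j, f j (tnth x j) = u j (tnth x j)}.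
    apply: filter_forall => j; exact: (@ae_tnth [set y | f j y = u j y]).
  apply: filterS2 ae_box aeu => x xA fux _.
  rewrite patchE ifT; last exact: mem_set.
  have -> : \sum_(j < m) f j (tnth x j) = \sum_(j < m) u j (tnth x j).
    by apply: eq_bigr => j _; exact: fux.
  by [].
Qed.

(** The two sides agree at s = 0, so that their derivatives there agree too. *)
Lemma bernoulli_squeeze (e W : R) : 0 <= e -> 0 <= W ->
  (forall s : R, s * e <= (expR s - 1) * W) -> e = W.
Proof.
move=> e0 W0 H.
have key (s : R) : s < 1 -> (1 - s) * (s * e) <= s * W.
  move=> s1; have s1' : 0 <= 1 - s by rewrite subr_ge0 ltW.
  apply: (@le_trans _ _ ((1 - s) * ((expR s - 1) * W))); first by rewrite ler_wpM2l.
  rewrite mulrA ler_wpM2r//.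
  have h : (1 - s) * expR s <= 1.
    have := expR_ge1Dx (- s); rewrite expRN => h.
    by rewrite -ler_pdivlMr ?expR_gt0// mul1r.
  by move: h; rewrite mulrBr mulr1 => ?; lra.
apply/eqP; rewrite eq_le; apply/andP; split; apply/ler_addgt0Pl => z z0.
- have [->|en0] := eqVneq e 0; first by rewrite addr_ge0// ltW.
  have ep : 0 < e by rewrite lt_neqAle eq_sym en0.
  pose s := Num.min (1 / 2) (z / e).
  have s0 : 0 < s by rewrite lt_min divr_gt0// divr_gt0.
  have s1 : s <= 1 / 2 by rewrite ge_min lexx.
  have sz : s * e <= z by rewrite -ler_pdivlMr// ge_min lexx orbT.
  have := key s; rewrite mulrCA ler_pM2l// => /(_ _); rewrite mulrBl mul1r => k.
  by have := k (ltac:(lra)) => ?; lra.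
- have [ee|en0] := eqVneq e 0.
    by have := key (-1) (ltac:(lra)) => ?; lra.
  have ep : 0 < e by rewrite lt_neqAle eq_sym en0.
  pose s := z / e.
  have s0 : 0 < s by rewrite divr_gt0.
  have sz : s * e = z by rewrite /s divfK// gt_eqF.
  have := key (- s) (ltac:(lra)); rewrite mulrCA !mulNr lerN2 ler_pM2l//.
  by rewrite opprK mulrDl mul1r => ?; lra.
Qed.

Lemma sum_indicator (k0 : 'I_m) (z : 'I_m -> R) :
  \sum_(k < m) (k == k0)%:R * z k = z k0.
Proof.
rewrite (bigD1 k0)//= eqxx mul1r big1 ?addr0// => k /negbTE ->.
by rewrite mul0r.
Qed.

Section optimal.
Variables (f u : 'I_m -> T -> R).
Hypothesis m0 : (0 < m)%N.
Hypothesis fopt : optimal_potentials A c eps nu f.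
Hypotheses (bu : forall j, bmeas (u j)).
Hypothesis fu : forall j, {ae nu j, forall x, f j x = u j x}.

Let last_lt : (m.-1 < m)%N. Proof. by rewrite ltn_predL. Qed.
Let last_ord : 'I_m := Ordinal last_lt.

(** The perturbation of the j-th potential by an indicator is renormalized by
    moving its mean to the last potential; it leads to a one-parameter
    inequality that is an equality at 0. *)
Lemma optimal_marginals j B : measurable B ->
  \int[Q]_x (\1_B (tnth x j) * expR (gib u x)) = fine (nu j B).
Proof.
move=> mB; pose phi : T -> R := \1_B.
have bphi : bmeas phi by exact: bmeas_indic.
pose e := \int[nu j]_x phi x.
have eE : e = fine (nu j B) by exact: expect_indic.
have bp : bmeas (fun x => expR (gib u x)) by exact: bmeas_expR (bmeas_gibbs eps bcA bu).
have bphi' : bmeas (fun x : m.-tuple T => phi (tnth x j)) by exact: bmeas_tnth.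
pose W := \int[Q]_x (phi (tnth x j) * expR (gib u x)).
rewrite -[LHS]/W -eE; apply/esym/bernoulli_squeeze.
- by apply: Rintegral_ge0 => x _; rewrite /phi indicE.
- by apply: Rintegral_ge0 => x _; rewrite mulr_ge0 ?expR_ge0// /phi indicE.
move=> s; pose t := eps * s.
(* The mean e of phi is taken from the j-th potential and given to the last one. *)
pose g k x := u k x + t * ((k == j)%:R * (phi x - e) + (k == last_ord)%:R * e).
have bg k : bmeas (g k).
  apply: bmeasD => //; apply: bmeasZ; apply: bmeasD; last exact: bmeas_cst.
  by apply: bmeasZ; apply: bmeasB => //; exact: bmeas_cst.
have [[fL fnorm] fmax] := fopt.
have mf k : measurable_fun setT (f k).
  by have := fL k; rewrite inE => /andP[]; rewrite inE.
have intg k : \int[nu k]_x g k x = \int[nu k]_x u k x + t * ((k == last_ord)%:R * e).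
  rewrite /g expectD//; last first.
    apply: bmeasZ; apply: bmeasD; last exact: bmeas_cst.
    by apply: bmeasZ; apply: bmeasB => //; exact: bmeas_cst.
  congr (_ + _); rewrite expectZ; last first.
    apply: bmeasD; last exact: bmeas_cst.
    by apply: bmeasZ; apply: bmeasB => //; exact: bmeas_cst.
  congr (_ * _); rewrite expectD ?expect_cst; [|by apply: bmeasZ; apply: bmeasB => //;
    exact: bmeas_cst|exact: bmeas_cst].
  rewrite expectZ; last by apply: bmeasB => //; exact: bmeas_cst.
  rewrite expectB ?expect_cst//; last exact: bmeas_cst.
  by case: eqP => [->|_]; rewrite ?mul0r ?add0r// subrr mulr0 add0r.
have gnorm : normalized_potentials nu g.
  split=> [k|k km]; first exact: bmeas_Lfun.
  rewrite -Rintegral_EFin// intg (_ : (k == last_ord) = false); last first.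
    by apply/negbTE/eqP => kl; move: km; rewrite kl /= prednK// ltnn.
  rewrite mul0r mulr0 addr0 Rintegral_EFin// -(fnorm k km).
  apply: ae_eq_integral => //; try by apply/measurable_EFinP => //; exact: bmeas_meas.
  by apply: filterS (fu k) => x -> _.
have := fmax g gnorm.
rewrite (@dual_objectiveE f u)// (@dual_objectiveE g g)//; last 2 first.
- by move=> k; exact: bmeas_meas.
- by move=> k; exact: aeW.
rewrite lee_fin (eq_bigr _ (fun k _ => intg k)) big_split/= -mulr_sumr.
rewrite (sum_indicator last_ord (fun=> e)).
have gibg x : gib g x = gib u x + s * phi (tnth x j).
  rewrite /gib /gibbs /g big_split/= -mulr_sumr big_split/=.
  rewrite (sum_indicator j (fun k => phi (tnth x k) - e)).
  rewrite (sum_indicator last_ord (fun=> e)).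
  by rewrite /t; field; rewrite gt_eqF.
have pg : \int[Q]_x expR (gib g x) = \int[Q]_x expR (gib u x) + (expR s - 1) * W.
  rewrite /W -expectZ; last exact: bmeasM.
  rewrite -expectD//; last by apply: bmeasZ; exact: bmeasM.
  apply: eq_Rintegral => x _; rewrite gibg expRD /phi indicE.
  by case: (_ \in _); rewrite /= ?mulr1 ?mulr0 ?mul1r ?mul0r ?expR0; ring.
rewrite pg => H.
have : eps * (s * e) <= eps * ((expR s - 1) * W) by rewrite mulrA -/t; lra.
by rewrite ler_pM2l.
Qed.

End optimal.

End first_order_condition.

(** * Transport between empirical measures *)

Section atomic.
Context d (U : measurableType d) (R : realType) (I : finType).
Variables (y : I -> U) (w : I -> R).
Hypothesis w0 : forall i, 0 <= w i.

(** The points y i may coincide: empirical measures of arbitrary samples are of this form. *)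
Definition atomic (P : set U -> \bar R) :=
  forall B, measurable B -> P B = (\sum_i w i * \1_B (y i))%:E.

Section representation.
Variable i0 : I.
Let e k := nth i0 (enum I) k.
Let sum_e (V : nmodType) (F : I -> V) : \sum_(k < #|I|) F (e k) = \sum_i F i.
Proof. by rewrite -[RHS]big_enum/= (big_nth i0) big_mkord cardE. Qed.

Let M := msum (fun k => mscale (NngNum (w0 (e k))) (dirac (y (e k)) : {measure set U -> \bar R})) #|I|.

Let ME B : M B = (\sum_i w i * \1_B (y i))%:E.
Proof.
rewrite /M /msum -sumEFin -sum_e; apply: eq_bigr => k _.
by rewrite /mscale EFinM.
Qed.

Let M_integral (f : U -> \bar R) : measurable_fun setT f -> (forall x, (0 <= f x)%E) ->
  (\int[M]_x f x = \sum_i (w i)%:E * f (y i))%E.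
Proof.
move=> mf f0; rewrite ge0_integral_measure_sum// -sum_e; apply: eq_bigr => k _.
by rewrite ge0_integral_mscale//= integral_dirac// diracT mul1e.
Qed.

Lemma atomic_measure_exists : \sum_i w i = 1 -> exists P : probability U R, atomic P.
Proof.
move=> w1; have M1 : M setT = 1%E.
  by rewrite ME -w1; congr EFin; apply: eq_bigr => i _; rewrite indicT mulr1.
exists (mnormalize M (dirac (y i0))) => B mB.
rewrite -ME; change (mnormalize M (dirac (y i0)) B = M B); rewrite /mnormalize.
have E (b : \bar R) : b = 1%E -> (if (b == 0%E) || (b == +oo%E)
    then fun V => dirac (y i0) V else fun V => (M V * ((fine b)^-1)%:E)%E) B = M B.
  by move=> ->; rewrite onee_eq0 /= invr1 mule1.
exact: (E _ M1).
Qed.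

Lemma ge0_integral_atomic (P : probability U R) (f : U -> \bar R) : atomic P ->
  measurable_fun setT f -> (forall x, (0 <= f x)%E) ->
  (\int[P]_x f x = \sum_i (w i)%:E * f (y i))%E.
Proof.
move=> aP mf f0; rewrite -M_integral//; apply: eq_measure_integral => B mB _.
exact: etrans (aP _ mB) (esym (ME B)).
Qed.

End representation.

Variable (P : probability U R).
Hypothesis aP : atomic P.

Lemma atomic_mass : \sum_i w i = 1.
Proof.
have := aP measurableT; rewrite probability_setT => /esym[] <-.
by apply: eq_bigr => i _; rewrite indicT mulr1.
Qed.

Lemma atomic_inhabited : exists i0 : I, True.
Proof.
apply: contrapT => noI; have := atomic_mass.
rewrite big1 => [/eqP|i _]; first by rewrite eq_sym oner_eq0.
by exfalso; apply: noI; exists i.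
Qed.

Lemma expect_atomic (f : U -> R) : bmeas f -> \int[P]_x f x = \sum_i w i * f (y i).
Proof.
move=> bf; have [i0 _] := atomic_inhabited; have [mf [K hK]] := bf.
have bK : bmeas (fun x => f x + K) by apply: bmeasD => //; exact: bmeas_cst.
have : \int[P]_x (f x + K) = \sum_i w i * (f (y i) + K).
  apply: EFin_inj; rewrite Rintegral_EFin// (ge0_integral_atomic i0 aP).
  - by rewrite -sumEFin; apply: eq_bigr => i _; rewrite EFinM.
  - by apply/measurable_EFinP; exact: bmeas_meas.
  - move=> x; rewrite lee_fin; have := hK x; rewrite ler_norml => /andP[? _]; lra.
rewrite expectD ?expect_cst//; last exact: bmeas_cst.
under eq_bigr do rewrite mulrDr.
by rewrite big_split/= -mulr_suml atomic_mass mul1r => /addIr.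
Qed.

Lemma atomic_null i B : measurable B -> P B = 0%E -> 0 < w i -> ~ B (y i).
Proof.
move=> mB; rewrite (aP mB) => -[] s0 wi Bi.
have : w i <= \sum_k w k * \1_B (y k).
  rewrite (bigD1 i)//= indicE mem_set// mulr1 lerDl sumr_ge0// => k _.
  by rewrite mulr_ge0// indicE.
by rewrite s0 leNgt wi.
Qed.

Lemma atomic_null_sufficient B : measurable B ->
  (forall i, 0 < w i -> ~ B (y i)) -> P B = 0%E.
Proof.
move=> mB H; rewrite (aP mB) big1// => i _.
have [wi|wi] := ltP 0 (w i); first by rewrite indicE memNset ?mulr0//; exact: H.
by rewrite (_ : w i = 0) ?mul0r//; apply: le_anti; rewrite wi w0.
Qed.

(** The density of an atomic measure may be truncated at the largest value of its
    logarithm at the atoms, hence the formula. *)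
Lemma KL_atomic (Q : probability U R) : (P `<< Q)%E ->
  KL P Q = (\sum_i w i * ln (RN_pos P Q (y i)))%:E.
Proof.
move=> PQ; pose h := Radon_Nikodym (charge_of_finite_measure P) Q.
pose l x := ln (RN_pos P Q x).
pose K := \sum_i `|l (y i)|.
have ml : measurable_fun setT l.
  by apply: measurableT_comp => //; exact: measurable_RN_pos.
(* The bound K is that of the logarithm at the atoms. *)
pose G x := Num.max (- K) (Num.min K (l x)).
have K0 : 0 <= K by apply: sumr_ge0.
have lK i : `|l (y i)| <= K by rewrite /K (bigD1 i)//= lerDl sumr_ge0.
have GE x : `|l x| <= K -> G x = l x.
  by rewrite ler_norml => /andP[h1 h2]; rewrite /G min_r// max_r.
have bG : bmeas G.
  split; first by apply: measurable_maxr => //; exact: measurable_minr.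
  exists K => x; rewrite ler_norml le_max lexx/= ge_max ge_min lexx/= andbT.
  by rewrite ge0_cp.
rewrite /KL; case: asboolP => // _.
have mD := measurable_RN_gt0 PQ.
have mlne : measurable_fun setT (fun x => lne (h x)).
  by apply: measurable_lne; [exact: measurable_RN|exact: RN_fin_num].
transitivity (\int[P]_x (G x)%:E)%E.
  apply: ae_eq_integral => //.
    by apply/measurable_EFinP; exact: bmeas_meas.
  have mN : measurable [set x | `|l x| <= K].
    rewrite [X in measurable X](_ : _ = (fun x => `|l x|) @^-1` `]-oo, K]); last first.
      by apply/seteqP; split => x /=; rewrite in_itv.
    rewrite -[X in measurable X]setTI.
    have : measurable_fun setT (fun x => `|l x|) by exact: measurableT_comp.
    by apply => //; exact: measurable_itv.
  exists (~` ([set x | 0 < fine (h x)] `&` [set x | `|l x| <= K])); split.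
  - by apply: measurableC; exact: measurableI.
  - apply: atomic_null_sufficient; first by apply: measurableC; exact: measurableI.
    move=> i wi; apply; split => //=; apply: contrapT => /negP hi.
    apply: (atomic_null (measurableC mD) (RN_le0_null PQ) wi) => /=; exact/negP.
  - apply: subsetC => x [/= hx lx] _; rewrite GE// /l.
    by rewrite -(RN_posE PQ hx) lne_EFin// /RN_pos lt_max hx.
rewrite -Rintegral_EFin// expect_atomic//; congr EFin; apply: eq_bigr => i _.
by rewrite GE.
Qed.

End atomic.

Section marg_exchange.
Context (R : realFieldType) (m n : nat).
Notation J := {ffun 'I_m -> 'I_n.+1}.

(** Exchanging the values l and l' of the j-th coordinate is a bijection between the two
    families of multi-indices. *)
Lemma marg_exchange (F : J -> R) j l l' :
  (forall i i' : J, (forall k, k != j -> i k = i' k) ->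
    i j = l -> i' j = l' -> F i = F i') ->
  marg j l F = marg j l' F.
Proof.
move=> FE; rewrite /marg /avg; congr (_ * (_ * _)).
pose s (i : J) : J := [ffun k => if k == j then tperm l l' (i k) else i k].
have ss : involutive s.
  by move=> i; apply/ffunP => k; rewrite !ffunE; case: eqP => // _; rewrite tpermK.
rewrite [RHS](reindex_inj (inv_inj ss))/=; apply: eq_bigr => i _.
rewrite {1}/s ffunE eqxx.
have -> : (tperm l l' (i j) == l') = (i j == l).
  by rewrite -[X in _ == X = _](tpermL l l') (inj_eq perm_inj).
case: eqP => [il|_]; last by rewrite !mul0r.
congr (_ * _); apply: FE => //; last by rewrite ffunE eqxx il tpermL.
by move=> k /negbTE kj; rewrite ffunE kj.
Qed.

End marg_exchange.

Section empirical_transport.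
Context d (T : measurableType d) (R : realType) (m n : nat).
Variables (A : 'I_m -> set T) (c : m.-tuple T -> R) (eps : R).
Hypotheses (mA : forall j, measurable (A j)) (eps0 : 0 < eps) (m0 : (0 < m)%N).
Hypothesis mset1 : forall x : T, measurable [set x].
Let cA := c \_ (box A).
Hypothesis bcA : bmeas cA.
Variable x : 'I_m -> nat -> T.
Notation J := {ffun 'I_m -> 'I_n.+1}.
Implicit Types (q : J -> R).

Let hat j : probability T R := empirical R n (x j).

Definition grid_point (i : J) : m.-tuple T := [tuple x j (i j) | j < m].

Let N1 : R := n.+1%:R^-1.
Let N1_ge0 : 0 <= N1. Proof. by rewrite invr_ge0. Qed.
Let Nm_gt0 : 0 < N1 ^+ m. Proof. by rewrite exprn_gt0// invr_gt0. Qed.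

Lemma atomic_empirical j :
  atomic (fun l : 'I_n.+1 => x j l) (fun=> N1) (hat j).
Proof.
move=> B mB; rewrite /hat /= /empirical /mscale /msum /=.
by rewrite -mulr_sumr EFinM -sumEFin.
Qed.

(** On boxes, the average of a product of functions of the coordinates is the product of
    their averages. *)
Lemma atomic_prod : atomic grid_point (fun=> N1 ^+ m) (prod_prob hat).
Proof.
have [Q aQ] : exists Q : probability (m.-tuple T) R, atomic grid_point (fun=> N1 ^+ m) Q.
  apply: atomic_measure_exists => //; first by move=> ?; exact: ltW.
  - exact: [ffun=> ord0].
  - have := @avg_cst R m n 1; rewrite /avg mulr_sumr => <-.
    by apply: eq_bigr => i _; rewrite mulr1.
move=> B mB; rewrite -aQ//; apply: prod_prob_unique => // S mS.
rewrite (aQ _ (measurable_box mS)) -mulr_sumr.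
transitivity (avg (fun i : J => \prod_j \1_(S j) (x j (i j)) : R))%:E.
  congr (_ * _)%:E; apply: eq_bigr => i _; rewrite indicE.
  have [/set_mem iS|/negP iS] := boolP (_ \in _).
    rewrite big1// => j _; rewrite indicE mem_set//.
    by have := iS j; rewrite tnth_mktuple.
  have /existsNP[j jS] : ~ forall j, S j (tnth (grid_point i) j).
    by move=> iS'; apply: iS; exact/mem_set.
  rewrite (bigD1 j)//= indicE memNset ?mul0r//.
  by move: jS; rewrite tnth_mktuple.
rewrite (avg_prod (fun j l => \1_(S j) (x j l))).
rewrite -prodEFin; apply: eq_bigr => j _.
by rewrite atomic_empirical// -mulr_sumr.
Qed.

(** Densities are taken relative to the uniform weights on the multi-indices, so that
    the sample enters only through the costs C, even when sample points coincide. *)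
Definition index_cost (C q : J -> R) : R :=
  avg (fun i => q i * C i) + eps * avg (fun i => q i * ln (q i)).

Definition index_density q := (forall i, 0 <= q i) /\ forall j l, marg j l q = 1.

Lemma index_density_mass q : index_density q -> avg q = 1.
Proof.
move=> [_ mq]; rewrite -(avg1_marg (Ordinal m0)) (@eq_avg1 _ _ _ (fun=> 1))//.
exact: avg1_cst.
Qed.

Hypothesis xA : forall j (l : 'I_n.+1), A j (x j l).

Let w q i := N1 ^+ m * q i.

Let avg_w q (F : J -> R) : \sum_i w q i * F i = avg (fun i => q i * F i).
Proof. by rewrite /avg mulr_sumr; apply: eq_bigr => i _; rewrite /w mulrA. Qed.

Let prod_null B i : measurable B -> prod_prob hat B = 0%E -> ~ B (grid_point i).
Proof.
by move=> mB B0; apply: (atomic_null _ atomic_prod mB B0) => // ?; exact: ltW.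
Qed.

Lemma avg_RN_pos (P : probability (m.-tuple T) R) : (P `<< prod_prob hat)%E ->
  avg (fun i => RN_pos P (prod_prob hat) (grid_point i)) = 1.
Proof.
move=> PQ; apply: EFin_inj; rewrite /avg mulr_sumr -sumEFin.
rewrite -[RHS](probability_setT P) (RN_pos_density PQ measurableT).
rewrite (ge0_integral_atomic _ ([ffun=> ord0] : J) atomic_prod)//.
- by move=> ?; exact: ltW.
- by apply/measurable_EFinP; exact: measurable_RN_pos.
- by move=> y; rewrite lee_fin; exact: RN_pos_ge0.
Qed.

(** A density on the multi-indices is pushed to a coupling; sample points that
    coincide can only decrease its entropy. *)
Lemma eot_le_index q : index_density q ->
  (eot A c eps hat <= (index_cost (fun i => cA (grid_point i)) q)%:E)%E.
Proof.
move=> dq; have [q0 mq] := dq.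
have w0 i : 0 <= w q i by rewrite mulr_ge0// ltW.
have [P aP] : exists P : probability (m.-tuple T) R, atomic grid_point (w q) P.
  apply: atomic_measure_exists => //; first exact: [ffun=> ord0].
  by rewrite -[RHS](index_density_mass dq) /avg mulr_sumr.
have law j (B : set T) : measurable B -> P ((fun y => tnth y j) @^-1` B) = hat j B.
  move=> mB; rewrite aP; last first.
    by rewrite -[X in measurable X]setTI; exact: measurable_tnth.
  rewrite (avg_w q) atomic_empirical// -mulr_sumr; congr EFin.
  rewrite -[RHS]/(avg1 (fun l : 'I_n.+1 => \1_B (x j l))) -(avg1_marg j).
  apply: eq_avg1 => l.
  rewrite (@eq_marg _ _ _ _ _ _ (fun i => \1_B (x j l) * q i)).
    by rewrite margZ mq mulr1.
  move=> i il; rewrite mulrC; congr (_ * _); rewrite !indicE; congr (_%:R).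
  have -> : (grid_point i \in (fun y => tnth y j) @^-1` B) = (tnth (grid_point i) j \in B) by [].
  by rewrite tnth_mktuple il.
have cP : coupling A hat P.
  split=> //; apply: (box_full mA) => j; rewrite law//.
  rewrite atomic_empirical// -[1%E]/(1%:E) -(@avg1_cst R n 1) /avg1 mulr_sumr.
  congr EFin; apply: eq_bigr => l _; rewrite indicE mem_set//; exact: xA.
have PQ : (P `<< prod_prob hat)%E.
  apply/null_content_dominatesP => B mB B0; rewrite aP// big1// => i _.
  by rewrite indicE memNset ?mulr0//; exact: prod_null.
have le : (eot A c eps hat <= \int[P]_(x in box A) (c x)%:E +
    eps%:E * KL P (prod_prob hat))%E by apply: ereal_inf_lbound; exists P.
apply: le_trans le _; rewrite integral_cost// (expect_atomic w0 aP)//.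
rewrite (KL_atomic w0 aP PQ) -EFinM -EFinD lee_fin (avg_w q) lerD2l.
rewrite ler_pM2l// (avg_w q).
rewrite -subr_le0.
have -> : avg (fun i => q i * ln (RN_pos P (prod_prob hat) (grid_point i))) -
    avg (fun i => q i * ln (q i)) =
  avg (fun i => q i * (ln (RN_pos P (prod_prob hat) (grid_point i)) - ln (q i))).
  rewrite -mulN1r -avgZ -avgD; apply: eq_avg => i; ring.
apply: (@le_trans _ _ (avg (fun i => RN_pos P (prod_prob hat) (grid_point i) + -1 * q i))).
  apply: le_avg => i; have [qi|qi] := ltP 0 (q i); last first.
    have -> : q i = 0 by apply: le_anti; rewrite qi q0.
    by rewrite mul0r mulr0 addr0 RN_pos_ge0.
  have wi : 0 < w q i by rewrite mulr_gt0.
  have hi : 0 < RN_pos P (prod_prob hat) (grid_point i).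
    have := atomic_null w0 aP (measurableC (measurable_RN_gt0 PQ)) (RN_le0_null PQ) wi.
    by move=> /contrapT hi; rewrite /RN_pos lt_max hi.
  rewrite -ln_div ?posrE// mulN1r.
  set h := RN_pos _ _ _ in hi *.
  have := @le_ln1Dx R (h / q i - 1).
  rewrite subrKC ltrBrDl subrr divr_gt0// => /(_ isT) H.
  apply: (@le_trans _ _ (q i * (h / q i - 1))); first by rewrite ler_wpM2l// ltW.
  by rewrite mulrBr mulr1 mulrCA divff ?mulr1// gt_eqF.
by rewrite avgD avgZ (avg_RN_pos PQ) (index_density_mass dq) mulN1r subrr.
Qed.

Let one_density : index_density (fun=> 1).
Proof. by split=> // j l; exact: marg_cst. Qed.

(** Conversely the density of a coupling is read at the sample points. The law of the
    coupling only gives the total marginal mass of coinciding points, but these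
    have equal shares by symmetry. *)
Lemma index_le_coupling P : coupling A hat P -> exists2 q, index_density q &
  ((index_cost (fun i => cA (grid_point i)) q)%:E <=
   \int[P]_(x in box A) (c x)%:E + eps%:E * KL P (prod_prob hat))%E.
Proof.
move=> cP; rewrite integral_cost//.
have [PQ|nPQ] := pselect (P `<< prod_prob hat)%E; last first.
  (* The entropy is infinite. *)
  exists (fun=> 1) => //; rewrite /KL asboolF//.
  by rewrite gt0_muley ?lte_fin// addey// leey.
pose h := RN_pos P (prod_prob hat); pose q i := h (grid_point i).
have q0 i : 0 <= q i by exact: RN_pos_ge0.
have w0 i : 0 <= w q i by rewrite mulr_ge0// ltW.
have aP : atomic grid_point (w q) P.
  move=> B mB; rewrite (RN_pos_density PQ mB) integral_mkcond.
  have mh : measurable_fun setT (EFin \o h).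
    by apply/measurable_EFinP; exact: measurable_RN_pos.
  rewrite (ge0_integral_atomic _ ([ffun=> ord0] : J) atomic_prod).
  - rewrite -sumEFin; apply: eq_bigr => i _; rewrite patchE indicE.
    by case: (_ \in _); rewrite ?mulr1 ?mulr0 ?mule0// /w EFinM.
  - by move=> ?; exact: ltW.
  - exact: ((measurable_restrictT _ mB).1 (measurable_funTS mh)).
  - by move=> y; rewrite patchE; case: ifP => // _; rewrite lee_fin RN_pos_ge0.
exists q.
  split=> // j l.
  have mB := mset1 (x j l); set B := [set x j l] in mB.
  have mtB : measurable ((fun y : m.-tuple T => tnth y j) @^-1` B).
    by rewrite -[X in measurable X]setTI; exact: measurable_tnth.
  have E1 : hat j B = (avg1 (fun l' : 'I_n.+1 => \1_B (x j l')))%:E.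
    by rewrite atomic_empirical// -mulr_sumr.
  have E2 : P ((fun y => tnth y j) @^-1` B) =
      (avg1 (fun l' : 'I_n.+1 => \1_B (x j l') * marg j l q))%:E.
    rewrite aP// (avg_w q) -(avg1_marg j); congr EFin; apply: eq_avg1 => l'.
    rewrite (@eq_marg _ _ _ _ _ _ (fun i => \1_B (x j l') * q i)); last first.
      move=> i il; rewrite mulrC; congr (_ * _); rewrite !indicE; congr (_%:R).
      have -> : (grid_point i \in (fun y => tnth y j) @^-1` B) = (tnth (grid_point i) j \in B) by [].
      by rewrite tnth_mktuple il.
    rewrite margZ indicE; have [/set_mem/= xl|_] := boolP (_ \in B); last by rewrite !mul0r.
    (* The points of indices l and l' coincide, so that h does not distinguish them. *)
    congr (_ * _); apply: marg_exchange => i i' ii' il il'; congr h.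
    apply: eq_from_tnth => k; rewrite !tnth_mktuple.
    by have [->|kj] := eqVneq k j; [rewrite il il'|rewrite ii'].
  have := cP.2 j B mB; rewrite E1 E2 => -[].
  have -> : avg1 (fun l' : 'I_n.+1 => \1_B (x j l') * marg j l q) =
      marg j l q * avg1 (fun l' : 'I_n.+1 => \1_B (x j l')).
    by rewrite -avg1Z; apply: eq_avg1 => l'; rewrite mulrC.
  set s := avg1 _ => H.
  have s0 : s != 0.
    rewrite gt_eqF// /s /avg1 mulr_gt0 ?invr_gt0// (bigD1 l)//= ltr_pwDl//.
      by rewrite indicE mem_set.
    by apply: sumr_ge0 => k _; rewrite indicE.
  by apply: (mulIf s0); rewrite H mul1r.
rewrite (KL_atomic w0 aP PQ) (expect_atomic w0 aP)// -EFinM -EFinD lee_fin.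
by rewrite !avg_w.
Qed.

Definition index_value (C : J -> R) : R := inf [set index_cost C q | q in index_density].

(** The entropy of a density of mass 1 is nonnegative. *)
Lemma index_cost_lb (C : J -> R) K q : (forall i, `|C i| <= K) -> index_density q ->
  - K <= index_cost C q.
Proof.
move=> CK dq; have [q0 _] := dq; rewrite /index_cost -[leLHS]addr0; apply: lerD.
  apply: (@le_trans _ _ (avg (fun i => - K * q i))).
    by rewrite avgZ (index_density_mass dq) mulr1.
  apply: le_avg => i; rewrite mulrC ler_wpM2l//.
  by have := CK i; rewrite ler_norml => /andP[].
apply: mulr_ge0; first exact: ltW.
have -> : 0 = avg (fun i => q i + -1 * 1).
  by rewrite avgD avg_cst (index_density_mass dq) mulr1 subrr.
apply: le_avg => i; have [qi|qi] := ltP 0 (q i); last first.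
  have -> : q i = 0 by apply: le_anti; rewrite qi q0.
  by rewrite mul0r add0r mulr1 lerN10.
have := @le_ln1Dx R ((q i)^-1 - 1).
rewrite subrKC ltrBrDl subrr invr_gt0 => /(_ qi); rewrite lnV ?posrE// => H.
have : q i * (- ln (q i)) <= q i * ((q i)^-1 - 1) by rewrite ler_wpM2l// ltW.
by rewrite mulrBr mulfV ?gt_eqF// => ?; lra.
Qed.

Lemma index_has_inf (C : J -> R) : has_inf [set index_cost C q | q in index_density].
Proof.
split; first by exists (index_cost C (fun=> 1)); exists (fun=> 1).
exists (- \sum_i `|C i|) => _ [q dq <-].
apply: index_cost_lb => // i; rewrite (bigD1 i)//= lerDl sumr_ge0//.
Qed.

Theorem eot_empirical : eot A c eps hat = (index_value (fun i => cA (grid_point i)))%:E.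
Proof.
have [ne lb] := index_has_inf (fun i => cA (grid_point i)).
apply/eqP; rewrite eq_le; apply/andP; split.
  rewrite -ereal_inf_EFin//; apply: le_ereal_inf_tmp => _ [_ [q dq <-] <-].
  exact: eot_le_index.
apply: le_ereal_inf_tmp => _ [P cP <-].
have [q dq qle] := index_le_coupling cP; apply: le_trans qle.
by rewrite lee_fin; apply: inf_lbound => //; exists q.
Qed.

End empirical_transport.

(** * Linearization of the empirical value *)

Section index_value_regularity.
Context (R : realType) (m n : nat) (eps : R).
Hypotheses (eps0 : 0 < eps) (m0 : (0 < m)%N).
Notation J := {ffun 'I_m -> 'I_n.+1}.
Notation V := (@index_value R m n eps).
Notation cost := (@index_cost R m n eps).

Lemma index_value_le (C q : J -> R) : index_density q -> V C <= cost C q.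
Proof.
move=> dq; have [_ lb] := index_has_inf eps0 m0 C.
by apply: inf_lbound => //; exists q.
Qed.

Lemma index_value_ge (C : J -> R) b : (forall q, index_density q -> b <= cost C q) ->
  b <= V C.
Proof.
move=> H; have [ne _] := index_has_inf eps0 m0 C.
by apply: lb_le_inf => // _ [q dq <-]; exact: H.
Qed.

Lemma index_value_lipschitz (C C' : J -> R) : `|V C - V C'| <= \sum_i `|C i - C' i|.
Proof.
have one D D' : V D - \sum_i `|D i - D' i| <= V D'.
  apply: index_value_ge => q dq; have [q0 _] := dq.
  rewrite lerBlDr (le_trans (index_value_le D dq))// /index_cost.
  rewrite addrAC lerD2r -lerBlDl -mulN1r -avgZ -avgD.
  rewrite /avg mulr_sumr; apply: ler_sum => i _.
  rewrite (_ : q i * D i + -1 * (q i * D' i) = q i * (D i - D' i)); last by ring.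
  rewrite mulrA; apply: (@le_trans _ _ (n.+1%:R^-1 ^+ m * q i * `|D i - D' i|)).
    by rewrite ler_wpM2l ?ler_norm// mulr_ge0.
  apply: ler_piMl => //; rewrite -[leRHS](index_density_mass m0 dq) /avg mulr_sumr.
  by rewrite (bigD1 i)//= lerDl sumr_ge0// => k _; rewrite mulr_ge0.
rewrite ler_norml; apply/andP; split; last first.
  by rewrite lerBlDr addrC -lerBlDr one.
rewrite lerBrDr addrC (_ : \sum_i _ = \sum_i `|C' i - C i|) ?one//.
by apply: eq_bigr => i _; rewrite distrC.
Qed.

End index_value_regularity.

(** By density of the rationals, F is the supremum of the countably many functions that
    take the value of F at a rational point and decrease from there at unit speed. *)
Lemma measurable_lipschitz d (T : measurableType d) (R : realType) (I : finType)
    (F : (I -> R) -> R) (C : I -> T -> R) :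
  (forall x y, `|F x - F y| <= \sum_i `|x i - y i|) ->
  (forall i, measurable_fun setT (C i)) ->
  measurable_fun setT (fun w => F (fun i => C i w)).
Proof.
move=> FL mC mD; apply: (measurability _ (RGenOInfty.measurableE R)) => //.
move=> /= _ [_ [a ->] <-]; rewrite preimage_itvoy setTI.
pose G (v : {ffun I -> rat}) w := F (fun i => ratr (v i)) - \sum_i `|C i w - ratr (v i)|.
rewrite [X in measurable X](_ : _ = \bigcup_(v in setT) [set w | a < G v w]).
  apply: countable_bigcupT_measurable; first exact: countableP.
  move=> v; rewrite [X in measurable X](_ : _ = G v @^-1` `]a, +oo[); last first.
    by rewrite preimage_itvoy.
  rewrite -[X in measurable X]setTI.
  have : measurable_fun setT (G v).
    apply: measurable_funB => //; apply: measurable_sum => i.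
    by apply: measurableT_comp => //; exact: measurable_funB.
  by apply => //; exact: measurable_itv.
apply/seteqP; split => w /=.
  move=> aF; pose F1 := F (fun i => C i w).
  have aF1 : 0 < F1 - a by rewrite subr_gt0.
  pose k : R := (#|I|.+1)%:R.
  (* Half of the gap between F and a is left after an error r on each variable. *)
  pose r := (F1 - a) / (2 * k).
  have r0 : 0 < r by rewrite divr_gt0// mulr_gt0.
  have [v vP] : exists v : {ffun I -> rat}, forall i, `|C i w - ratr (v i)| <= r.
    have /choice[v vP] : forall i, exists q : rat, `|C i w - ratr q| <= r.
      move=> i; have [q] := @rat_in_itvoo R (C i w) (C i w + r) ltac:(by rewrite ltrDl).
      rewrite in_itv/= => /andP[q1 q2]; exists q.
      by rewrite distrC ger0_norm ?subr_ge0; lra.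
    by exists (finfun v) => i; rewrite ffunE.
  exists v => //=.
  have s : \sum_i `|C i w - ratr (v i)| <= #|I|%:R * r.
    rewrite (le_trans (ler_sum _ (fun i _ => vP i)))// sumr_const.
    by rewrite -(mulr_natl r).
  have kr : #|I|%:R * r + r = (F1 - a) / 2.
    rewrite -[X in _ + X]mul1r -mulrDl natr1 -/k /r; field.
    by rewrite gt_eqF.
  have := FL (fun i => C i w) (fun i => ratr (v i)).
  rewrite ler_norml => /andP[_]; rewrite /G -/F1.
  by move: s; set S := \sum_i _ => s h; lra.
move=> [v _ /= h]; apply: lt_le_trans h _; rewrite /G.
have := FL (fun i => C i w) (fun i => ratr (v i)).
by rewrite ler_norml => /andP[+ _]; set S := \sum_i _ => ?; lra.
Qed.

Section linearization.
Context (R : realType) (m : nat) (eps del K : R).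
Hypotheses (eps0 : 0 < eps) (m0 : (0 < m)%N).
Hypotheses (del0 : 0 < del) (del1 : del <= 1) (K1 : 1 <= K).

Section fixed_sample.
Variables (n : nat) (u : 'I_m -> 'I_n.+1 -> R) (p : {ffun 'I_m -> 'I_n.+1} -> R).
Notation J := {ffun 'I_m -> 'I_n.+1}.
Hypothesis pK : forall i, del <= p i <= K.
Let C (i : J) := \sum_j u j (i j) - eps * ln (p i).

Let p0 i : 0 < p i.
Proof. by have /andP[h _] := pK i; exact: lt_le_trans h. Qed.

(** The marginal constraints on q turn the potentials into constants. *)
Lemma index_cost_entropy q : index_density q ->
  index_cost eps C q =
  \sum_j avg1 (u j) + eps * avg (fun i => q i * (ln (q i) - ln (p i))).
Proof.
move=> [_ mq]; rewrite /index_cost -!avgZ -avgD.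
rewrite (@eq_avg _ _ _ _ (fun i : J => \sum_j u j (i j) * q i +
    eps * (q i * (ln (q i) - ln (p i))))); last first.
  by move=> i; rewrite /C -mulr_suml; ring.
rewrite avgD avg_sum avgZ; congr (_ + _); apply: eq_bigr => j _.
rewrite -(avg1_marg j); apply: eq_avg1 => l.
rewrite (@eq_marg _ _ _ _ _ _ (fun i => u j l * q i)) => [|i ->//].
by rewrite margZ mq mulr1.
Qed.

(** The inequality ln x <= x - 1 at x = p / q. *)
Lemma index_value_linear_lower :
  \sum_j avg1 (u j) + eps * (1 - avg p) <= index_value eps C.
Proof.
apply: index_value_ge => // q dq; have [q0 _] := dq.
rewrite index_cost_entropy// lerD2l ler_pM2l//.
have -> : 1 - avg p = avg (fun i => q i + -1 * p i).
  by rewrite avgD avgZ (index_density_mass m0 dq) mulN1r.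
apply: le_avg => i; rewrite mulN1r.
have [qi|qi] := ltP 0 (q i); last first.
  have -> : q i = 0 by apply: le_anti; rewrite qi q0.
  by rewrite mul0r sub0r oppr_le0 ltW.
have := @le_ln1Dx R (p i / q i - 1).
rewrite subrKC ltrBrDl subrr divr_gt0// => /(_ isT).
rewrite ln_div ?posrE// => H.
have : q i * (ln (p i) - ln (q i)) <= q i * (p i / q i - 1).
  by rewrite ler_wpM2l// ltW.
rewrite [leRHS]mulrBr mulr1 mulrCA divff ?gt_eqF// mulr1 => ?.
by rewrite -(opprB (ln (p i))) mulrN; lra.
Qed.

(** The inequality ln x <= x - 1 at x = q / p. *)
Lemma index_value_linear_upper q E : index_density q ->
  avg (fun i => (q i - p i) ^+ 2) <= E ->
  index_value eps C <=
  \sum_j avg1 (u j) + eps * (1 - avg p) + eps * (del^-1 * E).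
Proof.
move=> dq qE; have [q0 _] := dq.
apply: le_trans (index_value_le eps0 m0 C dq) _.
rewrite index_cost_entropy// -addrA lerD2l -mulrDr ler_pM2l//.
have -> : 1 - avg p = avg (fun i => q i + -1 * p i).
  by rewrite avgD avgZ (index_density_mass m0 dq) mulN1r.
apply: (@le_trans _ _ (avg (fun i => (q i + -1 * p i) + del^-1 * (q i - p i) ^+ 2))).
  apply: le_avg => i; rewrite mulN1r.
  have pi0 := p0 i; have /andP[dp _] := pK i.
  apply: (@le_trans _ _ (q i - p i + (p i)^-1 * (q i - p i) ^+ 2)); last first.
    by rewrite lerD2l ler_wpM2r ?sqr_ge0// lef_pV2 ?posrE.
  have -> : q i - p i + (p i)^-1 * (q i - p i) ^+ 2 = q i * (q i / p i - 1).
    by field; rewrite gt_eqF.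
  have [qi|qi] := ltP 0 (q i); last first.
    have -> : q i = 0 by apply: le_anti; rewrite qi q0.
    by rewrite !mul0r.
  rewrite -ln_div ?posrE// ler_wpM2l//.
  have := @le_ln1Dx R (q i / p i - 1).
  by rewrite subrKC ltrBrDl subrr divr_gt0// => /(_ isT).
by rewrite avgD avgZ lerD2l ler_wpM2l// invr_ge0 ltW.
Qed.

End fixed_sample.

(** The lower bound holds for every admissible density; the upper one is reached by the
    density that rounding makes of p. *)
Lemma index_value_linearization : exists2 L : R, 0 <= L &
  forall n (u : 'I_m -> 'I_n.+1 -> R) (p : {ffun 'I_m -> 'I_n.+1} -> R),
  (forall i, del <= p i <= K) ->
  `|index_value eps (fun i : {ffun 'I_m -> 'I_n.+1} => \sum_j u j (i j) - eps * ln (p i)) -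
    \sum_j avg1 (u j)| <=
  L * (`|1 - avg p| + \sum_j avg1 (fun l => (marg j l p - 1) ^+ 2)).
Proof.
have [C C0 H] := rounding m0 del0 del1 K1.
have dC0 : 0 <= del^-1 * C by rewrite mulr_ge0// invr_ge0 ltW.
have eps0' := ltW eps0.
exists (eps * (1 + del^-1 * C)); first by rewrite mulr_ge0// addr_ge0.
move=> n u p pK; have [q [q0 mq qp]] := H n p pK.
have lo := index_value_linear_lower u pK.
have up := index_value_linear_upper u pK (conj q0 mq) qp.
move: lo up; set V := index_value _ _; set S := \sum_j avg1 (u j).
set eta := \sum_j _; set z := 1 - avg p => lo up.
have eta0 : 0 <= eta.
  by apply: sumr_ge0 => j _; apply: avg1_ge0 => l; exact: sqr_ge0.
have z1 : eps * z <= eps * `|z| by rewrite ler_pM2l// ler_norm.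
have z2 : - (eps * `|z|) <= eps * z.
  by rewrite -mulrN ler_pM2l// lerNl -normrN ler_norm.
have a1 : 0 <= eps * (del^-1 * C) * `|z| by rewrite !mulr_ge0// invr_ge0 ltW.
have a2 : 0 <= eps * eta by rewrite mulr_ge0.
have -> : eps * (1 + del^-1 * C) * (`|z| + eta) = eps * `|z| + eps * eta +
  eps * (del^-1 * C) * `|z| + eps * (del^-1 * C) * eta by ring.
have up' : V <= S + eps * z + eps * (del^-1 * C) * eta.
  by apply: le_trans up _; rewrite !mulrA.
by rewrite ler_norml; apply/andP; split; lra.
Qed.

End linearization.

(** * Second moments of degenerate averages *)

Section single_replacement.
Context d (T : measurableType d) (R : realType) (m : nat) (nu : 'I_m -> probability T R).
Implicit Types (j k : 'I_m) (y : m.-tuple T).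

Definition upd j (z : T * m.-tuple T) : m.-tuple T :=
  [tuple if k == j then z.1 else tnth z.2 k | k < m].

Lemma measurable_upd j : measurable_fun setT (upd j).
Proof.
apply/measurable_fun_tnthP => k.
rewrite (_ : _ \o _ = fun z => if k == j then z.1 else tnth z.2 k); last first.
  by apply/funext => z /=; rewrite tnth_mktuple.
case: eqP => _; first exact: measurable_fst.
exact: (measurableT_comp (@measurable_tnth _ T m k) measurable_snd).
Qed.

(** Replacing one coordinate by an independent one with the same law preserves the
    product law. *)
Lemma expect_upd j (F : m.-tuple T -> R) : bmeas F ->
  \int[prod_prob nu]_y F y = \int[nu j]_t \int[prod_prob nu]_y F (upd j (t, y)).
Proof.
move=> bF; rewrite -[RHS](@expect_prod1 _ _ _ _ _ (nu j) (prod_prob nu) (fun z => F (upd j z))); last first.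
  by apply: (bmeas_comp bF); exact: measurable_upd.
pose U := mfun_Sub (mem_set (measurable_upd j)).
apply: expect_law => //; first exact: measurable_upd.
move=> B mB; rewrite -[RHS]/(distribution (nu j \x prod_prob nu)%E U B).
apply: prod_prob_unique => // A mA.
rewrite /distribution /pushforward/=.
pose A' k := if k == j then setT else A k.
have mA' k : measurable (A' k) by rewrite /A'; case: ifP.
rewrite [X in product_measure1 _ _ X](_ : _ = A j `*` box A').
  have mb : measurable (box A') by exact: measurable_box.
  transitivity (nu j (A j) * prod_prob nu (box A'))%E; first exact: product_measure1E.
  rewrite (prod_prob_box nu mA') [RHS](bigD1 j)//=; congr (_ * _)%E.
  rewrite (bigD1 j)//= /A' eqxx probability_setT mul1e.
  by apply: eq_bigr => k /negbTE ->.
apply/seteqP; split => [[t y] /= Ay|[t y] /= [At Ay] k]; last first.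
  by rewrite tnth_mktuple; case: eqP => [->//|kj]; have := Ay k; rewrite /A'; case: eqP.
split; first by have := Ay j; rewrite tnth_mktuple eqxx.
move=> k; rewrite /A'; case: eqP => // kj.
by have := Ay k; rewrite tnth_mktuple; case: eqP.
Qed.

Lemma bmeas_upd j (F : m.-tuple T -> R) : bmeas F ->
  bmeas (fun t => \int[prod_prob nu]_y F (upd j (t, y))).
Proof.
move=> bF; apply: (bmeas_fubini1 (nu j) (prod_prob nu) (f := fun z => F (upd j z))).
by apply: (bmeas_comp bF); exact: measurable_upd.
Qed.

(** Tested against an indicator of the j-th coordinate, the marginal condition is an
    equality of integrals of this conditional mean and of 1. *)
Lemma conditional_mean1 j (p : m.-tuple T -> R) : bmeas p ->
  (forall B, measurable B ->
    \int[prod_prob nu]_x (\1_B (tnth x j) * p x) = fine (nu j B)) ->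
  {ae nu j, forall t, \int[prod_prob nu]_y p (upd j (t, y)) = 1}.
Proof.
move=> bp H; pose r t := \int[prod_prob nu]_y p (upd j (t, y)).
have br : bmeas r by exact: bmeas_upd.
have : ae_eq (nu j) setT (EFin \o r) (EFin \o (fun=> 1)).
  apply: integral_ae_eq => //; first exact: (bmeas_integrable (nu j) br).
    by apply/measurable_EFinP; exact: measurable_cst.
  move=> B _ mB.
  transitivity (\int[nu j]_t (\1_B t * r t))%:E; last first.
    transitivity (nu j B); last by rewrite integral_cst// mul1e.
    rewrite -[RHS]fineK ?fin_num_measure// -(H B mB) (expect_upd j); last first.
      by apply: bmeasM => //; apply: (@bmeas_tnth _ _ _ _ (\1_B)); exact: bmeas_indic.
    congr EFin; apply: eq_Rintegral => t _; rewrite -expectZ.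
      by apply: eq_Rintegral => y _; rewrite tnth_mktuple eqxx.
    apply: (@bmeas_pair1 _ _ _ _ _ (fun z => p (upd j z))).
    by apply: (bmeas_comp bp); exact: measurable_upd.
  rewrite Rintegral_EFin; last by apply: bmeasM => //; exact: bmeas_indic.
  rewrite integral_mkcond; apply: eq_integral => t _.
  by rewrite patchE indicE /=; case: (t \in B); rewrite ?mul1r ?mul0r.
by apply: filterS => t /(_ Logic.I)[].
Qed.

End single_replacement.

Section second_moments.
Context d (T : measurableType d) (R : realType) (m : nat) (nu : 'I_m -> probability T R).
Context dO (Om : measurableType dO) (P : probability Om R).
Context (X : 'I_m * nat -> {RV P >-> T}).
Hypothesis X_indep : independent_RVs X.
Hypothesis X_law : forall jk B, measurable B -> P (X jk @^-1` B) = nu jk.1 B.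
Hypothesis m0 : (0 < m)%N.
Let Q := prod_prob nu.

Definition idx (i : 'I_m -> nat) : m.-tuple ('I_m * nat) := [tuple (j, i j) | j < m].

Lemma uniq_idx i : uniq (idx i).
Proof. by rewrite map_inj_uniq ?enum_uniq// => j k []. Qed.

Lemma mem_idx i j l : ((j, l) \in idx i) = (l == i j).
Proof.
apply/idP/eqP => [/tnthP[k]|->]; first by rewrite tnth_mktuple => -[-> ->].
by apply/tnthP; exists j; rewrite tnth_mktuple.
Qed.

Lemma law_idx i : (fun k => nu (tnth (idx i) k).1) = nu.
Proof. by apply/funext => k; rewrite tnth_mktuple. Qed.

Lemma expect_sample_idx i (F : m.-tuple T -> R) : bmeas F ->
  \int[P]_w F (sample X (idx i) w) = \int[Q]_x F x.
Proof.
move=> bF; rewrite (expect_sample (nu := fun jk => nu jk.1) X_indep)//.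
  by rewrite law_idx.
exact: uniq_idx.
Qed.

Lemma bmeas_sample_idx i (F : m.-tuple T -> R) : bmeas F ->
  bmeas (fun w => F (sample X (idx i) w)).
Proof. by move=> bF; apply: (bmeas_comp bF); exact: measurable_sample. Qed.

Variable xi : m.-tuple T -> R.
Hypothesis bxi : bmeas xi.
Hypothesis xi0 : \int[Q]_x xi x = 0.
Hypothesis xi_degenerate : forall j, {ae nu j, forall t, \int[Q]_y xi (upd j (t, y)) = 0}.

Let uniq_disjoint (i i' : 'I_m -> nat) : (forall j, i j != i' j) ->
  uniq (idx i' ++ idx i).
Proof.
move=> ii'; rewrite cat_uniq !uniq_idx andbT/=; apply/hasPn => -[j l].
by rewrite !mem_idx => /eqP ->.
Qed.

(** The two blocks of variables share at most the j-th one, so that the others can be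
    integrated out of one of them; what is left is a conditional mean given that
    variable. *)
Lemma expect_degenerate (i i' : 'I_m -> nat) j : (forall k, k != j -> i k != i' k) ->
  \int[P]_w (xi (sample X (idx i) w) * xi (sample X (idx i') w)) = 0.
Proof.
move=> ii'.
have bF2 (F : m.-tuple T * m.-tuple T -> R) (i2 : 'I_m -> nat) : bmeas F ->
    (forall k, i k != i2 k) ->
    \int[P]_w F (sample X (idx i) w, sample X (idx i2) w) =
    \int[P]_w \int[Q]_y F (sample X (idx i) w, y).
  move=> bF ii2.
  rewrite (expect_freeze (nu := fun jk => nu jk.1) X_indep)// ?law_idx//.
  exact: uniq_disjoint.
have [ij|ij] := eqVneq (i j) (i' j); last first.
  rewrite (bF2 (fun z => xi z.1 * xi z.2)) => [|//|k].
  - rewrite -[RHS](expect_cst P 0); apply: eq_Rintegral => w _ /=.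
    by rewrite expectZ// -/Q xi0 mulr0.
  - by apply: bmeasM; apply: (bmeas_comp bxi).
  - by have [->|] := eqVneq k j; [exact: ij|exact: ii'].
(* A fresh index separates the blocks; the shared variable is put back by hand. *)
pose i2 k := if k == j then (i j).+1 else i' k.
pose U (z : m.-tuple T * m.-tuple T) := upd j (tnth z.1 j, z.2).
have mU : measurable_fun setT U.
  apply: (measurableT_comp (@measurable_upd _ T m j)).
  apply/measurable_fun_pair => //=.
  exact: (measurableT_comp (@measurable_tnth _ T m j)).
have bF : bmeas (fun z => xi z.1 * xi (U z)).
  by apply: bmeasM; [exact: (bmeas_comp bxi)|exact: (bmeas_comp bxi)].
transitivity (\int[P]_w (xi (sample X (idx i) w) *
    xi (U (sample X (idx i) w, sample X (idx i2) w)))).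
  apply: eq_Rintegral => w _; congr (_ * xi _); apply: eq_from_tnth => k.
  rewrite !tnth_mktuple /= /i2; case: eqP => [->|//].
  by rewrite ij.
rewrite (bF2 (fun z => xi z.1 * xi (U z)) i2 bF); last first.
  move=> k; rewrite /i2; have [->|kj] := eqVneq k j; last exact: ii'.
  by rewrite neq_ltn ltnS leqnn.
pose r t := \int[Q]_y xi (upd j (t, y)).
have br : bmeas r by exact: bmeas_upd.
transitivity (\int[P]_w (xi (sample X (idx i) w) * r (tnth (sample X (idx i) w) j))).
  apply: eq_Rintegral => w _ /=; rewrite expectZ//.
  apply: (bmeas_comp bxi); apply: (measurableT_comp (@measurable_upd _ T m j)).
  by apply/measurable_fun_pair => //=; exact: measurable_cst.
have bxr : bmeas (fun x => xi x * r (tnth x j)).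
  by apply: bmeasM => //; exact: bmeas_tnth.
rewrite (expect_sample_idx i bxr) -[RHS](expect_cst Q 0).
apply: expect_ae_eq => //; first exact: bmeas_cst.
apply: filterS (ae_tnth (xi_degenerate j)) => x.
by rewrite -/(r _) => ->; rewrite mulr0.
Qed.

Variable K : R.
Hypothesis xiK : forall x, `|xi x| <= K.

Variable n : nat.
Notation J := {ffun 'I_m -> 'I_n.+1}.
Let xis (i : J) w := xi (sample X (idx (fun j => i j : nat)) w).

Let bxis i : bmeas (xis i). Proof. exact: bmeas_sample_idx. Qed.

Let expect_avg (F : J -> Om -> R) : (forall i, bmeas (F i)) ->
  \int[P]_w avg (fun i => F i w) = avg (fun i => \int[P]_w F i w).
Proof.
move=> bF; rewrite /avg expectZ; last by apply: bmeas_sum.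
by rewrite expect_sum.
Qed.

Let bmeas_avg (F : J -> Om -> R) : (forall i, bmeas (F i)) ->
  bmeas (fun w => avg (fun i => F i w)).
Proof. by move=> bF; apply: bmeasZ; apply: bmeas_sum. Qed.

(** The only terms contributing to the second moment are those whose multi-indices share
    several coordinates; the kernel g dominates the indicator of such pairs. *)
Lemma expect_avg_sqr (a : J -> R) (g : J -> J -> R) :
  (forall i, 0 <= a i) -> (forall i i', 0 <= g i i') ->
  (forall i i' : J, (forall j, exists2 k, k != j & i k = i' k) -> 1 <= g i i') ->
  \int[P]_w (avg (fun i => a i * xis i w) ^+ 2) <=
  K ^+ 2 * avg (fun i => a i * avg (fun i' => a i' * g i i')).
Proof.
move=> a0 g0 g1.
have sq w : avg (fun i => a i * xis i w) ^+ 2 =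
    avg (fun i => avg (fun i' => a i * a i' * (xis i w * xis i' w))).
  rewrite expr2 -avgZ; apply: eq_avg => i; rewrite mulrC -avgZ.
  by apply: eq_avg => i'; ring.
under eq_Rintegral do rewrite sq.
have bx i i' : bmeas (fun w => xis i w * xis i' w) by exact: bmeasM.
rewrite expect_avg => [|i]; last by apply: bmeas_avg => i'; exact: bmeasZ.
rewrite -avgZ; apply: le_avg => i.
rewrite expect_avg => [|i']; last exact: bmeasZ.
rewrite mulrA -avgZ; apply: le_avg => i'; rewrite expectZ//.
rewrite (_ : K ^+ 2 * a i * (a i' * g i i') = a i * a i' * (K ^+ 2 * g i i')); last by ring.
rewrite ler_wpM2l ?mulr_ge0//.
have [good|bad] := pselect (exists j, forall k, k != j -> i k != i' k).
  have [j ij] := good.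
  by rewrite (@expect_degenerate (fun k => i k) (fun k => i' k) j ij) mulr_ge0 ?sqr_ge0.
have g1' : 1 <= g i i'.
  apply: g1 => // j; apply: contrapT => H; apply: bad; exists j => k kj.
  by apply/negP => /eqP ik; apply: H; exists k.
apply: (@le_trans _ _ (K ^+ 2)); last by rewrite ler_peMr// sqr_ge0.
apply: le_trans (ler_norm _) _; apply: expect_bound => // w.
by rewrite normrM expr2 ler_pM// /xis.
Qed.

Let agree j (i i' : J) : R := (i' j == i j)%:R.

(** Two given coordinates are shared by a proportion 1/N^2 of the pairs. *)
Lemma expect_total_sqr :
  \int[P]_w (avg (fun i => xis i w) ^+ 2) <= K ^+ 2 * (m%:R * m%:R) * n.+1%:R^-1 ^+ 2.
Proof.
pose g i i' := \sum_j \sum_(k | k != j) agree j i i' * agree k i i'.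
have := @expect_avg_sqr (fun=> 1) g (fun=> ler01).
have one w : avg (fun i => 1 * xis i w) = avg (fun i => xis i w).
  by apply: eq_avg => i; rewrite mul1r.
under eq_Rintegral do rewrite one.
move=> H; apply: (le_trans (H _ _)) => {H}.
- by move=> i i'; rewrite !sumr_ge0// => j _; rewrite sumr_ge0// => k _; rewrite mulr_ge0.
- move=> i i' H; have [j _ ij] := H (Ordinal m0); have [k kj ik] := H j.
  rewrite /g (bigD1 j)//= (bigD1 k)//= /agree ij ik !eqxx mulr1 -addrA lerDl addr_ge0//.
    by rewrite sumr_ge0// => l _; rewrite mulr_ge0.
  by rewrite sumr_ge0// => l _; rewrite sumr_ge0// => l' _; rewrite mulr_ge0.
rewrite -mulrA ler_wpM2l ?sqr_ge0// -[leRHS](@avg_cst R m n).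
apply: le_avg => i; rewrite mul1r; under eq_avg do rewrite mul1r; rewrite avg_sum.
apply: (@le_trans _ _ (\sum_(j < m) \sum_(k < m) n.+1%:R^-1 ^+ 2)); last first.
  by rewrite !sumr_const !card_ord -!mulrnA -(mulr_natl (_ ^+ 2)) natrM.
apply: ler_sum => j _; rewrite avg_sum big_mkcond/=; apply: ler_sum => k _.
case: ifPn => [kj|_]; last by rewrite exprn_ge0// invr_ge0.
rewrite (@avg_coord2 _ _ _ j k (fun l => (l == i j)%:R) (fun l => (l == i k)%:R)) ?(eq_sym j)//.
by rewrite !avg1_eq1 expr2.
Qed.

(** Here the j-th coordinate is already shared, and another one is shared by a proportion
    1/N of the pairs. *)
Lemma expect_marg_sqr j l :
  \int[P]_w (marg j l (fun i => xis i w) ^+ 2) <= K ^+ 2 * m%:R * n.+1%:R^-1.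
Proof.
pose N : R := n.+1%:R.
have N0 : N != 0 by rewrite pnatr_eq0.
pose a (i : J) := N * (i j == l)%:R.
pose g i i' := \sum_(k | k != j) agree k i i'.
have sq w : marg j l (fun i => xis i w) = avg (fun i => a i * xis i w).
  by rewrite /marg -(avgZ n.+1%:R); apply: eq_avg => i; rewrite mulrA.
under eq_Rintegral do rewrite sq.
have H := @expect_avg_sqr a g; apply: (le_trans (H _ _ _)) => {H}.
- by move=> i; rewrite mulr_ge0.
- by move=> i i'; rewrite sumr_ge0.
- move=> i i' H; have [k kj ik] := H j.
  by rewrite /g (bigD1 k)//= /agree ik eqxx lerDl sumr_ge0.
rewrite -mulrA ler_wpM2l ?sqr_ge0//.
rewrite (@eq_avg _ _ _ _ (fun i => N * (i j == l)%:R * \sum_(k | k != j) N^-1)); last first.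
  move=> i; congr (_ * _).
  under eq_avg do rewrite mulr_sumr.
  rewrite avg_sum; apply: eq_bigr => k kj.
  under eq_avg do rewrite -mulrA.
  rewrite avgZ (@avg_coord2 _ _ _ j k (fun t => (t == l)%:R) (fun t => (t == i k)%:R)).
    by rewrite !avg1_eq1 mulrA divff ?mul1r.
  by rewrite eq_sym.
under eq_avg do rewrite mulrC mulrA.
rewrite avgZ (avg_coord j (fun t => (t == l)%:R)) avg1_eq1 mulfK//.
apply: (@le_trans _ _ (\sum_(k < m) N^-1)); last by rewrite sumr_const card_ord mulr_natl.
rewrite big_mkcond/=; apply: ler_sum => k _; case: ifP => // _.
by rewrite invr_ge0.
Qed.

Lemma expect_error :
  \int[P]_w (`|avg (fun i => xis i w)| +
    \sum_j avg1 (fun l => marg j l (fun i => xis i w) ^+ 2)) <=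
  (K ^+ 2 * (m%:R * m%:R) + 1 + m%:R * (K ^+ 2 * m%:R)) * n.+1%:R^-1.
Proof.
have bZ : bmeas (fun w => avg (fun i => xis i w)) by exact: bmeas_avg.
have bM j l : bmeas (fun w => marg j l (fun i => xis i w)).
  by apply: bmeasZ; apply: bmeas_avg => i; exact: bmeasZ.
have bA j : bmeas (fun w => avg1 (fun l => marg j l (fun i => xis i w) ^+ 2)).
  by apply: bmeasZ; apply: bmeas_sum => l _; exact: bmeasX.
rewrite expectD; [|exact: bmeas_norm|exact: bmeas_sum].
rewrite mulrDl lerD//; last first.
  rewrite expect_sum//.
  apply: (@le_trans _ _ (\sum_(j < m) (K ^+ 2 * m%:R * n.+1%:R^-1))); last first.
    by rewrite sumr_const card_ord -(mulr_natl (_ * _)) mulrA.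
  apply: ler_sum => j _; rewrite /avg1 expectZ; last first.
    by apply: bmeas_sum => l _; exact: bmeasX.
  rewrite expect_sum; last by move=> l _; exact: bmeasX.
  rewrite -[leRHS](@avg1_cst R n); apply: le_avg1 => l; exact: expect_marg_sqr.
pose N : R := n.+1%:R; have N0 : 0 < N by rewrite ltr0n.
(* By the inequality 2 z <= N z^2 + 1 / N. *)
apply: (@le_trans _ _ (\int[P]_w (N * avg (fun i => xis i w) ^+ 2 + N^-1))).
  apply: expect_le; first exact: bmeas_norm.
    by apply: bmeasD; [apply: bmeasZ; exact: bmeasX|exact: bmeas_cst].
  move=> w; set z := avg _.
  have := sqr_ge0 (N * `|z| - 1).
  have -> : (N * `|z| - 1) ^+ 2 = N * (N * `|z| ^+ 2 - 2 * `|z| + N^-1).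
    by field; rewrite gt_eqF.
  rewrite pmulr_rge0// -(normrX 2 z) (ger0_norm (sqr_ge0 z)).
  move: (normr_ge0 z) (N * z ^+ 2) (N^-1) => z0 q y; lra.
have bNZ : bmeas (fun w => N * avg (fun i => xis i w) ^+ 2).
  by apply: bmeasZ; exact: bmeasX.
rewrite expectD//; last exact: bmeas_cst.
rewrite expect_cst expectZ; last exact: bmeasX.
rewrite mulrDl mul1r lerD2r.
have := expect_total_sqr; rewrite -(ler_pM2l N0) => /le_trans; apply.
by rewrite le_eqVlt; apply/orP; left; apply/eqP; rewrite -/N; field; rewrite gt_eqF.
Qed.

End second_moments.

(** * The central limit theorem *)

Section normal_approximation.
Context d (T : measurableType d) (R : realType) (m : nat) (nu : 'I_m -> probability T R).
Context dO (Om : measurableType dO) (P : probability Om R).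
Context (X : 'I_m * nat -> {RV P >-> T}).
Hypothesis X_indep : independent_RVs X.
Hypothesis X_law : forall jk B, measurable B -> P (X jk @^-1` B) = nu jk.1 B.
Variables (g : 'I_m -> T -> R) (L : R).
Hypothesis bg : forall j, bmeas (g j).
Hypothesis gL : forall j x, `|g j x| <= L.
Hypothesis g0 : forall j, \int[nu j]_x g j x = 0.
Let V j := \int[nu j]_x (g j x ^+ 2).

(** The case of Lindeberg's bound where each sample has its own law: there are N
    terms of third moment O(N^(-3/2)) per sample. *)
Lemma normal_approximation n K h : 0 <= K -> taylor3 K h ->
  `|\int[P]_w h (Num.sqrt n.+1%:R * \sum_j avg1 (fun l : 'I_n.+1 => g j (X (j, l : nat) w))) -
    \int[gaussian 0 (\sum_j V j)]_z h z| <=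
  K * (\sum_j (L ^+ 3 + 128 * Num.sqrt (V j) ^+ 3)) / Num.sqrt n.+1%:R.
Proof.
move=> K0 th; pose N : R := n.+1%:R.
have N0 : 0 < N by rewrite ltr0n.
pose r := (Num.sqrt N)^-1.
have r0 : 0 < r by rewrite invr_gt0 sqrtr_gt0.
have r0' := ltW r0.
have rN : N * r ^+ 2 = 1.
  by rewrite /r exprVn sqr_sqrtr ?divff ?gt_eqF// ltW.
have V0 j : 0 <= V j by apply: Rintegral_ge0 => x _; exact: sqr_ge0.
pose s := [seq (j, k) | j <- enum 'I_m, k <- iota 0 n.+1].
have sum_s (F : 'I_m * nat -> R) : \sum_(i <- s) F i = \sum_j \sum_(l < n.+1) F (j, l : nat).
  rewrite big_allpairs big_enum/=; apply: eq_bigr => j _.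
  by rewrite -(big_mkord xpredT (fun l => F (j, l))).
have us : uniq s.
  by apply: allpairs_uniq; [exact: enum_uniq|exact: iota_uniq|move=> [] ? ? [] ? ? _ _ []<- <-].
have bU (i : 'I_m * nat) : bmeas (fun x => r * g i.1 x) by exact: bmeasZ.
have v0 (i : 'I_m * nat) : 0 <= r ^+ 2 * V i.1 by rewrite mulr_ge0 ?sqr_ge0.
have cU (i : 'I_m * nat) : centred (nu i.1) (fun x => r * g i.1 x) (r ^+ 2 * V i.1) (r ^+ 3 * L ^+ 3).
  have b2 : bmeas (fun x => (r * g i.1 x) ^+ 2) by exact: bmeasX.
  have b3 : bmeas (fun x => `|r * g i.1 x| ^+ 3) by apply: bmeasX; exact: bmeas_norm.
  split; split.
  - exact: bmeas_meas.
  - exact: (bmeas_integrable (nu i.1) (bU i)).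
  - exact: (bmeas_integrable (nu i.1) b2).
  - exact: (bmeas_integrable (nu i.1) b3).
  - by rewrite expectZ// g0 mulr0.
  - rewrite -expectZ; last exact: bmeasX.
    by apply: eq_Rintegral => x _; rewrite exprMn.
  - rewrite -[leRHS](expect_cst (nu i.1)); apply: expect_le => //; first exact: bmeas_cst.
    move=> x; rewrite normrM exprMn (ger0_norm r0'); apply: ler_wpM2l.
      by rewrite exprn_ge0.
    by rewrite lerXn2r ?nnegrE// (le_trans (normr_ge0 _) (gL i.1 x)).
have := lindeberg (nu := fun i => nu i.1) X_indep X_law bU v0 cU 0 us K0 th.
have -> : \sum_(i <- s) r ^+ 2 * V i.1 = \sum_j V j.
  rewrite sum_s; apply: eq_bigr => j _ /=; rewrite sumr_const card_ord -(mulr_natl (_ * _)).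
  by rewrite mulrA rN mul1r.
have -> : \sum_(i <- s) (r ^+ 3 * L ^+ 3 + 128 * Num.sqrt (r ^+ 2 * V i.1) ^+ 3) =
    (\sum_j (L ^+ 3 + 128 * Num.sqrt (V j) ^+ 3)) * r.
  rewrite sum_s mulr_suml; apply: eq_bigr => j _ /=.
  rewrite sumr_const card_ord -(mulr_natl (_ + _)) sqrtrM ?sqr_ge0// sqrtr_sqr.
  rewrite (ger0_norm r0') -/N -[RHS]mul1r -rN.
  by ring.
rewrite mulrA => H; apply: le_trans H; rewrite le_eqVlt; apply/orP; left; apply/eqP.
congr (`|_ - _|); last by apply: eq_Rintegral => z _; rewrite add0r.
apply: eq_Rintegral => w _; rewrite sum_s add0r; congr h.
rewrite mulr_sumr; apply: eq_bigr => j _; rewrite /avg1 -mulr_sumr mulrA; congr (_ * _).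
by rewrite -/N -[in LHS](sqr_sqrtr (ltW N0)) sqrtr_sqr ger0_norm ?sqrtr_ge0// expr2 invfM mulrA divff ?mul1r// gt_eqF ?sqrtr_gt0.
Qed.

End normal_approximation.

Section central_limit.
Context d (T : measurableType d) (R : realType) (m : nat).
Variables (A : 'I_m -> set T) (c : m.-tuple T -> R) (eps : R).
Hypotheses (mA : forall j, measurable (A j)) (eps0 : 0 < eps) (m0 : (0 < m)%N).
Hypothesis mset1 : forall x : T, measurable [set x].
Let cA := c \_ (box A).
Hypothesis bcA : bmeas cA.
Variables (nu : 'I_m -> probability T R) (u : 'I_m -> T -> R).
Hypotheses (nuA : forall j, nu j (A j) = 1%E) (bu : forall j, bmeas (u j)).
Hypothesis marginals : forall j B, measurable B ->
  \int[prod_prob nu]_x (\1_B (tnth x j) * expR (gibbs A c eps u x)) = fine (nu j B).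
Context dO (Om : measurableType dO) (P : probability Om R).
Context (X : 'I_m * nat -> {RV P >-> T}).
Hypothesis X_indep : independent_RVs X.
Hypothesis X_law : forall jk B, measurable B -> P (X jk @^-1` B) = nu jk.1 B.

Let pts w (j : 'I_m) (k : nat) : T := X (j, k) w.
Let p y := expR (gibbs A c eps u y).
Let hat n w j : probability T R := empirical R n (pts w j).

Definition sample_value n w : R :=
  index_value eps (fun i : {ffun 'I_m -> 'I_n.+1} => cA (grid_point (pts w) i)).

Definition sample_mean n w : R := \sum_j avg1 (fun l : 'I_n.+1 => u j (X (j, l : nat) w)).

Let point_sample n w (i : {ffun 'I_m -> 'I_n.+1}) :
  grid_point (pts w) i = sample X (idx (fun j => i j : nat)) w.
Proof. by apply: eq_from_tnth => j; rewrite !tnth_mktuple. Qed.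

Let bp : bmeas p. Proof. exact: bmeas_expR (bmeas_gibbs eps bcA bu). Qed.

Lemma bmeas_sample_value n : bmeas (sample_value n).
Proof.
have bC (i : {ffun 'I_m -> 'I_n.+1}) : bmeas (fun w => cA (grid_point (pts w) i)).
  under eq_fun do rewrite point_sample.
  exact: bmeas_sample_idx.
split.
  apply: (@measurable_lipschitz _ _ _ _ (@index_value R m n eps)) => [C C'|i].
    exact: index_value_lipschitz.
  exact: bmeas_meas.
have [mc [K hK]] := bcA.
pose v0 : R := @index_value R m n eps (fun=> 0).
exists (`|v0| + \sum_(i : {ffun 'I_m -> 'I_n.+1}) K) => w.
have := index_value_lipschitz eps0 m0 (fun i : {ffun 'I_m -> 'I_n.+1} => cA (grid_point (pts w) i)) (fun=> 0).
rewrite -/(sample_value n w) => H.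
rewrite -(subrK v0 (sample_value n w)).
rewrite (le_trans (ler_normD _ _))// addrC lerD2l (le_trans H)//.
by apply: ler_sum => i _; rewrite subr0.
Qed.

Lemma bmeas_sample_mean n : bmeas (sample_mean n).
Proof.
apply: bmeas_sum => j _; apply: bmeasZ; apply: bmeas_sum => l _.
by apply: (bmeas_comp (bu j)); exact: measurable_funPT.
Qed.

(** Linearization reduces the error to averages of the degenerate function p - 1. *)
Lemma sample_value_error : exists2 C, 0 <= C &
  forall n, \int[P]_w `|sample_value n w - sample_mean n w| <= C / n.+1%:R.
Proof.
have [mg [B0 gB0]] := bmeas_gibbs eps bcA bu.
pose B := `|B0|.
have gB y : `|gibbs A c eps u y| <= B by exact: le_trans (gB0 y) (ler_norm _).
have K1 : 1 <= expR B by rewrite -expR0 ler_expR normr_ge0.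
have del1 : expR (- B) <= 1 by rewrite -expR0 ler_expR oppr_le0 normr_ge0.
have pK y : expR (- B) <= p y <= expR B.
  by rewrite /p !ler_expR -ler_norml.
have [L L0 lin] := index_value_linearization eps0 m0 (expR_gt0 (- B)) del1 K1.
pose xi y := p y - 1.
have bxi : bmeas xi by apply: bmeasB => //; exact: bmeas_cst.
have xiK y : `|xi y| <= expR B.
  have /andP[_ h] := pK y; have := expR_gt0 (gibbs A c eps u y); rewrite -/(p y) => h0.
  by rewrite ler_norml /xi; apply/andP; split; lra.
have xi0 : \int[prod_prob nu]_x xi x = 0.
  rewrite expectB ?expect_cst//; last exact: bmeas_cst.
  by rewrite (gibbs_mass1 m0 marginals) subrr.
(* Degeneracy is the marginal condition of the Gibbs density. *)
have xi_deg j : {ae nu j, forall t, \int[prod_prob nu]_y xi (upd j (t, y)) = 0}.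
  apply: filterS (conditional_mean1 bp (@marginals j)) => t ht.
  rewrite expectB ?expect_cst ?ht ?subrr//; last exact: bmeas_cst.
  apply: (@bmeas_pair1 _ _ _ _ _ (fun z => p (upd j z))).
  by apply: (bmeas_comp bp); exact: measurable_upd.
have err := expect_error X_indep X_law m0 bxi xi0 xi_deg xiK.
set C := _ + _ in err.
exists (L * C).
  by rewrite mulr_ge0 ?addr_ge0 ?mulr_ge0 ?sqr_ge0.
move=> n; pose xis (i : {ffun 'I_m -> 'I_n.+1}) w := xi (sample X (idx (fun j => i j : nat)) w).
have bxis i : bmeas (xis i) by exact: bmeas_sample_idx.
pose D w := `|avg (fun i => xis i w)| + \sum_j avg1 (fun l => marg j l (fun i => xis i w) ^+ 2).
have bD : bmeas D.
  apply: bmeasD; first by apply: bmeas_norm; apply: bmeasZ; exact: bmeas_sum.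
  apply: bmeas_sum => j _; apply: bmeasZ; apply: bmeas_sum => l _; apply: bmeasX.
  by apply: bmeasZ; apply: bmeasZ; apply: bmeas_sum => i _; exact: bmeasZ.
rewrite -mulrA; apply: (@le_trans _ _ (L * \int[P]_w D w)); last first.
  by rewrite ler_wpM2l//; exact: err.
rewrite -expectZ//; apply: expect_le.
- by apply: bmeas_norm; apply: bmeasB; [exact: bmeas_sample_value|exact: bmeas_sample_mean].
- exact: bmeasZ.
move=> w; pose pw (i : {ffun 'I_m -> 'I_n.+1}) := p (grid_point (pts w) i).
have := lin n (fun j l => u j (X (j, l : nat) w)) pw (fun i => pK _).
have -> : index_value eps (fun i : {ffun 'I_m -> 'I_n.+1} =>
    \sum_j u j (X (j, i j : nat) w) - eps * ln (pw i)) = sample_value n w.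
  congr (index_value _ _); apply/funext => i.
  rewrite /pw /p expRK /gibbs mulrC divfK ?gt_eqF//.
  have -> : \sum_(j < m) u j (tnth (grid_point (pts w) i) j) = \sum_j u j (X (j, i j : nat) w).
    by apply: eq_bigr => j _; rewrite tnth_mktuple.
  by rewrite opprB addrC subrK.
have -> : `|1 - avg pw| = `|avg (fun i => xis i w)|.
  rewrite -normrN; congr (`|_|).
  rewrite (@eq_avg _ _ _ (fun i => xis i w) (fun i => pw i + -1 * 1)); last first.
    by move=> i; rewrite /xis -point_sample mulN1r.
  by rewrite avgD avgZ avg_cst; ring.
have mE j l : marg j l pw - 1 = marg j l (fun i => xis i w).
  rewrite (@eq_marg _ _ _ _ _ (fun i => xis i w) (fun i => pw i + -1 * 1)); last first.
    by move=> i _; rewrite /xis -point_sample mulN1r.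
  by rewrite margD margZ marg_cst; ring.
under [X in _ <= _ * (_ + X)]eq_bigr do under eq_avg1 do rewrite mE.
by [].
Qed.

Let in_support n w := forall j (l : 'I_n.+1), A j (X (j, l : nat) w).

Lemma fine_eot_sample n w : in_support n w ->
  fine (eot A c eps (hat n w)) = sample_value n w.
Proof. by move=> Aw; rewrite (@eot_empirical _ _ _ _ n). Qed.

(** An empirical measure with an atom outside of A has no coupling, so that the infimum
    is +oo, of which fine is 0. *)
Lemma fine_eot_outside n w : ~ in_support n w -> fine (eot A c eps (hat n w)) = 0.
Proof.
move=> nA; rewrite /eot; set E := (X in ereal_inf X).
suff -> : E = set0 by rewrite ereal_inf0.
rewrite -subset0 => r [pi [piA piE] _]; apply: nA => j l.
have mj : measurable ((fun x : m.-tuple T => tnth x j) @^-1` A j).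
  by rewrite -[X in measurable X]setTI; exact: measurable_tnth.
have hA : hat n w j (A j) = 1%E.
  rewrite -piE//; apply/eqP; rewrite eq_le probability_le1//= -piA.
  apply: le_measure; rewrite ?inE//; first exact: measurable_box.
  by move=> y; exact.
have hA' : hat n w j (~` A j) = 0%E by rewrite probability_setC// hA subee.
have N1 : 0 < n.+1%:R^-1 :> R by rewrite invr_gt0.
apply: contrapT => nAl.
exact: (atomic_null (fun=> ltW N1) (@atomic_empirical _ _ R _ n (pts w) j)
  (measurableC (mA j)) hA' N1 (i := l)).
Qed.

Lemma ae_in_support n : {ae P, forall w, in_support n w}.
Proof.
apply: filter_forall => j; apply: filter_forall => l.
exists (~` (X (j, l : nat) @^-1` A j)); split => //.
  by apply: measurableC; apply: measurable_funPTI.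
have mX : measurable (X (j, l : nat) @^-1` A j) by exact: measurable_funPTI.
by rewrite probability_setC// X_law// nuA subee.
Qed.

Let S := \sum_j \int[nu j]_y u j y.
Let V j := \int[nu j]_y ((u j y - \int[nu j]_z u j z) ^+ 2).

Let Y n w := Num.sqrt n.+1%:R * (fine (eot A c eps (hat n w)) - fine (eot A c eps nu)).
Let Y' n w := Num.sqrt n.+1%:R * (sample_value n w - S).

Let eot_nu : fine (eot A c eps nu) = S.
Proof. by rewrite (eot_optimal mA eps0 bcA nuA bu m0 marginals). Qed.

Let mY n : measurable_fun setT (Y n).
Proof.
rewrite /Y eot_nu; apply: measurable_funM; first exact: measurable_cst.
apply: measurable_funB; last exact: measurable_cst.
pose G := [set w | in_support n w].
have mG : measurable G.
  rewrite [G](_ : _ = \bigcap_(j in [set: 'I_m]) \bigcap_(l in [set: 'I_n.+1])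
      (X (j, l : nat) @^-1` A j)).
    apply: fin_bigcap_measurable => // j _; apply: fin_bigcap_measurable => // l _.
    exact: measurable_funPTI.
  by apply/seteqP; split => [w Gw j _ l _|w Gw j l]; [exact: Gw|exact: Gw].
rewrite [X in measurable_fun _ X](_ : _ = (sample_value n) \_ G).
  apply/(measurable_restrictT _ mG).1; apply: measurable_funTS.
  exact: bmeas_meas (bmeas_sample_value n).
apply/funext => w; rewrite patchE; case: ifPn => [/set_mem|/negP] h.
  exact: fine_eot_sample.
by apply: fine_eot_outside => h'; apply: h; exact/mem_set.
Qed.

(** Test functions are Lipschitz, so that an error of expectation O(1/N) on the value
    costs O(1/sqrt N) after scaling, as does the normal approximation. *)
Theorem cvg_in_law_eot : cvg_in_law P Y (gaussian 0 (\sum_j V j)).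
Proof.
apply: cvg_in_law_taylor3 => // K h K0 th; have bh := th.1.
have [L L0 hL] := taylor3_lipschitz K0 th.
have [C C0 err] := sample_value_error.
pose g j x := u j x - \int[nu j]_z u j z.
have bg j : bmeas (g j) by apply: bmeasB => //; exact: bmeas_cst.
have [G gG] : exists G, forall j x, `|g j x| <= G.
  have /choice[G hG] j : exists G, forall x, `|g j x| <= G by have [] := bg j.
  exists (\sum_j `|G j|) => j x; apply: (le_trans (hG j x)).
  by rewrite (bigD1 j)//= (le_trans (ler_norm _))// lerDl sumr_ge0.
have g0 j : \int[nu j]_x g j x = 0.
  by rewrite expectB ?expect_cst ?subrr//; exact: bmeas_cst.
have clt n := normal_approximation X_indep X_law bg gG g0 n K0 th.
pose W n w : R := Num.sqrt n.+1%:R * \sum_j avg1 (fun l : 'I_n.+1 => g j (X (j, l : nat) w)).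
have WE n w : W n w = Num.sqrt n.+1%:R * (sample_mean n w - S).
  rewrite /W; congr (_ * _); rewrite /sample_mean /S -sumrB; apply: eq_bigr => j _.
  rewrite (@eq_avg1 _ _ _ (fun l => u j (X (j, l : nat) w) + -1 * \int[nu j]_z u j z)).
    by rewrite avg1D avg1_cst mulN1r.
  by move=> l; rewrite mulN1r.
have bV n := bmeas_sample_value n; have bM n := bmeas_sample_mean n.
have mY' n : measurable_fun setT (Y' n).
  by apply: bmeas_meas; apply: bmeasZ; apply: bmeasB => //; exact: bmeas_cst.
have mW n : measurable_fun setT (W n).
  have -> : W n = fun w => Num.sqrt n.+1%:R * (sample_mean n w - S).
    by apply/funext => w; exact: WE.
  by apply: bmeas_meas; apply: bmeasZ; apply: bmeasB => //; exact: bmeas_cst.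
pose D := L * C + K * \sum_(j < m) (G ^+ 3 + 128 * Num.sqrt (\int[nu j]_x (g j x ^+ 2)) ^+ 3).
have main n : `|\int[P]_w h (Y n w) - \int[gaussian 0 (\sum_j V j)]_z h z| <=
    D / Num.sqrt n.+1%:R.
  have sN0 : 0 < Num.sqrt n.+1%:R :> R by rewrite sqrtr_gt0.
  have -> : \int[P]_w h (Y n w) = \int[P]_w h (Y' n w).
    apply: expect_ae_eq; [exact: (bmeas_comp bh)|exact: (bmeas_comp bh)|].
    by apply: filterS (ae_in_support n) => w Aw; rewrite /Y /Y' fine_eot_sample// eot_nu.
  apply: le_trans (ler_distD (\int[P]_w h (W n w)) _ _) _.
  rewrite /D mulrDl; apply: lerD; last exact: clt.
  rewrite -expectB; [|exact: (bmeas_comp bh)..].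
  apply: le_trans (expect_norm _ _) _.
    by apply: bmeasB; exact: (bmeas_comp bh).
  have bVM : bmeas (fun w => `|sample_value n w - sample_mean n w|).
    by apply: bmeas_norm; exact: bmeasB.
  apply: (@le_trans _ _ (\int[P]_w (L * Num.sqrt n.+1%:R * `|sample_value n w - sample_mean n w|))).
    apply: expect_le.
    - by apply: bmeas_norm; apply: bmeasB; exact: (bmeas_comp bh).
    - exact: bmeasZ.
    move=> w; apply: (le_trans (hL _ _)); rewrite -mulrA ler_wpM2l// WE /Y' -mulrBr.
    by rewrite normrM (ger0_norm (ltW sN0)) opprB addrA subrK.
  rewrite expectZ//.
  apply: le_trans (ler_wpM2l _ (err n)) _; first by rewrite mulr_ge0// ltW.
  have nE : n.+1%:R = Num.sqrt n.+1%:R ^+ 2 :> R by rewrite sqr_sqrtr.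
  rewrite [X in C / X]nE; move: (Num.sqrt _) sN0 => s s0.
  by rewrite le_eqVlt; apply/orP; left; apply/eqP; field; rewrite gt_eqF.
apply/cvgrPdist_le => e e0; near=> n; rewrite distrC; apply: (le_trans (main n)).
have sN0 : 0 < Num.sqrt n.+1%:R :> R by rewrite sqrtr_gt0.
rewrite ler_pdivrMr// mulrC -ler_pdivrMr//.
apply: (le_trans (ler_norm _)); rewrite -sqrtr_sqr ler_sqrt//.
apply: (@le_trans _ _ n%:R); last by rewrite ler_nat.
by near: n; exact: nbhs_infty_ger.
Unshelve. all: by end_near. Qed.

End central_limit.

Section euclidean_borel_sets.
Context (R : realType) (d : nat).

Lemma measurable_closed_borelRn (A : set 'rV[R]_d) : closed A ->
  measurable (A : set (borelRn R d)).
Proof.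
move=> cA; rewrite -[A]setCK; apply: measurableC.
by apply: sub_gen_smallest; exact: closed_openC.
Qed.

Lemma measurable_set1_borelRn (x : borelRn R d) : measurable [set x].
Proof.
apply: (@measurable_closed_borelRn [set (x : 'rV[R]_d)]).
apply: accessible_closed_set1; apply: hausdorff_accessible; exact: norm_hausdorff.
Qed.

Lemma measurable_compact_borelRn (A : set 'rV[R]_d) : compact A ->
  measurable (A : set (borelRn R d)).
Proof.
by move=> cA; apply: measurable_closed_borelRn; apply: compact_closed => //; exact: norm_hausdorff.
Qed.

End euclidean_borel_sets.

Lemma fine_variance d (T : measurableType d) (R : realType) (P : probability T R) (f u : T -> R) :
  measurable_fun setT f -> bmeas u -> {ae P, forall x, f x = u x} ->
  fine 'V_P[f] = \int[P]_x ((u x - \int[P]_y u y) ^+ 2).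
Proof.
move=> mf bu fu.
have Ef : 'E_P[f]%E = (\int[P]_y u y)%:E.
  rewrite Rintegral_EFin// unlock; apply: ae_eq_integral => //.
  - exact/measurable_EFinP.
  - by apply/measurable_EFinP; exact: bmeas_meas.
  - by apply: filterS fu => x -> _.
rewrite /variance unlock Ef /= unlock; congr fine; apply: ae_eq_integral => //.
- by apply/measurable_EFinP; apply: measurable_funM; apply: measurable_funB.
- apply/measurable_EFinP; apply: bmeas_meas; apply: bmeasX; apply: bmeasB => //.
  exact: bmeas_cst.
- by apply: filterS fu => x fx _; rewrite expr2 -fx.
Qed.

Theorem theorem4p5 (R : realType) (m d : nat) (hm : (2 <= m)%N)
  (hd : (1 <= d)%N) (eps : R) (heps : 0 < eps)
  (A : 'I_m -> set (borelRn R d))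
  (A_compact : forall j, compact (A j : set 'rV[R]_d))
  (A_interior : forall j, (A j : set 'rV[R]_d)° !=set0)
  (A_cube : forall j (x : 'rV[R]_d), A j x ->
     forall i : 'I_d, -1 <= x ord0 i <= 1)
  (nu : 'I_m -> probability (borelRn R d) R)
  (nu_A : forall j, nu j (A j) = 1%E)
  (c : m.-tuple (borelRn R d) -> R)
  (c_meas : measurable_fun (box A) c)
  (c_bounded : [bounded c x | x in box A])
  (f : 'I_m -> borelRn R d -> R)
  (f_opt : optimal_potentials A c eps nu f)
  (dO : measure_display) (Om : measurableType dO) (P : probability Om R)
  (X : 'I_m * nat -> {RV P >-> borelRn R d})
  (X_law : forall j k (B : set (borelRn R d)), measurable B ->
     distribution P (X (j, k)) B = nu j B)
  (X_indep : independent_RVs X) :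
  cvg_in_law P
    (fun N w => Num.sqrt N.+1%:R *
       (fine (eot A c eps (fun j => empirical R N (fun k => X (j, k) w)))
        - fine (eot A c eps nu)))
    (gaussian 0 (\sum_(j < m) fine 'V_(nu j)[f j])).

Proof.
have m0 : (0 < m)%N by exact: leq_trans hm.
have mA j : measurable (A j) by exact: measurable_compact_borelRn.
have bcA : bmeas (c \_ (box A)) by apply: bmeas_patch => //; exact: measurable_box.
have [[fL _] _] := f_opt.
have mf j : measurable_fun setT (f j).
  by have := fL j; rewrite inE => /andP[]; rewrite inE.
have /choice[u uP] : forall j, exists u, bmeas u /\ {ae nu j, forall x, f j x = u x}.
  by move=> j; have [u bu fu] := Lfun_truncation (fL j); exists u.
have bu j : bmeas (u j) := (uP j).1.
have fu j : {ae nu j, forall x, f j x = u j x} := (uP j).2.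
have marginals := optimal_marginals mA heps bcA nu_A m0 f_opt bu fu.
have law jk B : measurable B -> P (X jk @^-1` B) = nu jk.1 B.
  by case: jk => j k; exact: X_law.
have := cvg_in_law_eot mA heps m0 (@measurable_set1_borelRn R d) bcA nu_A bu
  marginals X_indep law.
by under eq_bigr do rewrite -(fine_variance (mf _) (bu _) (fu _)).
Qed.
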